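(* Let $H\in\mathbb{R}$, let $U_H=\{x\in\mathbb{R}^2: x_2>H\}$ and $T_H=\{x\in\mathbb{R}^2:x_2=H\}$. Then for all $x,y\in\mathbb{R}^2\setminus\overline{U_H}$, $$\int_{T_H}\left([\Pi^{(1)}(\xi,x)]^T\,\overline{\Gamma(\xi,y)}-[\Gamma(\xi,x)]^T\,\overline{\Pi^{(1)}(\xi,y)}\right)ds(\xi)=2i\,\mathrm{Im}_+\Gamma(y,x),$$ where $\Pi^{(1)}$ is formed with the unit normal $\boldsymbol n=(0,1)$ on $T_H$ pointing into $U_H$.
   Context: Constants: $\omega>0$, Lamé constants $\mu>0$, $\lambda+\mu\ge 0$, $k_p=\omega/\sqrt{2\mu+\lambda}$, $k_s=\omega/\sqrt{\mu}$. Fix real numbers $\tilde\mu,\tilde\lambda$ with $\tilde\mu+\tilde\lambda=\mu+\lambda$. Fundamental solution of the Navier equation $\mu\Delta\boldsymbol u+(\lambda+\mu)\,\mathrm{grad}\,\mathrm{div}\,\boldsymbol u+\omega^2\boldsymbol u=0$ in $\mathbb{R}^2$: for $x\ne y$, $$\Gamma(x,y)=\frac1\mu \boldsymbol I\,\Phi_{k_s}(x,y)+\frac1{\omega^2}\nabla_x^T\nabla_x\big(\Phi_{k_s}(x,y)-\Phi_{k_p}(x,y)\big),\qquad \Phi_k(x,y)=\frac i4H_0^{(1)}(k|x-y|),$$ where $\nabla_x^T\nabla_x$ is the Hessian matrix and $\boldsymbol I$ the $2\times2$ identity matrix. Generalised stress operator on a curve with unit normal $\boldsymbol n=(n_1,n_2)$: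 $$\boldsymbol P\boldsymbol u=(\mu+\tilde\mu)\frac{\partial\boldsymbol u}{\partial\boldsymbol n}+\tilde\lambda\,\boldsymbol n\,\mathrm{div}\,\boldsymbol u-\tilde\mu\,\boldsymbol n^\perp\,\mathrm{div}^\perp\boldsymbol u,\quad \boldsymbol n^\perp=(-n_2,n_1),\quad \mathrm{div}^\perp\boldsymbol u=-\partial_2u_1+\partial_1u_2 .$$ $\Pi^{(1)}_{jk}(x,y)=\big(\boldsymbol P^{(x)}(\Gamma_{\cdot k}(x,y))\big)_j$, i.e. $\boldsymbol P$ is applied in the variable $x$ to the $k$-th column of $\Gamma$. With $\mathbb{S}^1_+=\{\boldsymbol d\in\mathbb{R}^2:|\boldsymbol d|=1,\ d_2>0\}$ and $\boldsymbol d\otimes\boldsymbol d=\boldsymbol d\boldsymbol d^T$, $$\mathrm{Im}_+\Gamma(x,y)=\frac1{8\pi}\left[\frac1{\lambda+2\mu}\int_{\mathbb{S}^1_+}\boldsymbol d\otimes\boldsymbol d\,e^{ik_p(x-y)\cdot\boldsymbol d}ds(\boldsymbol d)+\frac1\mu\int_{\mathbb{S}^1_+}(\boldsymbol I-\boldsymbol d\otimes\boldsymbol d)e^{ik_s(x-y)\cdot\boldsymbol d}ds(\boldsymbol d)\right].$$ The integral over $T_H$ is understood as the improper integral $\lim_{R\to\infty}\int_{\{\xi\in T_H:\,|\xi_1|\le R\}}$. *)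

(* Defs.v *)
From Stdlib Require Import Reals Arith Factorial.
From Coquelicot Require Import Coquelicot.
Open Scope R_scope.

(* Stdlib reals with Coquelicot.  Vector and matrix coordinates are numbered
   from 0: index 0 stands for the subscript 1 and index 1 for the subscript 2. *)

Definition point : Type := (R * R)%type.

Definition coord (j : nat) (x : point) : R :=
  match j with O => fst x | _ => snd x end.

Definition dot (x y : point) : R := fst x * fst y + snd x * snd y.
Definition sub (x y : point) : point := (fst x - fst y, snd x - snd y).
Definition dist (x y : point) : R := sqrt (dot (sub x y) (sub x y)).

Definition harmonic (n : nat) : R := sum_n_m (fun k => / INR k) 1 n.

Definition euler_gamma : R := Lim_seq (fun n => harmonic n - ln (INR n)).

Definition bessel_J0 (z : R) : R :=
  PSeries (fun k => (-1) ^ k / INR (fact k) ^ 2) ((z / 2) ^ 2).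

(* Y_0(z) = (2/pi) [ (ln(z/2) + gamma) J_0(z)
                     - sum_k (-1)^k H_k / (k!)^2 (z^2/4)^k ],  z > 0. *)
Definition bessel_Y0 (z : R) : R :=
  2 / PI * ((ln (z / 2) + euler_gamma) * bessel_J0 z
            - PSeries (fun k => (-1) ^ k * harmonic k / INR (fact k) ^ 2)
                      ((z / 2) ^ 2)).

Definition hankel1_0 (z : R) : C := (RtoC (bessel_J0 z) + Ci * RtoC (bessel_Y0 z))%C.

Definition Phi (k : R) (x y : point) : C :=
  (Ci / RtoC 4 * hankel1_0 (k * dist x y))%C.

Definition derive_RC (f : R -> C) (t : R) : C :=
  (Derive (fun s => Re (f s)) t, Derive (fun s => Im (f s)) t).

Definition pderiv (j : nat) (f : point -> C) (x : point) : C :=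
  match j with
  | O => derive_RC (fun t => f (t, snd x)) (fst x)
  | _ => derive_RC (fun t => f (fst x, t)) (snd x)
  end.

Definition mat : Type := matrix (T := C) 2 2.

Definition entry (A : mat) (j k : nat) : C := coeff_mat (RtoC 0) A j k.
Definition build (f : nat -> nat -> C) : mat := mk_matrix 2 2 f.
Definition trmat (A : mat) : mat := build (fun j k => entry A k j).
Definition conjmat (A : mat) : mat := build (fun j k => Cconj (entry A j k)).
Definition mulmat (A B : mat) : mat := Mmult (T := C_Ring) A B.
Definition submat (A B : mat) : mat :=
  build (fun j k => (entry A j k - entry B j k)%C).
Definition scalmat (c : C) (A : mat) : mat :=
  build (fun j k => (c * entry A j k)%C).

Definition delta (j k : nat) : R := if Nat.eqb j k then 1 else 0.

Definition hessian (f : point -> C) (x : point) : mat :=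
  build (fun j k => pderiv j (pderiv k f) x).

Definition kp (om mu lam : R) : R := om / sqrt (2 * mu + lam).
Definition ks (om mu : R) : R := om / sqrt mu.

Definition Gamma (om mu lam : R) (x y : point) : mat :=
  build (fun j k =>
    (RtoC (/ mu * delta j k) * Phi (ks om mu) x y
     + RtoC (/ om ^ 2)
       * entry (hessian (fun z => Phi (ks om mu) z y - Phi (kp om mu lam) z y) x)
               j k)%C).

(* A vector field is given by its components [u 0] and [u 1]. *)
Definition vfield : Type := nat -> point -> C.

Definition ndiff (n : point) (f : point -> C) (x : point) : C :=
  (RtoC (fst n) * pderiv 0 f x + RtoC (snd n) * pderiv 1 f x)%C.

Definition div (u : vfield) (x : point) : C :=
  (pderiv 0 (u 0%nat) x + pderiv 1 (u 1%nat) x)%C.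

Definition div_perp (u : vfield) (x : point) : C :=
  (- pderiv 1 (u 0%nat) x + pderiv 0 (u 1%nat) x)%C.

Definition perp (n : point) : point := (- snd n, fst n).

Definition stress (mu tmu tlam : R) (n : point) (u : vfield) : vfield :=
  fun j x =>
    (RtoC (mu + tmu) * ndiff n (u j) x
     + RtoC (tlam * coord j n) * div u x
     - RtoC (tmu * coord j (perp n)) * div_perp u x)%C.

Definition Pi1 (om mu lam tmu tlam : R) (n x y : point) : mat :=
  build (fun j k =>
    stress mu tmu tlam n (fun l z => entry (Gamma om mu lam z y) l k) j x).

Definition expi (t : R) : C := (cos t, sin t).

Definition integral_RC (f : R -> C) (a b : R) : C :=
  RInt (V := C_R_CompleteNormedModule) f a b.

(* Arc-length parametrisation of the open upper half circle. *)
Definition dir (th : R) : point := (cos th, sin th).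

Definition integral_upper_circle (f : point -> C) : C :=
  integral_RC (fun th => f (dir th)) 0 PI.

Definition ImplusGamma (om mu lam : R) (x y : point) : mat :=
  build (fun j k =>
    (RtoC (/ (8 * PI)) *
     (RtoC (/ (lam + 2 * mu)) *
        integral_upper_circle (fun d =>
          RtoC (coord j d * coord k d)
          * expi (kp om mu lam * dot (sub x y) d))
      + RtoC (/ mu) *
        integral_upper_circle (fun d =>
          RtoC (delta j k - coord j d * coord k d)
          * expi (ks om mu * dot (sub x y) d))))%C).

Definition U (H : R) (x : point) : Prop := H < snd x.

Definition closure (A : point -> Prop) (x : point) : Prop :=
  forall V : point -> Prop, locally x V -> exists z : point, V z /\ A z.

(* [F] has improper integral [L] over the line [x_2 = H], in the sense of
   symmetric truncation [|xi_1| <= r] with [r] tending to infinity; the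
   truncated integrals are required to exist. *)
Definition is_improper_integral_T (H : R) (F : point -> mat) (L : mat) : Prop :=
  forall j k : nat, (j < 2)%nat -> (k < 2)%nat ->
    (forall r : R, 0 < r ->
       ex_RInt (V := C_R_NormedModule) (fun t => entry (F (t, H)) j k) (- r) r) /\
    filterlim (fun r => integral_RC (fun t => entry (F (t, H)) j k) (- r) r)
              (Rbar_locally p_infty) (locally (entry L j k)).

(* Main.v *)
(* Above both sources the columns of Γ(·,x) and of the conjugate of Γ(·,y) solve
   the Navier equation, so by Betti's identity the bilinear stress flux is
   divergence free, and its integral over the part |ξ_1| <= r of T_H equals the
   one over the upper half circle of radius r centred at (0,H).  Far away each
   column splits into a pressure wave polarised along the normal and a shear wave
   polarised across it; the mixed terms of the flux vanish and the two pure ones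
   converge, uniformly in the angle, to the integrands of Im_+ Γ.

   All that is needed of Φ_k is that z^(1/2) e^{-iz} H_0^(1)(z) has a limit c
   with |c|^2 = 2/π.  This is read off from the steepest-descent form
     H_0^(1)(z) = (2/π) e^{iz} ∫_0^{π/2} e^{-z sin^2 η / cos η} (1 - i / cos η) dη
   of the Mehler-Sommerfeld integral (2/πi) ∫_0^∞ e^{iz cosh t} dt.  The right-hand
   side solves Bessel's equation, and comparing logarithmic behaviour at 0, where
   Euler's constant enters through H_n = ∫_0^n (1 - (1 - x/n)^n) / x dx, identifies
   it with the power series.  The value of |c| comes from the Wronskian. *)

(* The half circle suits the flux because its normal is the direction of propagation and its length
   element [r] compensates exactly the two factors [r^(-1/2)] of the fields. Equality with the flux
   through the line is a comparison of derivatives in [r], both integrals vanishing at [r = 0]. A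
   mixed product of a shear and a pressure wave carries the factor [e^(i(k_s - k_p)r)], which has no
   limit; such a term disappears only because the leading stress form pairs orthogonal polarisations
   to zero at every angle. On polarisations across the normal that form has the value [mu], on those
   along it [mu + tmu + tlam = lam + 2 mu], so [tmu] and [tlam] act through their sum alone. The
   phase of [c] cancels against its conjugate, and [|c|^2 / (16 k) = 1/(8 pi k)] times [i(k + k)] is
   the constant [2i/(8 pi)] of the claim. *)
Require Import Defs.
From Stdlib Require Import Reals Arith Factorial Lra Lia Psatz.
From Coquelicot Require Import Coquelicot.
Open Scope R_scope.

(* The canonical structures of Coquelicot often leave an equation between reals
   typed in [R_NormedModule], where [ring] fails. *)
Ltac Req := match goal with |- @eq _ ?a ?b => change (@eq R a b) end.
Ltac Ceq := apply injective_projections; simpl; ring.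
Ltac Cfield := apply injective_projections; simpl; field; lra.
Ltac inv_pos := left; apply Rinv_0_lt_compat; lra.

Lemma sin_cos_sq (t : R) : sin t * sin t + cos t * cos t = 1.
Proof. exact (sin2_cos2 t). Qed.

Lemma is_RInt_RInt (f : R -> R) (a b : R) : ex_RInt f a b -> is_RInt f a b (RInt f a b).
Proof. apply (RInt_correct (V := R_CompleteNormedModule)). Qed.

(** * Power series of [J_0] and [Y_0] in the variable [w = z^2/4] *)

Definition aJ (k : nat) : R := (-1) ^ k / INR (fact k) ^ 2.
Definition aY (k : nat) : R := (-1) ^ k * harmonic k / INR (fact k) ^ 2.

Lemma harmonic_S (n : nat) : harmonic (S n) = harmonic n + / INR (S n).
Proof.
  unfold harmonic. rewrite sum_n_Sm by lia. reflexivity.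
Qed.

Lemma harmonic_pos (n : nat) : 0 < harmonic (S n).
Proof.
  induction n as [|n IH]; rewrite harmonic_S.
  - unfold harmonic. rewrite sum_n_m_zero by lia.
    unfold zero; simpl. lra.
  - assert (0 < / INR (S (S n))) by (apply Rinv_0_lt_compat, lt_0_INR; lia). lra.
Qed.

(** Coefficient form of [w f'' + f' + f = 0], which is Bessel's equation in the variable
    [w = z^2/4]. *)
Lemma aJ_S (n : nat) : INR (S n) ^ 2 * aJ (S n) = - aJ n.
Proof.
  unfold aJ. rewrite fact_simpl, mult_INR. simpl pow.
  assert (INR (S n) <> 0) by (apply not_0_INR; lia).
  assert (INR (fact n) <> 0) by (apply INR_fact_neq_0).
  field. split; assumption.
Qed.

Lemma aY_aJ (n : nat) : aY n = harmonic n * aJ n.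
Proof. unfold aY, aJ, Rdiv. ring. Qed.

Lemma aJ_neq_0 (n : nat) : aJ n <> 0.
Proof.
  unfold aJ. apply Rmult_integral_contrapositive_currified.
  - apply pow_nonzero. lra.
  - apply Rinv_neq_0_compat, pow_nonzero, INR_fact_neq_0.
Qed.

Lemma aJ_ratio (n : nat) : aJ (S n) / aJ n = - / INR (S n) ^ 2.
Proof.
  assert (INR (S n) <> 0) by (apply not_0_INR; lia).
  assert (H1 := aJ_S n).
  replace (aJ n) with (- (INR (S n) ^ 2 * aJ (S n))) by lra.
  assert (aJ (S n) <> 0) by (apply aJ_neq_0). field. auto.
Qed.

Lemma is_lim_seq_inv_S : is_lim_seq (fun n => / INR (S n)) 0.
Proof.
  apply (is_lim_seq_incr_1 (fun n => / INR n)).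
  apply (is_lim_seq_inv INR p_infty); [apply is_lim_seq_INR | discriminate].
Qed.

Lemma CV_radius_aJ : CV_radius aJ = p_infty.
Proof.
  apply CV_radius_infinite_DAlembert; [exact aJ_neq_0|].
  apply (is_lim_seq_le_le (fun _ => 0) _ (fun n => / INR (S n)));
    [|apply is_lim_seq_const | apply is_lim_seq_inv_S].
  intros n. rewrite aJ_ratio, Rabs_Ropp.
  assert (1 <= INR (S n)) by (apply (le_INR 1); lia).
  assert (Hp : 0 < / INR (S n)) by (apply Rinv_0_lt_compat; lra).
  rewrite <- pow_inv. rewrite Rabs_right by nra.
  assert (/ INR (S n) <= 1) by (rewrite <- Rinv_1; apply Rinv_le_contravar; lra).
  nra.
Qed.

Lemma CV_radius_aY : CV_radius aY = p_infty.
Proof.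
  (* [harmonic 0 = 0] makes [aY 0] vanish, so the ratio test, which asks for nonzero coefficients,
     is applied to the shifted sequence. *)
  rewrite <- CV_radius_decr_1.
  apply CV_radius_infinite_DAlembert.
  - intros n. unfold PS_decr_1. rewrite aY_aJ.
    apply Rmult_integral_contrapositive_currified; [|apply aJ_neq_0].
    assert (H := harmonic_pos n). lra.
  - apply (is_lim_seq_le_le (fun _ => 0) _ (fun n => 2 * / INR (S n))).
    2: apply is_lim_seq_const.
    2: { replace (Finite 0) with (Rbar_mult (Finite 2) (Finite 0)).
         apply is_lim_seq_scal_l, is_lim_seq_inv_S. simpl; f_equal; ring. }
    intros n. split; [apply Rabs_pos|]. unfold PS_decr_1.
    rewrite !aY_aJ.
    assert (Hh := harmonic_pos n). assert (Ha := aJ_neq_0 (S n)).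
    replace (harmonic (S (S n)) * aJ (S (S n)) / (harmonic (S n) * aJ (S n)))
      with (harmonic (S (S n)) / harmonic (S n) * (aJ (S (S n)) / aJ (S n)))
      by (field; split; [exact Ha| lra]).
    rewrite aJ_ratio, Rabs_mult, Rabs_Ropp.
    assert (H1 : 1 <= INR (S n)) by (apply (le_INR 1); lia).
    assert (H2 : INR (S (S n)) = INR (S n) + 1) by (rewrite (S_INR (S n)); ring).
    assert (Hq : 1 <= harmonic (S n)).
    { clear. induction n as [|n IH].
      - unfold harmonic. rewrite sum_n_n. simpl. lra.
      - rewrite harmonic_S.
        assert (0 < / INR (S (S n))) by (apply Rinv_0_lt_compat, lt_0_INR; lia). lra. }
    assert (Hp : 0 < / INR (S (S n))) by (apply Rinv_0_lt_compat; lra).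
    assert (Hp1 : / INR (S (S n)) <= / INR (S n)) by (apply Rinv_le_contravar; lra).
    assert (Hp2 : / INR (S n) <= 1) by (rewrite <- Rinv_1; apply Rinv_le_contravar; lra).
    rewrite <- pow_inv. rewrite (Rabs_right (_ ^ 2)) by nra.
    (* The numerator exceeds the denominator by at most 1, and the denominator is at least 1. *)
    assert (H3 : 0 < harmonic (S (S n)) / harmonic (S n) <= 2).
    { rewrite harmonic_S. split.
      - apply Rdiv_lt_0_compat; lra.
      - apply Rmult_le_reg_r with (harmonic (S n)); [lra|].
        unfold Rdiv. rewrite Rmult_assoc, Rinv_l by lra. lra. }
    rewrite Rabs_right by lra.
    set (h := harmonic (S (S n)) / harmonic (S n)) in *.
    set (p := / INR (S (S n))) in *. apply Rle_trans with (2 * p ^ 2).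
    + apply Rmult_le_compat_r; nra.
    + nra.
Qed.

Section Entire.
Variable a : nat -> R.
Hypothesis Ha : CV_radius a = p_infty.

Lemma entire_ex (x : R) : ex_pseries a x.
Proof. apply CV_radius_inside. rewrite Ha. exact I. Qed.

Lemma entire_derive_radius : CV_radius (PS_derive a) = p_infty.
Proof. rewrite CV_radius_derive. exact Ha. Qed.

Lemma entire_is_derive (x : R) :
  is_derive (PSeries a) x (PSeries (PS_derive a) x).
Proof. apply is_derive_PSeries. rewrite Ha. exact I. Qed.
End Entire.

(** The suffixes count derivatives in [w], they are not orders of Bessel functions:
    [J_0(z) = j0 (z^2/4)], and [y0] is the part of [Y_0] without the logarithm. *)
Definition j0 : R -> R := PSeries aJ.
Definition j1 : R -> R := PSeries (PS_derive aJ).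
Definition j2 : R -> R := PSeries (PS_derive (PS_derive aJ)).
Definition y0 : R -> R := PSeries aY.
Definition y1 : R -> R := PSeries (PS_derive aY).
Definition y2 : R -> R := PSeries (PS_derive (PS_derive aY)).

Lemma is_derive_j0 (x : R) : is_derive j0 x (j1 x).
Proof. apply entire_is_derive, CV_radius_aJ. Qed.
Lemma is_derive_j1 (x : R) : is_derive j1 x (j2 x).
Proof. apply entire_is_derive, entire_derive_radius, CV_radius_aJ. Qed.
Lemma is_derive_y0 (x : R) : is_derive y0 x (y1 x).
Proof. apply entire_is_derive, CV_radius_aY. Qed.
Lemma is_derive_y1 (x : R) : is_derive y1 x (y2 x).
Proof. apply entire_is_derive, entire_derive_radius, CV_radius_aY. Qed.

(** At [x^n] the term [x f''] contributes [n(n+1) a_(n+1)] and [f'] contributes [(n+1) a_(n+1)],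
    which add up to the square. *)
Lemma PSeries_euler (a : nat -> R) (x : R) : CV_radius a = p_infty ->
  x * PSeries (PS_derive (PS_derive a)) x + PSeries (PS_derive a) x + PSeries a x
  = PSeries (fun k => INR (S k) ^ 2 * a (S k) + a k) x.
Proof.
  intros Ha. assert (Hb := entire_derive_radius a Ha).
  assert (Hc := entire_derive_radius _ Hb).
  rewrite <- PSeries_incr_1.
  rewrite <- PSeries_plus by
    (apply entire_ex; rewrite ?CV_radius_incr_1; assumption).
  rewrite <- PSeries_plus.
  - apply PSeries_ext. intros [|n]; unfold PS_plus, PS_incr_1, PS_derive, plus, zero; simpl plus.
    + simpl. ring.
    + change (INR (S n) * (INR (S (S n)) * a (S (S n))) + INR (S (S n)) * a (S (S n)) + a (S n)
        = INR (S (S n)) ^ 2 * a (S (S n)) + a (S n)).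
      rewrite (S_INR (S n)). ring.
  - apply ex_pseries_plus; apply entire_ex; rewrite ?CV_radius_incr_1; assumption.
  - apply entire_ex; assumption.
Qed.

Lemma j_ode (x : R) : x * j2 x + j1 x + j0 x = 0.
Proof.
  unfold j0, j1, j2. rewrite PSeries_euler by exact CV_radius_aJ.
  rewrite (PSeries_ext _ (fun _ => 0)); [apply PSeries_const_0|].
  intros n. rewrite aJ_S. ring.
Qed.

(** The right-hand side comes from [H_(n+1) - H_n = 1/(n+1)]. In [Y_0] it balances the term
    [2 J_0'/z] that arises when Bessel's operator is applied to the logarithm times [J_0]. *)
Lemma y_ode (x : R) : x * y2 x + y1 x + y0 x = j1 x.
Proof.
  unfold y0, y1, y2, j1. rewrite PSeries_euler by exact CV_radius_aY.
  apply PSeries_ext. intros n. unfold PS_derive.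
  rewrite !aY_aJ, harmonic_S.
  assert (INR (S n) <> 0) by (apply not_0_INR; lia).
  replace (aJ n) with (- (INR (S n) ^ 2 * aJ (S n))) by (rewrite aJ_S; ring).
  field. assumption.
Qed.

Lemma j0_0 : j0 0 = 1.
Proof. unfold j0. rewrite PSeries_0. unfold aJ. simpl. field. Qed.
Lemma y0_0 : y0 0 = 0.
Proof. unfold y0. rewrite PSeries_0, aY_aJ. unfold harmonic. rewrite sum_n_m_zero by lia. unfold zero; simpl. ring. Qed.

(** * Differentiation rules for real functions *)

Lemma is_derive_eq (f : R -> R) (x a b : R) :
  is_derive f x a -> a = b -> is_derive f x b.
Proof. intros H <-. exact H. Qed.

Lemma derR_id (x : R) : is_derive (fun t : R => t) x 1.
Proof. apply (is_derive_id x). Qed.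

Lemma derR_const (c t : R) : is_derive (fun _ : R => c) t 0.
Proof. apply (is_derive_const (V := R_NormedModule) c t). Qed.

Lemma derR_mult (f g : R -> R) (x a b : R) :
  is_derive f x a -> is_derive g x b ->
  is_derive (fun t => f t * g t) x (a * g x + f x * b).
Proof. intros Hf Hg. apply (is_derive_mult f g x a b Hf Hg). intros; apply Rmult_comm. Qed.

Lemma derR_plus (f g : R -> R) (x a b : R) :
  is_derive f x a -> is_derive g x b -> is_derive (fun t => f t + g t) x (a + b).
Proof. intros Hf Hg. apply (is_derive_plus f g x a b Hf Hg). Qed.

Lemma derR_minus (f g : R -> R) (x a b : R) :
  is_derive f x a -> is_derive g x b -> is_derive (fun t => f t - g t) x (a - b).
Proof. intros Hf Hg. apply (is_derive_minus f g x a b Hf Hg). Qed.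

Lemma derR_opp (f : R -> R) (x a : R) : is_derive f x a -> is_derive (fun t => - f t) x (- a).
Proof. intros Hf. apply (is_derive_opp f x a Hf). Qed.

Lemma derR_scal (f : R -> R) (x c a : R) :
  is_derive f x a -> is_derive (fun t => c * f t) x (c * a).
Proof. intros Hf. apply (is_derive_scal f x c a Hf). Qed.

Lemma derR_comp (f g : R -> R) (x a b : R) :
  is_derive f (g x) a -> is_derive g x b -> is_derive (fun t => f (g t)) x (a * b).
Proof.
  intros Hf Hg. assert (H := is_derive_comp f g x a b Hf Hg).
  refine (is_derive_eq _ _ _ _ H _). unfold scal; simpl; unfold mult; simpl. ring.
Qed.

Lemma is_derive_continuous (f : R -> R) (x l : R) : is_derive f x l -> continuous f x.
Proof. intros H. apply (ex_derive_continuous f x). exists l. exact H. Qed.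

Lemma const_on_halfline (f : R -> R) (a b c : R) :
  (forall t, a < t -> is_derive f t 0) -> a < b -> a < c -> f b = f c.
Proof.
  intros Hf Hb Hc.
  destruct (Rtotal_order b c) as [H|[->|H]]; [|reflexivity|].
  - apply (eq_is_derive f b c); [|exact H]. intros t Ht. apply Hf. lra.
  - symmetry. apply (eq_is_derive f c b); [|exact H]. intros t Ht. apply Hf. lra.
Qed.

(** The Wronskian of [J_0] and [Y_0] after the logarithms have cancelled. Its derivative is a
    combination of [j_ode] and [y_ode], hence zero, and at [w = 0] only [j0 0 = 1] survives. *)
Lemma series_wronskian (w : R) : 0 < w ->
  j0 w * j0 w - 2 * w * (j0 w * y1 w - j1 w * y0 w) = 1.
Proof.
  intros Hw.
  pose (f := fun w => j0 w * j0 w - 2 * w * (j0 w * y1 w - j1 w * y0 w)).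
  assert (H : f 0 = f w).
  { apply (eq_is_derive f 0 w); [|exact Hw]. intros t _.
    assert (D0 := is_derive_j0 t). assert (D1 := is_derive_j1 t).
    assert (E0 := is_derive_y0 t). assert (E1 := is_derive_y1 t).
    assert (K : is_derive (fun w => 2 * w) t (2 * 1)) by (apply derR_scal, derR_id).
    eapply is_derive_eq.
    - apply derR_minus; [apply derR_mult; eassumption|].
      apply derR_mult; [exact K|].
      apply derR_minus; apply derR_mult; eassumption.
    - unfold zero; simpl. assert (A := j_ode t). assert (B := y_ode t).
      replace (j2 t) with (j2 t + 0) by ring.
      replace (j1 t * j0 t + j0 t * j1 t -
        (2 * 1 * (j0 t * y1 t - j1 t * y0 t) +
         2 * t * (j1 t * y1 t + j0 t * y2 t - ((j2 t + 0) * y0 t + j1 t * y1 t))))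
      with (2 * y0 t * (t * j2 t + j1 t + j0 t) - 2 * j0 t * ((t * y2 t + y1 t + y0 t) - j1 t))
        by ring.
      rewrite A, B. ring. }
  unfold f in H. rewrite j0_0 in H. rewrite <- H. ring.
Qed.

(** * Bessel's equation of order zero and its solution space *)

Definition bessel_pair (f f' : R -> R) : Prop :=
  forall z, 0 < z -> is_derive f z (f' z) /\ is_derive f' z (- f' z / z - f z).

Definition bessel_J0' (z : R) : R := z / 2 * j1 ((z / 2) ^ 2).
Definition bessel_Y0' (z : R) : R :=
  2 / PI * (bessel_J0 z / z + (ln (z / 2) + euler_gamma) * bessel_J0' z
            - z / 2 * y1 ((z / 2) ^ 2)).

Lemma bessel_J0_eq (z : R) : bessel_J0 z = j0 ((z / 2) ^ 2).
Proof. reflexivity. Qed.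
Lemma bessel_Y0_eq (z : R) : bessel_Y0 z =
  2 / PI * ((ln (z / 2) + euler_gamma) * bessel_J0 z - y0 ((z / 2) ^ 2)).
Proof. reflexivity. Qed.

Lemma is_derive_quarter_sq (z : R) : is_derive (fun z => (z / 2) ^ 2) z (z / 2).
Proof. auto_derive; [exact I|]. field. Qed.

Lemma is_derive_half (z : R) : is_derive (fun z => z / 2) z (/ 2).
Proof. auto_derive; [exact I|]. field. Qed.

Lemma bessel_J0_pair : bessel_pair bessel_J0 bessel_J0'.
Proof.
  intros z Hz. split.
  - eapply is_derive_eq.
    + apply (derR_comp j0 (fun z => (z / 2) ^ 2)); [apply is_derive_j0 | apply is_derive_quarter_sq].
    + unfold bessel_J0'. ring.
  - eapply is_derive_eq.
    + apply derR_mult; [apply is_derive_half|].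
      apply (derR_comp j1 (fun z => (z / 2) ^ 2)); [apply is_derive_j1 | apply is_derive_quarter_sq].
    + unfold bessel_J0'. rewrite bessel_J0_eq. assert (A := j_ode ((z / 2) ^ 2)).
      set (w := (z / 2) ^ 2) in *.
      replace (j0 w) with (- (w * j2 w + j1 w)) by lra.
      subst w. field. lra.
Qed.

Lemma is_derive_ln_half (z : R) : 0 < z ->
  is_derive (fun z => ln (z / 2) + euler_gamma) z (/ z).
Proof. intros Hz. auto_derive; [lra|]. field. lra. Qed.

Lemma is_derive_Rinv (z : R) : 0 < z -> is_derive Rinv z (- / z ^ 2).
Proof. intros Hz. auto_derive; [lra|]. field. lra. Qed.

Lemma bessel_Y0_pair : bessel_pair bessel_Y0 bessel_Y0'.
Proof.
  intros z Hz. destruct (bessel_J0_pair z Hz) as [J1 J2].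
  assert (HP := PI_RGT_0).
  assert (S0 := derR_comp y0 (fun z => (z / 2) ^ 2) z _ _ (is_derive_y0 _) (is_derive_quarter_sq z)).
  assert (S1 := derR_comp y1 (fun z => (z / 2) ^ 2) z _ _ (is_derive_y1 _) (is_derive_quarter_sq z)).
  cbv beta in S0, S1.
  assert (L := is_derive_ln_half z Hz). split.
  - eapply is_derive_eq.
    + apply derR_scal, derR_minus; [|exact S0]. apply derR_mult; [exact L|exact J1].
    + unfold bessel_Y0'. unfold Rdiv; ring.
  - eapply is_derive_eq.
    + apply derR_scal, derR_minus; [|apply derR_mult; [apply is_derive_half|exact S1]].
      apply derR_plus; [|apply derR_mult; [exact L|exact J2]].
      apply derR_mult; [exact J1| apply is_derive_Rinv; exact Hz].
    + unfold bessel_Y0'. rewrite bessel_Y0_eq.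
      assert (A := y_ode ((z / 2) ^ 2)).
      set (l := ln (z / 2) + euler_gamma). 
      unfold bessel_J0'. set (w := (z / 2) ^ 2) in *.
      replace (y0 w) with (j1 w - (w * y2 w + y1 w)) by lra.
      set (J := bessel_J0 z). subst w. field. lra.
Qed.

(** Abel's identity: the Wronskian satisfies [W' = - W / z], so [z W] has derivative zero. *)
Lemma wronskian_const (f f' g g' : R -> R) (z z' : R) :
  bessel_pair f f' -> bessel_pair g g' -> 0 < z -> 0 < z' ->
  z * (f z * g' z - f' z * g z) = z' * (f z' * g' z' - f' z' * g z').
Proof.
  intros Hf Hg.
  apply (const_on_halfline (fun z => z * (f z * g' z - f' z * g z)) 0).
  intros t Ht. destruct (Hf t Ht) as [F1 F2]. destruct (Hg t Ht) as [G1 G2].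
  eapply is_derive_eq.
  - apply derR_mult; [apply derR_id|].
    apply derR_minus; apply derR_mult; eassumption.
  - unfold one; simpl. field. lra.
Qed.

Lemma wronskian_JY (z : R) : 0 < z ->
  z * (bessel_J0 z * bessel_Y0' z - bessel_J0' z * bessel_Y0 z) = 2 / PI.
Proof.
  intros Hz. assert (HP := PI_RGT_0).
  assert (H := series_wronskian ((z / 2) ^ 2)).
  rewrite bessel_Y0_eq. unfold bessel_Y0', bessel_J0'. rewrite bessel_J0_eq.
  set (w := (z / 2) ^ 2) in *. set (l := ln (z / 2) + euler_gamma).
  assert (Hw : 0 < w) by (unfold w; nra). specialize (H Hw).
  transitivity (2 / PI * (j0 w * j0 w - 2 * w * (j0 w * y1 w - j1 w * y0 w))).
  - subst w. field. lra.
  - rewrite H. ring.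
Qed.

(** Cramer's rule with the denominator [z W(J_0, Y_0) = 2/pi]. The numerators are again [z] times
    Wronskians, hence constant, and may be evaluated at 1. *)
Lemma bessel_pair_decomp (f f' : R -> R) : bessel_pair f f' ->
  exists al be : R, forall z, 0 < z ->
    f z = al * bessel_J0 z + be * bessel_Y0 z /\
    f' z = al * bessel_J0' z + be * bessel_Y0' z.
Proof.
  intros Hf. assert (HP := PI_RGT_0).
  exists (PI / 2 * (1 * (f 1 * bessel_Y0' 1 - f' 1 * bessel_Y0 1))),
         (PI / 2 * (1 * (bessel_J0 1 * f' 1 - bessel_J0' 1 * f 1))).
  intros z Hz.
  rewrite (wronskian_const f f' bessel_Y0 bessel_Y0' 1 z Hf bessel_Y0_pair) by lra.
  rewrite (wronskian_const bessel_J0 bessel_J0' f f' 1 z bessel_J0_pair Hf) by lra.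
  assert (W := wronskian_JY z Hz).
  split.
  - transitivity (PI / 2 * f z * (z * (bessel_J0 z * bessel_Y0' z - bessel_J0' z * bessel_Y0 z))).
    + rewrite W. field. lra.
    + ring.
  - transitivity (PI / 2 * f' z * (z * (bessel_J0 z * bessel_Y0' z - bessel_J0' z * bessel_Y0 z))).
    + rewrite W. field. lra.
    + ring.
Qed.

(** * The integral representation *)

Lemma cont2_fst (p : R * R) : continuous (fun p : R * R => fst p) p.
Proof. apply continuous_fst. Qed.
Lemma cont2_snd (p : R * R) : continuous (fun p : R * R => snd p) p.
Proof. apply continuous_snd. Qed.
Lemma cont2_const (c : R) (p : R * R) : continuous (fun _ : R * R => c) p.
Proof. apply continuous_const. Qed.
Lemma cont2_plus (f g : R * R -> R) (p : R * R) :
  continuous f p -> continuous g p -> continuous (fun p => f p + g p) p.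
Proof. intros Hf Hg. apply (continuous_plus f g p Hf Hg). Qed.
Lemma cont2_minus (f g : R * R -> R) (p : R * R) :
  continuous f p -> continuous g p -> continuous (fun p => f p - g p) p.
Proof. intros Hf Hg. apply (continuous_minus f g p Hf Hg). Qed.
Lemma cont2_mult (f g : R * R -> R) (p : R * R) :
  continuous f p -> continuous g p -> continuous (fun p => f p * g p) p.
Proof. intros Hf Hg. apply (continuous_mult f g p Hf Hg). Qed.
Lemma cont2_comp (f : R -> R) (g : R * R -> R) (p : R * R) :
  continuous g p -> continuous f (g p) -> continuous (fun p => f (g p)) p.
Proof. intros Hg Hf. apply (continuous_comp g f p Hg Hf). Qed.
Lemma cont2_pair (f g : R * R -> R) (h : R * R -> R) (p : R * R) :
  continuous f p -> continuous g p -> continuous h (f p, g p) ->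
  continuous (fun p => h (f p, g p)) p.
Proof.
  intros Hf Hg Hh. apply (continuous_comp_2 f g (fun x y => h (x, y)) p Hf Hg).
  apply continuous_ext with h; [intros [a b]; reflexivity|exact Hh].
Qed.

(* For [c > 0] this is [e^(-z (1/c - c)) c^(2-m)], to be used at [c = cos η]; it is
   extended by 0 so that integrands are smooth across [η = π/2]. *)
Definition ker (m : nat) (z c : R) : R :=
  if Rlt_dec 0 c then exp (- (z * (/ c - c))) * c ^ 2 * (/ c) ^ m else 0.

Lemma ker_pos (m : nat) (z c : R) : 0 < c ->
  ker m z c = exp (- (z * (/ c - c))) * c ^ 2 * (/ c) ^ m.
Proof. intros H. unfold ker. destruct (Rlt_dec 0 c); [reflexivity|lra]. Qed.

Lemma ker_npos (m : nat) (z c : R) : c <= 0 -> ker m z c = 0.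
Proof. intros H. unfold ker. destruct (Rlt_dec 0 c); [lra|reflexivity]. Qed.

Lemma ker_ge_0 (m : nat) (z c : R) : 0 <= ker m z c.
Proof.
  destruct (Rlt_dec 0 c) as [H|H]; [rewrite ker_pos by exact H|rewrite ker_npos by lra; lra].
  apply Rmult_le_pos; [apply Rmult_le_pos|].
  - left; apply exp_pos.
  - apply pow_le; lra.
  - apply pow_le. left; apply Rinv_0_lt_compat; exact H.
Qed.

Lemma ker_mult (m : nat) (z c : R) : c * ker (S m) z c = ker m z c.
Proof.
  destruct (Rlt_dec 0 c) as [H|H].
  - rewrite !ker_pos by exact H. simpl. field. lra.
  - rewrite !ker_npos by lra. ring.
Qed.

Lemma exp_INR_mult (k : nat) (y : R) : exp (INR k * y) = exp y ^ k.
Proof.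
  induction k as [|k IH]; [simpl; rewrite Rmult_0_l; apply exp_0|].
  rewrite S_INR, Rmult_plus_distr_r, exp_plus, IH, Rmult_1_l. simpl. ring.
Qed.

(** With [x = n y] this is the [n]-th power of [y <= e^y]. *)
Lemma pow_le_exp (n : nat) (x : R) : 0 <= x -> x ^ n <= INR n ^ n * exp x.
Proof.
  intros Hx. destruct n as [|n].
  - simpl. assert (H := exp_ineq1_le x). lra.
  - assert (Hn : 0 < INR (S n)) by (apply lt_0_INR; lia).
    set (y := x / INR (S n)).
    assert (Hxy : x = INR (S n) * y) by (unfold y; field; lra).
    assert (Hy : 0 <= y) by (apply Rmult_le_pos; [exact Hx|left; apply Rinv_0_lt_compat; exact Hn]).
    rewrite Hxy, Rpow_mult_distr, exp_INR_mult.
    apply Rmult_le_compat_l; [apply pow_le; lra|].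
    apply pow_incr. assert (H := exp_ineq1_le y). lra.
Qed.

Lemma exp_le (a b : R) : a <= b -> exp a <= exp b.
Proof. intros [H| ->]; [left; apply exp_increasing; exact H|lra]. Qed.

(** Near [c = 0] the factor [e^(-u/c)] beats every power of [1/c], uniformly for [u] close to [z]:
    [pow_le_exp] with exponent [m + n] absorbs [c^(-m)] and leaves [c^n]. This makes the extension
    by 0 differentiable in [c] and jointly continuous. *)
Lemma ker_flat (m n : nat) (z : R) : 0 < z -> exists M, 0 <= M /\
  forall u c, z / 2 <= u <= 2 * z -> 0 < c <= 1 -> ker m u c <= M * c ^ n.
Proof.
  intros Hz. set (N := (m + n)%nat).
  assert (Hzn : 0 < (z / 2) ^ N) by (apply pow_lt; lra).
  exists (INR N ^ N * exp (2 * z) / (z / 2) ^ N). split.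
  - apply Rmult_le_pos; [apply Rmult_le_pos|].
    + apply pow_le, pos_INR.
    + left; apply exp_pos.
    + left; apply Rinv_0_lt_compat; exact Hzn.
  - intros u c Hu Hc. rewrite ker_pos by lra.
    assert (Hi : 0 < / c) by (apply Rinv_0_lt_compat; lra).
    assert (Hy : 0 <= z / 2 / c) by (apply Rmult_le_pos; lra).
    assert (P := pow_le_exp N (z / 2 / c) Hy).
    replace (- (u * (/ c - c))) with (u * c + - (u / c)) by (field; lra).
    rewrite exp_plus.
    assert (Huc : exp (u * c) <= exp (2 * z)).
    { apply exp_le. assert (u * c <= 2 * z * 1) by (apply Rmult_le_compat; lra). lra. }
    assert (Hcn : 0 < c ^ n) by (apply pow_lt; lra). assert (Hcm : 0 < c ^ m) by (apply pow_lt; lra).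
    assert (Q : exp (- (u / c)) <= INR N ^ N * (c ^ m * c ^ n) / (z / 2) ^ N).
    { apply Rle_trans with (exp (- (z / 2 / c))).
      - apply exp_le, Ropp_le_contravar. apply Rmult_le_compat_r; lra.
      - rewrite exp_Ropp. assert (He := exp_pos (z / 2 / c)).
        apply Rmult_le_reg_l with (exp (z / 2 / c)); [exact He|]. rewrite Rinv_r by lra.
        apply Rmult_le_reg_r with ((z / 2 / c) ^ N); [apply pow_lt, Rdiv_lt_0_compat; lra|].
        rewrite Rmult_1_l. apply Rle_trans with (1 := P). right.
        replace ((z / 2 / c) ^ N) with ((z / 2) ^ N * / c ^ N)
          by (rewrite <- pow_inv, <- Rpow_mult_distr; reflexivity).
        replace (c ^ N) with (c ^ m * c ^ n) by (unfold N; rewrite pow_add; reflexivity).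
        clear P. revert Hzn Hcn Hcm He. generalize (INR N ^ N) ((z / 2) ^ N) (c ^ m) (c ^ n) (exp (z / 2 / c)).
        intros. field. repeat split; lra. }
    replace (INR N ^ N * exp (2 * z) / (z / 2) ^ N * c ^ n) with
      (exp (2 * z) * (INR N ^ N * (c ^ m * c ^ n) / (z / 2) ^ N) * 1 * / c ^ m) by
      (clear - Hzn Hcn Hcm; revert Hzn Hcn Hcm;
       generalize (INR N ^ N) ((z / 2) ^ N) (c ^ m) (c ^ n); intros; field; split; lra).
    rewrite pow_inv. apply Rmult_le_compat_r; [inv_pos|].
    assert (H1 := exp_pos (u * c)). assert (H2 := exp_pos (- (u / c))).
    apply Rmult_le_compat; [apply Rmult_le_pos; lra|apply pow_le; lra| |].
    + apply Rmult_le_compat; lra.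
    + rewrite <- (pow1 2). apply pow_incr. lra.
Qed.

(** The factor [c - 1/c] produced by differentiation shifts the index down and up by one. Two
    derivatives starting from index 2 reach down to 0, whence the offset in [c^(2-m)]. *)
Lemma is_derive_ker_z (m : nat) (z c : R) :
  is_derive (fun z => ker (S m) z c) z (ker m z c - ker (S (S m)) z c).
Proof.
  destruct (Rlt_dec 0 c) as [H|H].
  - apply is_derive_ext with (fun z => exp (- (z * (/ c - c))) * c ^ 2 * (/ c) ^ S m).
    { intros t. symmetry. apply ker_pos; exact H. }
    rewrite !ker_pos by exact H. auto_derive; [exact I|]. simpl. field. lra.
  - rewrite !ker_npos by lra. apply is_derive_ext with (fun _ => 0).
    { intros t. symmetry. apply ker_npos; lra. }
    auto_derive; [exact I|ring].
Qed.

Lemma is_derive_ker_c (m : nat) (z c : R) : 0 < z ->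
  is_derive (fun c => ker m z c) c
    ((2 - INR m) * ker (S m) z c + z * (ker (S (S m)) z c + ker m z c)).
Proof.
  intros Hz. destruct (Rtotal_order c 0) as [H|[H|H]].
  - rewrite !ker_npos by lra. apply is_derive_ext_loc with (fun _ => 0).
    + assert (Hd : 0 < - c) by lra. exists (mkposreal _ Hd). intros t Ht.
      apply Rabs_def2 in Ht. unfold minus, plus, opp in Ht; simpl in Ht.
      symmetry. apply ker_npos; lra.
    + eapply is_derive_eq; [apply (is_derive_const 0)|]. unfold zero; simpl; ring.
  - subst c. rewrite !ker_npos by lra.
    replace ((2 - INR m) * 0 + z * (0 + 0)) with 0 by ring.
    (* At [c = 0] the difference quotient is 0 from the left and at most [M h] from the right, by
       [ker_flat] with [n = 2]. *)
    apply is_derive_Reals. intros eps Heps.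
    destruct (ker_flat m 2 z Hz) as [M [HM B]].
    assert (Hd : 0 < Rmin 1 (eps / (M + 1))).
    { apply Rmin_glb_lt; [lra|]. apply Rdiv_lt_0_compat; lra. }
    exists (mkposreal _ Hd). intros h Hh0 Hh. simpl in Hh.
    assert (Hh1 : Rabs h < 1) by (eapply Rlt_le_trans; [exact Hh|apply Rmin_l]).
    assert (Hh2 : Rabs h < eps / (M + 1)) by (eapply Rlt_le_trans; [exact Hh|apply Rmin_r]).
    rewrite Rplus_0_l, (ker_npos m z 0) by lra.
    destruct (Rlt_dec 0 h) as [Hp|Hp].
    + rewrite Rabs_right in Hh1, Hh2 by lra.
      specialize (B z h ltac:(lra) ltac:(lra)).
      assert (G := ker_ge_0 m z h).
      replace ((ker m z h - 0) / h - 0) with (ker m z h / h) by (field; lra).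
      rewrite Rabs_right.
      2: { apply Rle_ge, Rmult_le_pos; [lra|inv_pos]. }
      apply Rle_lt_trans with (M * h).
      * apply Rmult_le_reg_r with h; [exact Hp|]. unfold Rdiv.
        rewrite Rmult_assoc, Rinv_l by lra. nra.
      * apply Rle_lt_trans with ((M + 1) * h); [nra|].
        apply (Rmult_lt_compat_l (M + 1)) in Hh2; [|lra].
        replace ((M + 1) * (eps / (M + 1))) with eps in Hh2 by (field; lra). lra.
    + rewrite ker_npos by lra. replace ((0 - 0) / h - 0) with 0 by (field; exact Hh0). rewrite Rabs_R0. exact Heps.
  - apply is_derive_ext_loc with (fun c => exp (- (z * (/ c - c))) * c ^ 2 * (/ c) ^ m).
    + exists (mkposreal _ H). intros t Ht.
      apply Rabs_def2 in Ht. unfold minus, plus, opp in Ht; simpl in Ht.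
      symmetry. apply ker_pos; lra.
    + rewrite !ker_pos by exact H. destruct m as [|m].
      * auto_derive; [lra|]. change (/ c + - c) with (/ c - c). simpl. field. lra.
      * eapply is_derive_eq.
        { apply derR_mult; [apply (derR_mult (fun c => exp (- (z * (/ c - c)))) (fun c => c ^ 2))|].
          - apply (derR_comp exp (fun c => - (z * (/ c - c)))); [apply is_derive_exp|].
            instantiate (1 := z * (/ c ^ 2 + 1)). auto_derive; [lra|]. field. lra.
          - instantiate (1 := 2 * c). auto_derive; [exact I|]. ring.
          - apply (is_derive_pow Rinv (S m) c (- / c ^ 2)), is_derive_Rinv; exact H. }
        cbv beta. simpl Nat.pred. generalize (INR (S m)) (exp (- (z * (/ c - c)))). intros k e. simpl pow.
        generalize ((/ c) ^ m). intros q. field. lra.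
Qed.

(** Joint continuity is what differentiation under the integral sign asks of the [z]-derivative of
    the integrand. *)
Lemma continuous_ker (m : nat) (z c : R) : 0 < z ->
  continuous (fun p : R * R => ker m (fst p) (snd p)) (z, c).
Proof.
  intros Hz. destruct (Rtotal_order c 0) as [H|[H|H]].
  - apply (continuous_ext_loc _ (fun _ => 0)); [|apply continuous_const].
    assert (Hd : 0 < - c) by lra. exists (mkposreal _ Hd). intros [u t] [_ Ht].
    simpl in Ht. apply Rabs_def2 in Ht. unfold minus, plus, opp in Ht; simpl in Ht.
    symmetry. apply ker_npos; simpl; lra.
  - subst c. apply filterlim_locally. intros eps.
    destruct (ker_flat m 1 z Hz) as [M [HM B]].
    assert (Hd : 0 < Rmin (z / 2) (Rmin 1 (eps / (M + 1)))).
    { destruct eps as [e He]; simpl. repeat apply Rmin_glb_lt; try lra. apply Rdiv_lt_0_compat; lra. }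
    exists (mkposreal _ Hd). intros [u t] [Hu Ht]. simpl in Hu, Ht.
    assert (Hu1 : Rabs (u - z) < z / 2) by (eapply Rlt_le_trans; [exact Hu|apply Rmin_l]).
    assert (Ht1 : Rabs (t - 0) < Rmin 1 (eps / (M + 1))) by (eapply Rlt_le_trans; [exact Ht|apply Rmin_r]).
    rewrite Rminus_0_r in Ht1.
    assert (Ht2 : Rabs t < 1) by (eapply Rlt_le_trans; [exact Ht1|apply Rmin_l]).
    assert (Ht3 : Rabs t < eps / (M + 1)) by (eapply Rlt_le_trans; [exact Ht1|apply Rmin_r]).
    apply Rabs_def2 in Hu1. simpl fst; simpl snd.
    change (Rabs (ker m u t - ker m z 0) < eps). rewrite (ker_npos m z 0) by lra.
    destruct eps as [e He]; simpl in *.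
    destruct (Rlt_dec 0 t) as [Hp|Hp].
    + rewrite Rabs_right in Ht2, Ht3 by lra.
      specialize (B u t ltac:(lra) ltac:(lra)).
      assert (G := ker_ge_0 m u t). rewrite Rminus_0_r, Rabs_right by lra.
      apply Rle_lt_trans with (1 := B).
      apply Rle_lt_trans with ((M + 1) * t).
      * lra.
      * apply (Rmult_lt_compat_l (M + 1)) in Ht3; [|lra].
        replace ((M + 1) * (e / (M + 1))) with e in Ht3 by (field; lra). lra.
    + rewrite ker_npos by lra. rewrite Rminus_0_r, Rabs_R0. exact He.
  - apply (continuous_ext_loc _ (fun p : R * R => exp (- (fst p * (/ snd p - snd p))) * snd p ^ 2 * (/ snd p) ^ m)).
    + exists (mkposreal _ H). intros [u t] [_ Ht].
      simpl in Ht. apply Rabs_def2 in Ht. unfold minus, plus, opp in Ht; simpl in Ht.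
      symmetry. apply ker_pos; simpl; lra.
    + assert (Ci : continuous (fun p : R * R => / snd p) (z, c)).
      { apply cont2_comp; [apply cont2_snd|]. exact (is_derive_continuous Rinv c _ (is_derive_Rinv c H)). }
      assert (P : forall (g : R * R -> R) n p, continuous g p -> continuous (fun p => g p ^ n) p).
      { intros g n p Hg. apply (cont2_comp (fun x => x ^ n) g); [exact Hg|].
        eapply is_derive_continuous. auto_derive; [exact I|reflexivity]. }
      apply cont2_mult; [apply cont2_mult|].
      * apply cont2_comp.
        -- apply (continuous_opp (fun p : R * R => fst p * (/ snd p - snd p))).
           apply cont2_mult; [apply cont2_fst|]. apply cont2_minus; [exact Ci|apply cont2_snd].
        -- eapply is_derive_continuous. apply is_derive_exp.
      * apply P, cont2_snd.
      * apply P, Ci.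
Qed.

Lemma continuous_cos (x : R) : continuous cos x.
Proof. eapply is_derive_continuous, is_derive_cos. Qed.
Lemma continuous_sin (x : R) : continuous sin x.
Proof. eapply is_derive_continuous, is_derive_sin. Qed.

Lemma continuous_ker_cos2 (m : nat) (z t : R) : 0 < z ->
  continuous (fun p : R * R => ker m (fst p) (cos (snd p))) (z, t).
Proof.
  intros Hz.
  apply (cont2_pair (fun p => fst p) (fun p => cos (snd p)) (fun p => ker m (fst p) (snd p))).
  - apply cont2_fst.
  - apply cont2_comp; [apply cont2_snd|apply continuous_cos].
  - apply continuous_ker. exact Hz.
Qed.

Lemma continuous_ker_cos (m : nat) (z t : R) : 0 < z ->
  continuous (fun t => ker m z (cos t)) t.
Proof.
  intros Hz.
  apply (continuous_comp_2 (fun _ => z) (fun t => t) (fun z t => ker m z (cos t))).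
  - apply continuous_const.
  - apply continuous_id.
  - apply continuous_ker_cos2. exact Hz.
Qed.

Lemma ex_RInt_continuous_all (f : R -> R) (a b : R) :
  (forall t, continuous f t) -> ex_RInt f a b.
Proof. intros H. apply (ex_RInt_continuous (V := R_CompleteNormedModule)). intros; apply H. Qed.

Definition kerint (m : nat) (z : R) : R := RInt (fun t => ker m z (cos t)) 0 (PI / 2).

Lemma ex_RInt_ker (m : nat) (z a b : R) : 0 < z -> ex_RInt (fun t => ker m z (cos t)) a b.
Proof. intros Hz. apply ex_RInt_continuous_all. intros. apply continuous_ker_cos; exact Hz. Qed.

Lemma locally_gt (b x : R) : b < x -> locally x (fun u => b < u).
Proof.
  intros H. assert (Hd : 0 < x - b) by lra. exists (mkposreal _ Hd). intros u Hu.
  apply Rabs_def2 in Hu. unfold minus, plus, opp in Hu; simpl in Hu. lra.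
Qed.

Lemma is_derive_kerint (m : nat) (z : R) : 0 < z ->
  is_derive (kerint (S m)) z (kerint m z - kerint (S (S m)) z).
Proof.
  intros Hz. unfold kerint.
  eapply is_derive_eq.
  - apply (is_derive_RInt_param (fun z t => ker (S m) z (cos t)) 0 (PI / 2) z).
    + apply filter_forall. intros u t _. eexists. apply is_derive_ker_z.
    + intros t _. apply continuity_2d_pt_filterlim.
      apply (continuous_ext (fun p : R * R => ker m (fst p) (cos (snd p)) - ker (S (S m)) (fst p) (cos (snd p)))).
      * intros [u v]. symmetry. apply is_derive_unique, is_derive_ker_z.
      * apply cont2_minus; apply continuous_ker_cos2; exact Hz.
    + apply filter_imp with (2 := locally_gt 0 z Hz). intros u Hu. apply ex_RInt_ker; exact Hu.
  - rewrite (RInt_ext _ (fun t => ker m z (cos t) - ker (S (S m)) z (cos t))).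
    + apply (RInt_minus (V := R_CompleteNormedModule)); apply ex_RInt_ker; exact Hz.
    + intros t _. apply is_derive_unique, is_derive_ker_z.
Qed.

(** The integrand is the derivative of [sin t * ker m z (cos t)]. The boundary terms vanish, at 0
    because of the sine and at [pi/2] because of the extension by 0. *)
Lemma kerint_parts (m : nat) (z : R) : 0 < z ->
  RInt (fun t => cos t * ker m z (cos t)
     - sin t * sin t * ((2 - INR m) * ker (S m) z (cos t)
                        + z * (ker (S (S m)) z (cos t) + ker m z (cos t)))) 0 (PI / 2) = 0.
Proof.
  intros Hz. apply is_RInt_unique.
  assert (E : 0 = minus (sin (PI / 2) * ker m z (cos (PI / 2))) (sin 0 * ker m z (cos 0))).
  { rewrite cos_PI2, sin_0, ker_npos by lra. unfold minus, plus, opp; simpl. ring. }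
  rewrite E at 2. apply (is_RInt_derive (fun t => sin t * ker m z (cos t))).
  - intros t _. eapply is_derive_eq.
    + apply derR_mult; [apply is_derive_sin|].
      apply (derR_comp (fun c => ker m z c) cos); [apply is_derive_ker_c; exact Hz|apply is_derive_cos].
    + cbv beta. ring.
  - intros t _.
    assert (K : forall n, continuous (fun t => ker n z (cos t)) t) by (intros; apply continuous_ker_cos; exact Hz).
    apply (continuous_minus (fun t => cos t * ker m z (cos t))).
    + apply (continuous_mult cos _ t); [apply continuous_cos|apply K].
    + apply (continuous_mult (fun t => sin t * sin t) _ t).
      * apply (continuous_mult sin sin t); apply continuous_sin.
      * apply (continuous_plus (fun t => (2 - INR m) * ker (S m) z (cos t))).
        -- apply (continuous_scal_r (2 - INR m) (fun t => ker (S m) z (cos t)) t (K _)).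
        -- apply (continuous_scal_r z (fun t => ker (S (S m)) z (cos t) + ker m z (cos t)) t).
           apply (continuous_plus (fun t => ker (S (S m)) z (cos t))); apply K.
Qed.

Lemma kerint_comb (z : R) (l a b c : R) (i j k : nat) : 0 < z ->
  RInt (fun t => a * ker i z (cos t) + b * ker j z (cos t) + c * ker k z (cos t)) 0 (PI / 2) = l ->
  a * kerint i z + b * kerint j z + c * kerint k z = l.
Proof.
  intros Hz <-. symmetry. apply is_RInt_unique.
  assert (K : forall n, is_RInt (fun t => ker n z (cos t)) 0 (PI / 2) (kerint n z)).
  { intros n. apply is_RInt_RInt, ex_RInt_ker; exact Hz. }
  apply (is_RInt_plus (V := R_NormedModule)); [apply (is_RInt_plus (V := R_NormedModule))|];
    apply (is_RInt_scal (V := R_NormedModule)), K.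
Qed.

(** [kerint_parts] at [m = 2], with [sin^2 = 1 - cos^2] and each cosine lowering an index by
    [ker_mult]. Together with the case [m = 3], which is [kerint_rel2], this amounts to Bessel's
    equation for the integral representation. *)
Lemma kerint_rel1 (z : R) : 0 < z -> kerint 1 z = z * (kerint 4 z - kerint 0 z).
Proof.
  intros Hz.
  assert (H : 1 * kerint 1 z + (- z) * kerint 4 z + z * kerint 0 z = 0).
  { apply kerint_comb; [exact Hz|]. etransitivity; [|apply (kerint_parts 2 z Hz)].
    apply RInt_ext. intros t _. assert (S2 := sin_cos_sq t).
    replace (sin t * sin t) with (1 - cos t * cos t) by lra.
    assert (M0 := ker_mult 0 z (cos t)). assert (M1 := ker_mult 1 z (cos t)).
    assert (M2 := ker_mult 2 z (cos t)). assert (M3 := ker_mult 3 z (cos t)).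
    simpl INR. rewrite <- M0, <- M1, <- M2, <- M3. Req. ring. }
  lra.
Qed.

Lemma kerint_rel2 (z : R) : 0 < z -> kerint 4 z = z * (kerint 5 z - kerint 1 z).
Proof.
  intros Hz.
  assert (H : 1 * kerint 4 z + (- z) * kerint 5 z + z * kerint 1 z = 0).
  { apply kerint_comb; [exact Hz|]. etransitivity; [|apply (kerint_parts 3 z Hz)].
    apply RInt_ext. intros t _. assert (S2 := sin_cos_sq t).
    replace (sin t * sin t) with (1 - cos t * cos t) by lra.
    assert (M1 := ker_mult 1 z (cos t)). assert (M2 := ker_mult 2 z (cos t)).
    assert (M3 := ker_mult 3 z (cos t)). assert (M4 := ker_mult 4 z (cos t)).
    simpl INR. rewrite <- M1, <- M2, <- M3, <- M4. Req. ring. }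
  lra.
Qed.

Lemma kerint_rel1_div (z : R) : 0 < z -> kerint 1 z / z = kerint 4 z - kerint 0 z.
Proof. intros Hz. rewrite kerint_rel1 by exact Hz. field. lra. Qed.

Lemma kerint_rel2_div (z : R) : 0 < z -> kerint 4 z / z = kerint 5 z - kerint 1 z.
Proof. intros Hz. rewrite kerint_rel2 by exact Hz. field. lra. Qed.

(* Real and imaginary parts of [(2/π) e^(iz) (kerint 2 z - i kerint 3 z)] and of
   its derivative [(2/π) e^(iz) (kerint 1 z + i kerint 4 z)]. *)
Definition hankelR (z : R) : R := 2 / PI * (cos z * kerint 2 z + sin z * kerint 3 z).
Definition hankelI (z : R) : R := 2 / PI * (sin z * kerint 2 z - cos z * kerint 3 z).
Definition hankelR' (z : R) : R := 2 / PI * (cos z * kerint 1 z - sin z * kerint 4 z).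
Definition hankelI' (z : R) : R := 2 / PI * (sin z * kerint 1 z + cos z * kerint 4 z).

Lemma hankelR_pair : bessel_pair hankelR hankelR'.
Proof.
  intros z Hz. assert (HP := PI_RGT_0).
  assert (D := fun m => is_derive_kerint m z Hz).
  assert (Dc := is_derive_cos z). assert (Ds := is_derive_sin z). split.
  - eapply is_derive_eq.
    + apply derR_scal, derR_plus; apply derR_mult;
        [exact Dc|exact (D 1%nat)|exact Ds|exact (D 2%nat)].
    + unfold hankelR'. ring.
  - eapply is_derive_eq.
    + apply derR_scal, derR_minus; apply derR_mult;
        [exact Dc|exact (D 0%nat)|exact Ds|exact (D 3%nat)].
    + unfold hankelR', hankelR.
      replace (- (2 / PI * (cos z * kerint 1 z - sin z * kerint 4 z)) / z) with
        (2 / PI * (sin z * (kerint 4 z / z) - cos z * (kerint 1 z / z))) by (field; lra).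
      rewrite kerint_rel1_div, kerint_rel2_div by exact Hz. cbv beta. ring.
Qed.

Lemma hankelI_pair : bessel_pair hankelI hankelI'.
Proof.
  intros z Hz. assert (HP := PI_RGT_0).
  assert (D := fun m => is_derive_kerint m z Hz).
  assert (Dc := is_derive_cos z). assert (Ds := is_derive_sin z). split.
  - eapply is_derive_eq.
    + apply derR_scal, derR_minus; apply derR_mult;
        [exact Ds|exact (D 1%nat)|exact Dc|exact (D 2%nat)].
    + unfold hankelI'. ring.
  - eapply is_derive_eq.
    + apply derR_scal, derR_plus; apply derR_mult;
        [exact Ds|exact (D 0%nat)|exact Dc|exact (D 3%nat)].
    + unfold hankelI', hankelI.
      replace (- (2 / PI * (sin z * kerint 1 z + cos z * kerint 4 z)) / z) with
        (2 / PI * (- cos z * (kerint 4 z / z) - sin z * (kerint 1 z / z))) by (field; lra).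
      rewrite kerint_rel1_div, kerint_rel2_div by exact Hz. cbv beta. ring.
Qed.

(** * Behaviour at zero *)

Lemma derive_nonneg_le (f df : R -> R) (a b : R) : a <= b ->
  (forall x, a <= x <= b -> is_derive f x (df x)) ->
  (forall x, a <= x <= b -> 0 <= df x) -> f a <= f b.
Proof.
  intros Hab Hf Hd.
  destruct (MVT_gen f a b df) as [c [Hc E]]; rewrite ?Rmin_left, ?Rmax_right in * by exact Hab.
  - intros x Hx. apply Hf. lra.
  - intros x Hx. apply continuity_pt_filterlim. apply (is_derive_continuous f x (df x)), Hf, Hx.
  - assert (0 <= df c) by (apply Hd; exact Hc). nra.
Qed.

Lemma ln_1p_bounds (n : nat) :
  / INR (S (S n)) <= ln (INR (S (S n))) - ln (INR (S n)) <= / INR (S n).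
Proof.
  assert (Hn : 0 < INR (S n)) by (apply lt_0_INR; lia).
  assert (Hn' : INR (S (S n)) = INR (S n) + 1) by apply S_INR.
  rewrite Hn'. set (x := INR (S n)) in *. split.
  - assert (H := exp_ineq1_le (ln x - ln (x + 1))).
    rewrite Rminus_def, exp_plus, exp_Ropp, !exp_ln in H by lra.
    replace (x * / (x + 1)) with (1 - / (x + 1)) in H by (field; lra). lra.
  - assert (H := exp_ineq1_le (ln (x + 1) - ln x)).
    rewrite Rminus_def, exp_plus, exp_Ropp, !exp_ln in H by lra.
    replace ((x + 1) * / x) with (1 + / x) in H by (field; lra). lra.
Qed.

(** [euler_gamma] is a [Lim_seq], which is total, so convergence has to be established: the shifted
    sequence decreases and stays nonnegative because the increments of the logarithm lie between
    consecutive reciprocals. *)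
Lemma is_lim_euler_gamma :
  is_lim_seq (fun n => harmonic n - ln (INR n)) euler_gamma.
Proof.
  assert (H : ex_finite_lim_seq (fun n => harmonic (S n) - ln (INR (S n)))).
  { apply (ex_finite_lim_seq_decr _ 0).
    - intros n. rewrite (harmonic_S (S n)). assert (B := ln_1p_bounds n). lra.
    - intros n. assert (ln (INR (S (S n))) <= harmonic (S n)).
      { induction n as [|n IH].
        - assert (B := ln_1p_bounds 0). rewrite (harmonic_S 0).
          unfold harmonic. rewrite sum_n_m_zero by lia. unfold zero; simpl zero.
          change (INR 1) with 1 in B |- *. rewrite ln_1 in B. simpl in *. lra.
        - rewrite (harmonic_S (S n)). assert (B := ln_1p_bounds (S n)). lra. }
      assert (B := ln_1p_bounds n).
      assert (0 < / INR (S (S n))) by (apply Rinv_0_lt_compat, lt_0_INR; lia). lra. }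
  destruct H as [l H]. apply (is_lim_seq_incr_1 (fun n => harmonic n - ln (INR n))) in H.
  unfold euler_gamma. rewrite (is_lim_seq_unique _ _ H). exact H.
Qed.

Lemma bernoulli_le (v : R) (n : nat) : 0 <= v <= 1 -> 1 - INR n * v <= (1 - v) ^ n.
Proof.
  intros Hv. induction n as [|n IH]; [simpl; lra|].
  rewrite S_INR. simpl pow. assert (0 <= INR n) by apply pos_INR.
  apply Rle_trans with ((1 - v) * (1 - INR n * v)); [nra|].
  apply Rmult_le_compat_l; lra.
Qed.

(** Put [u = x / INR (S n)]. From above, [1 - u <= e^(-u)]. From below,
    [1 - u >= e^(-u) (1 + u)(1 - u)], and Bernoulli's inequality handles the power of [1 - u^2]. *)
Lemma exp_euler_bounds (n : nat) (x : R) : 0 <= x <= INR (S n) ->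
  exp (- x) * (1 - x ^ 2 / INR (S n)) <= (1 - x / INR (S n)) ^ S n <= exp (- x).
Proof.
  intros Hx. assert (Hn : 0 < INR (S n)) by (apply lt_0_INR; lia).
  set (u := x / INR (S n)).
  assert (Hxu : x = INR (S n) * u) by (unfold u; field; lra).
  clearbody u.
  assert (Hu : 0 <= u <= 1).
  { split; apply Rmult_le_reg_l with (INR (S n)); lra. }
  assert (Ex : exp (- x) = exp (- u) ^ S n).
  { rewrite <- exp_INR_mult. f_equal. rewrite Hxu. ring. }
  rewrite Ex. split.
  - replace (x ^ 2 / INR (S n)) with (INR (S n) * u ^ 2) by (rewrite Hxu; field; lra).
    assert (B := bernoulli_le (u ^ 2) (S n) ltac:(nra)).
    apply Rle_trans with (exp (- u) ^ S n * (1 - u ^ 2) ^ S n).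
    + apply Rmult_le_compat_l; [apply pow_le; left; apply exp_pos|exact B].
    + rewrite <- Rpow_mult_distr. apply pow_incr.
      assert (E := exp_pos (- u)). split; [apply Rmult_le_pos; nra|].
      replace (1 - u) with (exp (- u) * (exp u * (1 - u))).
      2: { rewrite <- Rmult_assoc, <- exp_plus. replace (- u + u) with 0 by ring. rewrite exp_0; ring. }
      apply Rmult_le_compat_l; [lra|]. assert (X := exp_ineq1_le u). nra.
  - apply pow_incr. assert (X := exp_ineq1_le (- u)). lra.
Qed.

(* Antiderivative in [x] of [(1 - (1 - x/n)^n) / x], which makes the harmonic
   numbers an integral. *)
Fixpoint harm_prim (n m : nat) (x : R) : R :=
  match m with
  | O => 0
  | S p => harm_prim n p x - (1 - x / INR n) ^ S p / INR (S p)
  end.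

Lemma harm_prim_S (n m : nat) (x : R) :
  harm_prim n (S m) x = harm_prim n m x - (1 - x / INR n) ^ S m / INR (S m).
Proof. reflexivity. Qed.

(** With [N = INR (S n)], the derivative is the geometric sum of [(1 - x/N)^k / N] over [k < m].
    Describing it through [x * d] avoids dividing at [x = 0]. For [m = S n] the last bound says that
    it lies between 0 and 1. *)
Lemma harm_prim_derive (n m : nat) (x : R) :
  exists d : R, is_derive (harm_prim (S n) m) x d /\ x * d = 1 - (1 - x / INR (S n)) ^ m /\ (0 <= x <= INR (S n) -> 0 <= d <= INR m / INR (S n)).
Proof.
  assert (Hn : 0 < INR (S n)) by (apply lt_0_INR; lia).
  induction m as [|m [d [D1 [D2 D3]]]].
  - exists 0. split; [apply (is_derive_const 0)|]. split; [simpl; ring|].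
    intros _. unfold Rdiv. simpl. rewrite Rmult_0_l. lra.
  - exists (d + / INR (S n) * (1 - x / INR (S n)) ^ m).
    assert (Hm : 0 < INR (S m)) by (apply lt_0_INR; lia).
    split; [|split].
    + apply (is_derive_ext (fun x => harm_prim (S n) m x - / INR (S m) * (1 - x / INR (S n)) ^ S m)).
      { intros t. rewrite harm_prim_S. unfold Rdiv. Req. ring. }
      eapply is_derive_eq.
      * apply derR_minus; [exact D1|].
        apply derR_scal. apply (is_derive_pow (fun x => 1 - x / INR (S n)) (S m) x (- / INR (S n))).
        clear - Hn. revert Hn. generalize (INR (S n)). intros N HN. auto_derive; [exact I|]. field. lra.
      * cbv beta. change (Nat.pred (S m)) with m. generalize ((1 - x / INR (S n)) ^ m). intros q. field. split; lra.
    + rewrite Rmult_plus_distr_l, D2. rewrite <- tech_pow_Rmult. generalize ((1 - x / INR (S n)) ^ m). intros q. field. lra.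
    + intros Hx. specialize (D3 Hx).
      assert (Hy : 0 <= 1 - x / INR (S n) <= 1).
      { split.
        - apply Rmult_le_reg_r with (INR (S n)); [exact Hn|].
          replace ((1 - x / INR (S n)) * INR (S n)) with (INR (S n) - x) by (field; lra). lra.
        - assert (0 <= x / INR (S n)); [|lra].
          apply Rmult_le_pos; [lra|inv_pos]. }
      assert (Hi : 0 < / INR (S n)) by (apply Rinv_0_lt_compat; lra).
      assert (P0 : 0 <= (1 - x / INR (S n)) ^ m) by (apply pow_le; lra).
      assert (P1 : (1 - x / INR (S n)) ^ m <= 1) by (rewrite <- (pow1 m) at 2; apply pow_incr; lra).
      rewrite (S_INR m). assert (I1 := Rmult_le_compat_l _ _ _ (Rlt_le _ _ Hi) P0). assert (I2 := Rmult_le_compat_l _ _ _ (Rlt_le _ _ Hi) P1). unfold Rdiv in D3 |- *. lra.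
Qed.

Lemma harm_prim_0 (n m : nat) : harm_prim (S n) m 0 = - harmonic m.
Proof.
  assert (Hn : 0 < INR (S n)) by (apply lt_0_INR; lia).
  induction m as [|m IH].
  - unfold harmonic. rewrite sum_n_m_zero by lia. unfold zero; simpl. ring.
  - rewrite harm_prim_S, IH, harmonic_S.
    replace (1 - 0 / INR (S n)) with 1 by (field; lra). rewrite pow1. unfold Rdiv; ring.
Qed.

Lemma harm_prim_n (n m : nat) : harm_prim (S n) m (INR (S n)) = 0.
Proof.
  assert (Hn : 0 < INR (S n)) by (apply lt_0_INR; lia).
  induction m as [|m IH]; [reflexivity|].
  rewrite harm_prim_S, IH.
  replace (1 - INR (S n) / INR (S n)) with 0 by (field; lra).
  rewrite pow_ne_zero by lia. unfold Rdiv; ring.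
Qed.

Definition expint (y b : R) : R := RInt (fun x => exp (- x) / x) y b.

Lemma continuous_expint (x : R) : 0 < x -> continuous (fun x => exp (- x) / x) x.
Proof. intros Hx. eapply is_derive_continuous. auto_derive; [lra|reflexivity]. Qed.

Lemma is_derive_expint (y x : R) : 0 < y -> 0 < x ->
  is_derive (expint y) x (exp (- x) / x).
Proof.
  intros Hy Hx. apply (is_derive_RInt (V := R_NormedModule) (fun x => exp (- x) / x) (expint y) y x).
  - apply filter_imp with (2 := locally_gt 0 x Hx). intros b Hb.
    apply is_RInt_RInt, (ex_RInt_continuous (V := R_CompleteNormedModule)).
    intros t Ht. apply continuous_expint.
    apply Rlt_le_trans with (Rmin y b); [apply Rmin_glb_lt; lra|lra].
  - apply continuous_expint; exact Hx.
Qed.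

(** By [harm_prim], [H_N] is the integral of [(1 - (1 - x/N)^N)/x] over [[0, N]]. The part below [y]
    lies between 0 and [y]. Above [y] the term [1/x] gives [ln N - ln y], and replacing
    [(1 - x/N)^N] by [e^(-x)] costs at most [1/N]. *)
Lemma harmonic_expint (n : nat) (y : R) : 0 < y <= INR (S n) ->
  0 <= harmonic (S n) - ln (INR (S n)) + ln y + expint y (INR (S n)) <= y + / INR (S n).
Proof.
  intros Hy. assert (Hn : 0 < INR (S n)) by (apply lt_0_INR; lia).
  set (N := INR (S n)) in *.
  set (P := harm_prim (S n) (S n)).
  set (dP := fun x => Derive P x).
  assert (HP : forall x, is_derive P x (dP x) /\ x * dP x = 1 - (1 - x / N) ^ S n /\ (0 <= x <= N -> 0 <= dP x <= 1)).
  { intros x. destruct (harm_prim_derive n (S n) x) as [d [D1 [D2 D3]]].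
    unfold dP. fold P in D1. rewrite (is_derive_unique _ _ _ D1). split; [exact D1|].
    split; [exact D2|]. intros Hx. specialize (D3 Hx).
    unfold Rdiv in D3. rewrite Rinv_r in D3 by (fold N; lra). exact D3. }
  assert (P0 : P 0 = - harmonic (S n)) by apply harm_prim_0.
  assert (PN : P N = 0) by apply harm_prim_n.
  assert (A1 : P 0 <= P y).
  { apply (derive_nonneg_le P dP); [lra|intros; apply HP|].
    intros x Hx. apply HP; lra. }
  assert (A2 : 0 - P 0 <= y - P y).
  { apply (derive_nonneg_le (fun x => x - P x) (fun x => 1 - dP x)); [lra| |].
    - intros x Hx. apply derR_minus; [apply derR_id|apply HP].
    - intros x Hx. destruct (HP x) as [_ [_ B]]. specialize (B ltac:(lra)). lra. }
  set (D := fun x => P x - ln x + expint y x).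
  assert (HD : forall x, y <= x <= N -> is_derive D x (dP x - / x + exp (- x) / x)).
  { intros x Hx. apply derR_plus; [apply derR_minus|].
    - apply HP.
    - apply is_derive_ln; lra.
    - apply is_derive_expint; lra. }
  assert (HdD : forall x, y <= x <= N ->
     dP x - / x + exp (- x) / x = (exp (- x) - (1 - x / N) ^ S n) / x).
  { intros x Hx. destruct (HP x) as [_ [B _]].
    replace ((1 - x / N) ^ S n) with (1 - x * dP x) by lra. field. lra. }
  assert (Dy : D y = P y - ln y).
  { unfold D, expint. rewrite RInt_point. unfold zero; simpl. ring. }
  assert (A3 : D y <= D N).
  { apply (derive_nonneg_le D (fun x => dP x - / x + exp (- x) / x)); [lra|exact HD|].
    intros x Hx. rewrite HdD by exact Hx.
    destruct (exp_euler_bounds n x) as [_ B]; [fold N; lra|]. fold N in B.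
    apply Rmult_le_pos; [lra|inv_pos]. }
  (* [-(x + 1) e^(-x) / N] is an antiderivative of [x e^(-x) / N], the error density left by the
     lower bound of [exp_euler_bounds]. *)
  assert (A4 : - ((y + 1) * exp (- y) / N) - D y <= - ((N + 1) * exp (- N) / N) - D N).
  { apply (derive_nonneg_le (fun x => - ((x + 1) * exp (- x) / N) - D x)
       (fun x => x * exp (- x) / N - (dP x - / x + exp (- x) / x))); [lra| |].
    - intros x Hx. apply derR_minus; [|apply HD; exact Hx].
      auto_derive; [exact I|]. field. lra.
    - intros x Hx. rewrite HdD by exact Hx.
      destruct (exp_euler_bounds n x) as [B _]; [fold N; lra|]. fold N in B.
      assert (Hx0 : 0 < x) by lra.
      replace (x * exp (- x) / N - (exp (- x) - (1 - x / N) ^ S n) / x)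
        with (((1 - x / N) ^ S n - exp (- x) * (1 - x ^ 2 / N)) / x).
      + apply Rmult_le_pos; [lra|inv_pos].
      + generalize ((1 - x / N) ^ S n). intros q. field. lra. }
  assert (A5 : (y + 1) * exp (- y) <= 1).
  { assert (E := exp_ineq1_le y). assert (E' := exp_pos (- y)).
    apply Rle_trans with (exp y * exp (- y)); [apply Rmult_le_compat_r; lra|].
    rewrite <- exp_plus. replace (y + - y) with 0 by ring. rewrite exp_0; lra. }
  assert (A6 : (y + 1) * exp (- y) / N <= / N).
  { rewrite <- (Rmult_1_l (/ N)). apply Rmult_le_compat_r; [inv_pos|exact A5]. }
  assert (A7 : 0 <= (N + 1) * exp (- N) / N).
  { apply Rmult_le_pos; [|inv_pos].
    apply Rmult_le_pos; [lra|left; apply exp_pos]. }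
  assert (DN : D N = 0 - ln N + expint y N) by (unfold D; rewrite PN; reflexivity).
  clearbody D. lra.
Qed.

(** [b] is the Gudermannian of [ln q], since [tan b = sinh (ln q)]; it inverts the substitution used
    in [expint_subst]. *)
Lemma atan_cos_sin (q b : R) : 1 < q -> b = atan ((q - / q) / 2) ->
  0 < b < PI / 2 /\ cos b = 2 / (q + / q) /\ (1 + sin b) / cos b = q.
Proof.
  intros Hq ->. set (t := (q - / q) / 2).
  assert (Hi : 0 < / q < 1).
  { split; [apply Rinv_0_lt_compat; lra|]. rewrite <- Rinv_1. apply Rinv_lt_contravar; lra. }
  assert (Hqq : q * / q = 1) by (field; lra).
  assert (Ht : 0 < t) by (unfold t; lra).
  assert (Hs : sqrt (1 + t²) = (q + / q) / 2).
  { replace (1 + t²) with (((q + / q) / 2)²) by (unfold t, Rsqr; field; lra).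
    apply sqrt_Rsqr. lra. }
  split; [|split].
  - assert (B := atan_bound t). split; [|lra].
    rewrite <- atan_0. apply atan_increasing. exact Ht.
  - rewrite cos_atan, Hs. field. nra.
  - rewrite cos_atan, sin_atan, Hs. unfold t. field. repeat split; nra.
Qed.

Lemma cos_pos_lt (b t : R) : 0 < b < PI / 2 -> 0 <= t <= b -> 0 < cos t.
Proof. intros Hb Ht. apply cos_gt_0; lra. Qed.

(** Substitution [x = (z/2)(1 + sin t)/cos t], for which [dx/x = dt/cos t]. It brings the
    exponential integral close to the shape of [kerint 3]. *)
Lemma expint_subst (z N b : R) : 0 < z -> z / 2 < N ->
  b = atan ((2 * N / z - / (2 * N / z)) / 2) ->
  is_RInt (fun t => exp (- (z / 2 * ((1 + sin t) / cos t))) / cos t) 0 b (expint (z / 2) N).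
Proof.
  intros Hz HN Hb.
  assert (Hq : 1 < 2 * N / z).
  { apply Rmult_lt_reg_r with z; [exact Hz|]. replace (2 * N / z * z) with (2 * N) by (field; lra). lra. }
  destruct (atan_cos_sin _ _ Hq Hb) as [Hb1 [Hb2 Hb3]].
  set (g := fun t => z / 2 * ((1 + sin t) / cos t)).
  set (dg := fun t => z / 2 * ((1 + sin t) / cos t) / cos t).
  assert (Hg0 : g 0 = z / 2) by (unfold g; rewrite sin_0, cos_0; field).
  assert (Hgb : g b = N) by (unfold g; rewrite Hb3; field; lra).
  replace (expint (z / 2) N) with (RInt (fun x => exp (- x) / x) (g 0) (g b)) by (rewrite Hg0, Hgb; reflexivity).
  assert (Hpos : forall t, Rmin 0 b <= t <= Rmax 0 b -> 0 < cos t /\ 0 <= sin t).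
  { intros t. rewrite Rmin_left, Rmax_right by lra. intros Ht. split.
    - apply (cos_pos_lt b); lra.
    - apply sin_ge_0; lra. }
  assert (Hgp : forall t, Rmin 0 b <= t <= Rmax 0 b -> 0 < g t).
  { intros t Ht. destruct (Hpos t Ht). apply Rmult_lt_0_compat; [lra|]. apply Rdiv_lt_0_compat; lra. }
  apply is_RInt_ext with (fun t => scal (dg t) (exp (- g t) / g t)).
  - intros t Ht. assert (Ht' : Rmin 0 b <= t <= Rmax 0 b) by lra.
    destruct (Hpos t Ht') as [Hc Hs]. unfold scal; simpl; unfold mult; simpl.
    unfold dg, g. generalize (exp (- (z / 2 * ((1 + sin t) / cos t)))). intros e.
    Req. field. repeat split; lra.
  - apply (is_RInt_comp (fun x => exp (- x) / x) g dg).
    + intros t Ht. apply continuous_expint, Hgp, Ht.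
    + intros t Ht. destruct (Hpos t Ht) as [Hc Hs]. split.
      * unfold g, dg. auto_derive; [lra|].
        assert (S2 := sin_cos_sq t).
        apply Rmult_eq_reg_r with (cos t * cos t); [|nra]. field_simplify; [|lra|lra].
        replace (cos t ^ 2) with (1 - sin t ^ 2) by (simpl; lra). field.
      * unfold dg. eapply is_derive_continuous. auto_derive; [lra|reflexivity].
Qed.

(** Write [s], [c] for the sine and cosine. As [1/c] is the mean of [(1 + s)/c] and [(1 - s)/c], the
    two integrands differ by the factor [exp (-(z/2) u + z c)] with [u = (1 - s)/c], and both [u]
    and [c] lie in [[0, 1]]. *)
Lemma ker3_compare (z t : R) : 0 < z -> 0 < cos t -> 0 <= sin t ->
  let e := exp (- (z / 2 * ((1 + sin t) / cos t))) / cos t in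
  exp (- z) * ker 3 z (cos t) <= e <= exp (z / 2) * ker 3 z (cos t).
Proof.
  intros Hz Hc Hs e.
  assert (S2 := sin_cos_sq t).
  assert (Hs1 : sin t <= 1) by nra. assert (Hc1 : cos t <= 1) by nra.
  assert (Hi : 0 < / cos t) by (apply Rinv_0_lt_compat; lra).
  assert (Hu : 0 <= (1 - sin t) / cos t <= 1).
  { split; [apply Rmult_le_pos; lra|].
    apply Rmult_le_reg_r with (cos t); [lra|]. unfold Rdiv. rewrite Rmult_assoc, Rinv_l by lra. nra. }
  set (u := (1 - sin t) / cos t) in *.
  assert (Ek : ker 3 z (cos t) = exp (- (z / 2 * u) + z * cos t) * e).
  { unfold e, u. rewrite ker_pos by lra. unfold Rdiv at 3. rewrite <- Rmult_assoc, <- exp_plus.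
    replace (- (z / 2 * ((1 - sin t) / cos t)) + z * cos t + - (z / 2 * ((1 + sin t) / cos t)))
      with (- (z * (/ cos t - cos t))) by (field; lra).
    generalize (exp (- (z * (/ cos t - cos t)))). intros q. field. lra. }
  assert (He : 0 < e) by (apply Rdiv_lt_0_compat; [apply exp_pos|exact Hc]).
  rewrite Ek. rewrite <- !Rmult_assoc, <- !exp_plus.
  assert (Z1 : z * cos t <= z * 1) by (apply Rmult_le_compat_l; lra).
  assert (Z2 : 0 <= z * u) by (apply Rmult_le_pos; lra).
  assert (Z3 : z * u <= z * 1) by (apply Rmult_le_compat_l; lra).
  assert (Z4 : 0 <= z * cos t) by (apply Rmult_le_pos; lra).
  split.
  - rewrite <- (Rmult_1_l e) at 2. apply Rmult_le_compat_r; [lra|]. rewrite <- exp_0. apply exp_le. lra.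
  - rewrite <- (Rmult_1_l e) at 1. apply Rmult_le_compat_r; [lra|]. rewrite <- exp_0. apply exp_le. lra.
Qed.

Lemma kerint3_expint (z : R) : 0 < z -> exists C, 0 <= C /\ forall N, z / 2 < N ->
  exp (- (z / 2)) * expint (z / 2) N <= kerint 3 z <= exp z * expint (z / 2) N + C / N.
Proof.
  intros Hz. assert (HPI := PI_RGT_0).
  destruct (ker_flat 3 1 z Hz) as [M [HM B]].
  exists (PI / 2 * (M * z)). split; [apply Rmult_le_pos; [lra|apply Rmult_le_pos; lra]|]. intros N HN.
  assert (Hq : 1 < 2 * N / z).
  { apply Rmult_lt_reg_r with z; [exact Hz|]. replace (2 * N / z * z) with (2 * N) by (field; lra). lra. }
  set (b := atan ((2 * N / z - / (2 * N / z)) / 2)).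
  destruct (atan_cos_sin _ b Hq eq_refl) as [Hb1 [Hb2 _]].
  assert (S := expint_subst z N b Hz HN eq_refl).
  set (Ib := RInt (fun t => ker 3 z (cos t)) 0 b).
  assert (HIb : is_RInt (fun t => ker 3 z (cos t)) 0 b Ib)
    by (apply is_RInt_RInt, ex_RInt_ker; exact Hz).
  assert (Hpw : forall t, 0 < t < b -> 0 < cos t /\ 0 <= sin t).
  { intros t Ht. split; [apply (cos_pos_lt b); lra|apply sin_ge_0; lra]. }
  assert (L1 : exp (- z) * Ib <= expint (z / 2) N).
  { apply (is_RInt_le (fun t => exp (- z) * ker 3 z (cos t))
      (fun t => exp (- (z / 2 * ((1 + sin t) / cos t))) / cos t) 0 b); [lra| |exact S|].
    - apply (is_RInt_scal (V := R_NormedModule)). exact HIb.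
    - intros t Ht. destruct (Hpw t Ht). apply ker3_compare; assumption. }
  assert (L2 : expint (z / 2) N <= exp (z / 2) * Ib).
  { apply (is_RInt_le (fun t => exp (- (z / 2 * ((1 + sin t) / cos t))) / cos t)
      (fun t => exp (z / 2) * ker 3 z (cos t)) 0 b); [lra|exact S| |].
    - apply (is_RInt_scal (V := R_NormedModule)). exact HIb.
    - intros t Ht. destruct (Hpw t Ht). apply ker3_compare; assumption. }
  set (Jb := RInt (fun t => ker 3 z (cos t)) b (PI / 2)).
  assert (Ch : kerint 3 z = Ib + Jb).
  { symmetry. apply (RInt_Chasles (V := R_CompleteNormedModule) (fun t => ker 3 z (cos t)));
      apply ex_RInt_ker; exact Hz. }
  assert (HJ : is_RInt (fun t => ker 3 z (cos t)) b (PI / 2) Jb)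
    by (apply is_RInt_RInt, ex_RInt_ker; exact Hz).
  assert (J0 : 0 <= Jb).
  { apply RInt_ge_0; [lra|apply ex_RInt_ker; exact Hz|]. intros; apply ker_ge_0. }
  (* Beyond [b] one has [cos t <= cos b <= z/N], so the flatness of the kernel bounds the tail by a
     multiple of [1/N]. *)
  assert (J1 : Jb <= PI / 2 * (M * z) / N).
  { apply Rle_trans with ((PI / 2 - b) * (M * (z / N))).
    - apply (is_RInt_le (fun t => ker 3 z (cos t)) (fun _ => M * (z / N)) b (PI / 2)); [lra|exact HJ| |].
      + apply (is_RInt_const (V := R_NormedModule)).
      + intros t Ht.
        assert (Ct : 0 < cos t) by (apply cos_gt_0; lra).
        assert (Cb : cos t <= cos b) by (left; apply cos_decreasing_1; lra).
        assert (Cz : cos b <= z / N).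
        { rewrite Hb2. assert (HiN : 0 < / (2 * N / z)) by (apply Rinv_0_lt_compat; lra).
          apply Rle_trans with (2 / (2 * N / z)).
          - apply Rmult_le_compat_l; [lra|]. apply Rinv_le_contravar; lra.
          - right. field. lra. }
        apply Rle_trans with (M * cos t ^ 1).
        * apply B; [lra|split; [exact Ct|apply COS_bound]].
        * rewrite pow_1. apply Rmult_le_compat_l; lra.
    - assert (0 < z / N) by (apply Rdiv_lt_0_compat; lra).
      replace (PI / 2 * (M * z) / N) with (PI / 2 * (M * (z / N))) by (field; lra).
      apply Rmult_le_compat_r; [|lra]. apply Rmult_le_pos; lra. }
  assert (X1 : exp (- (z / 2)) * exp (z / 2) = 1)
    by (rewrite <- exp_plus; replace (- (z / 2) + z / 2) with 0 by ring; apply exp_0).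
  assert (X2 : exp z * exp (- z) = 1)
    by (rewrite <- exp_plus; replace (z + - z) with 0 by ring; apply exp_0).
  split.
  - apply Rmult_le_compat_l with (r := exp (- (z / 2))) in L2; [|left; apply exp_pos].
    rewrite <- Rmult_assoc, X1 in L2. lra.
  - apply Rmult_le_compat_l with (r := exp z) in L1; [|left; apply exp_pos].
    rewrite <- Rmult_assoc, X2 in L1. lra.
Qed.

(** [harmonic_expint] at [y = z/2] is inserted into [kerint3_expint] and [N] tends to infinity:
    [H_N - ln N] becomes Euler's constant, while [1/N] and [C/N] vanish. *)
Lemma kerint3_log (z : R) : 0 < z ->
  let l := - euler_gamma - ln (z / 2) in
  exp (- (z / 2)) * l <= kerint 3 z /\ kerint 3 z <= exp z * (l + z / 2).
Proof.
  intros Hz l. destruct (kerint3_expint z Hz) as [C [HC B]].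
  set (h := fun n => harmonic (S n) - ln (INR (S n))).
  assert (Hh : is_lim_seq h euler_gamma).
  { apply (is_lim_seq_incr_1 (fun n => harmonic n - ln (INR n))). exact is_lim_euler_gamma. }
  assert (Hev : exists n0, forall n, (n0 <= n)%nat -> z / 2 < INR (S n)).
  { destruct (nfloor_ex (z / 2)) as [n0 Hn0]; [lra|]. exists n0. intros n Hn.
    rewrite S_INR. apply le_INR in Hn. lra. }
  destruct Hev as [n0 Hn0]. split.
  - refine (is_lim_seq_le_loc (fun n => exp (- (z / 2)) * (- h n - ln (z / 2))) (fun _ => kerint 3 z) (Finite (exp (- (z / 2)) * l)) (Finite (kerint 3 z)) _ _ _).
    + exists n0. intros n Hn. specialize (Hn0 n Hn).
      destruct (B _ Hn0) as [B1 _]. destruct (harmonic_expint n (z / 2)) as [E1 _]; [lra|].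
      apply Rle_trans with (exp (- (z / 2)) * expint (z / 2) (INR (S n))); [|lra].
      apply Rmult_le_compat_l; [left; apply exp_pos|]. unfold h. lra.
    + apply (is_lim_seq_scal_l _ (exp (- (z / 2))) (Finite l)).
      apply (is_lim_seq_minus' (fun n => - h n) (fun _ => ln (z / 2)) (- euler_gamma)); [|apply is_lim_seq_const].
      apply (is_lim_seq_opp h euler_gamma), Hh.
    + apply is_lim_seq_const.
  - refine (is_lim_seq_le_loc (fun _ => kerint 3 z)
      (fun n => exp z * ((- h n - ln (z / 2)) + (z / 2 + / INR (S n))) + C * / INR (S n)) (Finite (kerint 3 z))
      (Finite (exp z * (l + z / 2))) _ _ _).
    + exists n0. intros n Hn. specialize (Hn0 n Hn).
      destruct (B _ Hn0) as [_ B1]. destruct (harmonic_expint n (z / 2)) as [_ E1]; [lra|].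
      apply Rle_trans with (1 := B1). apply Rplus_le_compat_r.
      apply Rmult_le_compat_l; [left; apply exp_pos|]. unfold h. lra.
    + apply is_lim_seq_const.
    + replace (exp z * (l + z / 2)) with (exp z * (l + (z / 2 + 0)) + C * 0) by ring.
      apply is_lim_seq_plus'.
      * apply (is_lim_seq_scal_l _ (exp z) (Finite (l + (z / 2 + 0)))).
        apply is_lim_seq_plus'.
        -- apply (is_lim_seq_minus' (fun n => - h n) (fun _ => ln (z / 2)) (- euler_gamma)); [|apply is_lim_seq_const].
           apply (is_lim_seq_opp h euler_gamma), Hh.
        -- apply is_lim_seq_plus'; [apply is_lim_seq_const|apply is_lim_seq_inv_S].
      * apply (is_lim_seq_scal_l _ C (Finite 0)), is_lim_seq_inv_S.
Qed.

(** * Limits of [kerint 2] and [kerint 3] at zero, and identification with the series *)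

Lemma sin_ge_half (x : R) : 0 <= x <= 1 -> x / 2 <= sin x.
Proof.
  intros Hx. assert (H3 := PI2_3_2).
  assert (0 - 0 / 2 <= sin x - x / 2); [|lra].
  replace (0 - 0 / 2) with (sin 0 - 0 / 2) by (rewrite sin_0; ring).
  apply (derive_nonneg_le (fun x => sin x - x / 2) (fun x => cos x - / 2)); [lra| |].
  - intros t _. apply derR_minus; [apply is_derive_sin|apply is_derive_half].
  - intros t Ht. rewrite <- (Rdiv_1_l 2), <- cos_PI3.
    assert (cos (PI / 3) <= cos t); [|lra].
    apply cos_decr_1; lra.
Qed.

Lemma ker2_bounds (z c : R) : 0 < z -> 0 < c <= 1 -> 1 - z / c <= ker 2 z c <= 1.
Proof.
  intros Hz Hc. rewrite ker_pos by lra.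
  replace (exp (- (z * (/ c - c))) * c ^ 2 * (/ c) ^ 2) with (exp (- (z * (/ c - c)))).
  2: { generalize (exp (- (z * (/ c - c)))). intros e. field. lra. }
  assert (Hi : 1 <= / c) by (rewrite <- Rinv_1; apply Rinv_le_contravar; lra).
  split.
  - assert (E := exp_ineq1_le (- (z * (/ c - c)))).
    assert (0 <= z * c) by (apply Rmult_le_pos; lra). unfold Rdiv. lra.
  - rewrite <- exp_0. assert (0 <= z * (/ c - c)) by (apply Rmult_le_pos; lra).
    destruct H as [H|H]; [left; apply exp_increasing; lra|rewrite <- H, Ropp_0; lra].
Qed.

(** The argument is a square in order to balance two errors: dropping the last stretch of length [w]
    before [pi/2], and on the rest the loss [z / cos t <= 2 w], which follows from
    [cos t >= w/2]. *)
Lemma kerint2_bounds (w : R) : 0 < w <= 1 ->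
  (PI / 2 - w) * (1 - 2 * w) <= kerint 2 (w * w) <= PI / 2.
Proof.
  intros Hw. assert (H3 := PI2_3_2).
  assert (Hz : 0 < w * w) by (apply Rmult_lt_0_compat; lra).
  set (z := w * w) in *. set (b := PI / 2 - w).
  assert (Ex : forall u v, is_RInt (fun t => ker 2 z (cos t)) u v (RInt (fun t => ker 2 z (cos t)) u v))
    by (intros; apply is_RInt_RInt, ex_RInt_ker; exact Hz).
  split.
  - unfold kerint.
    rewrite <- (RInt_Chasles (V := R_CompleteNormedModule) (fun t => ker 2 z (cos t)) 0 b (PI / 2))
      by (apply ex_RInt_ker; exact Hz).
    assert (A : 0 <= RInt (fun t => ker 2 z (cos t)) b (PI / 2)).
    { apply RInt_ge_0; [unfold b; lra|apply ex_RInt_ker; exact Hz|intros; apply ker_ge_0]. }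
    assert (B : (b - 0) * (1 - 2 * w) <= RInt (fun t => ker 2 z (cos t)) 0 b).
    { apply (is_RInt_le (fun _ => 1 - 2 * w) (fun t => ker 2 z (cos t)) 0 b); [unfold b; lra| |apply Ex|].
      - apply (is_RInt_const (V := R_NormedModule)).
      - intros t Ht.
        assert (Cb : cos b <= cos t) by (left; apply cos_decreasing_1; unfold b in *; lra).
        assert (Cw : w / 2 <= cos b).
        { unfold b. rewrite cos_shift. apply sin_ge_half; lra. }
        destruct (ker2_bounds z (cos t)) as [K _]; [exact Hz|split; [lra|apply COS_bound]|].
        apply Rle_trans with (2 := K).
        assert (z / cos t <= 2 * w); [|lra].
        apply Rmult_le_reg_r with (cos t); [lra|]. unfold Rdiv.
        rewrite Rmult_assoc, Rinv_l by lra. unfold z.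
        assert (w * (w / 2) <= w * cos t) by (apply Rmult_le_compat_l; lra). lra. }
    unfold plus; simpl. unfold b in *. lra.
  - apply Rle_trans with ((PI / 2 - 0) * 1); [|lra].
    apply (is_RInt_le (fun t => ker 2 z (cos t)) (fun _ => 1) 0 (PI / 2)); [lra|apply Ex| |].
    + apply (is_RInt_const (V := R_NormedModule)).
    + intros t Ht. apply ker2_bounds; [exact Hz|]. split; [apply cos_gt_0; lra|apply COS_bound].
Qed.

(* Limits at 0 are only taken along this sequence. *)
Definition en (n : nat) : R := exp (- INR n).

Lemma en_bounds (n : nat) : 0 < en n <= 1.
Proof.
  split; [apply exp_pos|]. unfold en. rewrite <- exp_0.
  destruct (pos_INR n) as [H|H]; [left; apply exp_increasing; lra|].
  rewrite <- H, Ropp_0. lra.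
Qed.

Lemma n_en_le (n : nat) : (INR n + 1) * en n <= 4 * exp 1 * / INR (S n).
Proof.
  assert (Hn : 0 < INR (S n)) by (apply lt_0_INR; lia).
  assert (P := pow_le_exp 2 (INR (S n)) ltac:(lra)).
  assert (E : en n = exp 1 / exp (INR (S n))).
  { unfold en, Rdiv. rewrite <- exp_Ropp, <- exp_plus. f_equal. rewrite S_INR. ring. }
  rewrite E, <- S_INR. assert (H0 := exp_pos (INR (S n))). assert (H1 := exp_pos 1).
  apply Rmult_le_reg_r with (exp (INR (S n)) * INR (S n)); [apply Rmult_lt_0_compat; lra|].
  replace (INR (S n) * (exp 1 / exp (INR (S n))) * (exp (INR (S n)) * INR (S n)))
    with (exp 1 * INR (S n) ^ 2) by (generalize dependent (INR (S n)); intros; field; lra).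
  replace (4 * exp 1 * / INR (S n) * (exp (INR (S n)) * INR (S n)))
    with (exp 1 * (4 * exp (INR (S n)))) by (generalize dependent (INR (S n)); intros; field; lra).
  apply Rmult_le_compat_l; [lra|]. replace 4 with (INR 2 ^ 2) by (simpl; ring). exact P.
Qed.

Lemma is_lim_squeeze_0 (u v : nat -> R) :
  (forall n, Rabs (u n) <= v n) -> is_lim_seq v 0 -> is_lim_seq u 0.
Proof.
  intros H Hv. apply (is_lim_seq_le_le (fun n => - v n) u v 0).
  - intros n. specialize (H n). apply Rabs_le_between in H. exact H.
  - replace (Finite 0) with (Rbar_opp (Finite 0)) by (simpl; f_equal; ring).
    apply is_lim_seq_opp in Hv. exact Hv.
  - exact Hv.
Qed.

Lemma is_lim_scal_0 (c : R) (u : nat -> R) : is_lim_seq u 0 -> is_lim_seq (fun n => c * u n) 0.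
Proof.
  intros H. replace (Finite 0) with (Rbar_mult (Finite c) (Finite 0)) by (simpl; f_equal; ring).
  apply is_lim_seq_scal_l, H.
Qed.

Lemma is_lim_n_en : is_lim_seq (fun n => (INR n + 1) * en n) 0.
Proof.
  apply is_lim_squeeze_0 with (fun n => 4 * exp 1 * / INR (S n)).
  - intros n. rewrite Rabs_right; [apply n_en_le|].
    apply Rle_ge, Rmult_le_pos; [assert (H := pos_INR n); lra|left; apply en_bounds].
  - apply is_lim_scal_0, is_lim_seq_inv_S.
Qed.

Lemma is_lim_eq (u : nat -> R) (l l' : R) :
  is_lim_seq u l -> l = l' -> is_lim_seq u l'.
Proof. intros H <-. exact H. Qed.

Lemma is_lim_en : is_lim_seq en 0.
Proof.
  apply is_lim_squeeze_0 with (fun n => (INR n + 1) * en n); [|exact is_lim_n_en].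
  intros n. assert (H := en_bounds n). assert (Hn := pos_INR n).
  rewrite Rabs_right by lra. 
  assert (0 <= INR n * en n) by (apply Rmult_le_pos; lra). lra.
Qed.

Lemma is_lim_cont (f : R -> R) (u : nat -> R) (l : R) :
  continuous f l -> is_lim_seq u l -> is_lim_seq (fun n => f (u n)) (f l).
Proof.
  intros Hf Hu. apply is_lim_seq_continuous; [|exact Hu].
  apply continuity_pt_filterlim. exact Hf.
Qed.

Lemma is_lim_kerint2 : is_lim_seq (fun n => kerint 2 (en n)) (PI / 2).
Proof.
  pose (w := fun n => sqrt (en n)).
  assert (Hw : is_lim_seq w 0).
  { rewrite <- sqrt_0. apply is_lim_cont; [|exact is_lim_en]. apply continuous_sqrt. }
  apply (is_lim_seq_le_le (fun n => (PI / 2 - w n) * (1 - 2 * w n)) _ (fun _ => PI / 2)).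
  - intros n. assert (H := en_bounds n).
    assert (E : en n = w n * w n) by (symmetry; apply sqrt_sqrt; lra).
    rewrite E. apply kerint2_bounds. split; [apply sqrt_lt_R0; lra|].
    unfold w. rewrite <- sqrt_1. apply sqrt_le_1_alt; lra.
  - apply (is_lim_eq _ ((PI / 2 - 0) * (1 - 0))); [|ring].
    apply is_lim_seq_mult'; (apply is_lim_seq_minus'; [apply is_lim_seq_const|]);
      [exact Hw|apply is_lim_scal_0, Hw].
  - apply is_lim_seq_const.
Qed.

(** The singular part of [kerint 3] at [en n]. Since [ln (en n) = - n], it is affine in [n] with
    slope 1, which [bessel_comb_limit] exploits. *)
Definition elln (n : nat) : R := - euler_gamma - ln (en n / 2).

Lemma elln_eq (n : nat) : elln n = INR n + (ln 2 - euler_gamma).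
Proof.
  unfold elln, Rdiv. rewrite ln_mult, ln_Rinv by (try apply en_bounds; lra).
  unfold en. rewrite ln_exp. ring.
Qed.

Lemma is_lim_en_elln : is_lim_seq (fun n => en n * elln n) 0.
Proof.
  apply is_lim_seq_ext with (fun n => (INR n + 1) * en n + (ln 2 - euler_gamma - 1) * en n).
  - intros n. rewrite elln_eq. ring.
  - apply (is_lim_eq _ (0 + 0)); [|ring].
    apply is_lim_seq_plus'; [apply is_lim_n_en|apply is_lim_scal_0, is_lim_en].
Qed.

(** The two-sided bound of [kerint3_log] leaves an error of order [z |l| + z], where [l] is the
    singular part; the constant 3 bounds [e^z] for [z <= 1]. *)
Lemma is_lim_kerint3 : is_lim_seq (fun n => kerint 3 (en n) - elln n) 0.
Proof.
  apply is_lim_squeeze_0 with (fun n => 3 * Rabs (en n * elln n) + 3 * en n).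
  - intros n. assert (Hz := en_bounds n). set (z := en n) in *.
    destruct (kerint3_log z ltac:(lra)) as [B1 B2].
    change (- euler_gamma - ln (z / 2)) with (elln n) in B1, B2. set (l := elln n) in *.
    assert (E1 : 0 <= 1 - exp (- (z / 2)) <= z / 2).
    { assert (E := exp_ineq1_le (- (z / 2))).
      assert (exp (- (z / 2)) < exp 0) by (apply exp_increasing; lra). rewrite exp_0 in *. lra. }
    assert (E3 : exp z <= 3).
    { apply Rle_trans with (exp 1); [|apply exp_le_3].
      destruct (Rle_lt_or_eq_dec z 1) as [H|H]; [lra|left; apply exp_increasing; exact H|rewrite H; lra]. }
    assert (E2 : 0 <= exp z - 1 <= 3 * z).
    { assert (E := exp_ineq1_le z). assert (E' := exp_ineq1_le (- z)). rewrite exp_Ropp in E'.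
      split; [lra|].
      assert (X : exp z * (1 + - z) <= exp z * / exp z) by (apply Rmult_le_compat_l; lra).
      rewrite Rinv_r in X by lra.
      assert (exp z * z <= 3 * z) by (apply Rmult_le_compat_r; lra). lra. }
    assert (Al : Rabs (z * l) = z * Rabs l) by (rewrite Rabs_mult, (Rabs_right z) by lra; reflexivity).
    rewrite Al.
    assert (L1 := Rle_abs l). assert (L2 := Rle_abs (- l)). rewrite Rabs_Ropp in L2.
    assert (X1 : (1 - exp (- (z / 2))) * l <= z * Rabs l).
    { apply Rle_trans with ((1 - exp (- (z / 2))) * Rabs l); [apply Rmult_le_compat_l; lra|].
      apply Rmult_le_compat_r; lra. }
    assert (X2 : (exp z - 1) * l <= 3 * z * Rabs l).
    { apply Rle_trans with ((exp z - 1) * Rabs l); [apply Rmult_le_compat_l; lra|].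
      apply Rmult_le_compat_r; lra. }
    assert (X3 : exp z * (z / 2) <= 3 * (z / 2)) by (apply Rmult_le_compat_r; lra).
    assert (0 <= z * Rabs l) by (apply Rmult_le_pos; lra).
    apply Rabs_le. split; lra.
  - apply (is_lim_eq _ (3 * Rabs 0 + 3 * 0)); [|(rewrite Rabs_R0; ring)].
    apply is_lim_seq_plus'.
    + apply (is_lim_seq_scal_l _ 3 (Finite (Rabs 0))).
      apply (is_lim_seq_abs _ (Finite 0)), is_lim_en_elln.
    + apply (is_lim_seq_scal_l _ 3 (Finite 0)), is_lim_en.
Qed.

Lemma is_lim_en_kerint3 : is_lim_seq (fun n => en n * kerint 3 (en n)) 0.
Proof.
  apply is_lim_seq_ext with (fun n => en n * (kerint 3 (en n) - elln n) + en n * elln n).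
  - intros n. ring.
  - apply (is_lim_eq _ (0 * 0 + 0)); [|ring]. apply is_lim_seq_plus'; [|apply is_lim_en_elln].
    apply is_lim_seq_mult'; [apply is_lim_en|apply is_lim_kerint3].
Qed.

Lemma sin_abs_le (x : R) : 0 <= x -> Rabs (sin x) <= x.
Proof.
  intros Hx. apply Rabs_le. split.
  - apply (derive_nonneg_le (fun x => sin x + x) (fun x => cos x + 1)) in Hx.
    + rewrite sin_0 in Hx. lra.
    + intros t _. apply derR_plus; [apply is_derive_sin|apply derR_id].
    + intros t _. assert (H := COS_bound t). lra.
  - apply (derive_nonneg_le (fun x => x - sin x) (fun x => 1 - cos x)) in Hx.
    + rewrite sin_0 in Hx. lra.
    + intros t _. apply derR_minus; [apply derR_id|apply is_derive_sin].
    + intros t _. assert (H := COS_bound t). lra.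
Qed.

Lemma cos_1_abs_le (x : R) : 0 <= x <= 1 -> Rabs (cos x - 1) <= x.
Proof.
  intros Hx. replace (cos x) with (cos (2 * (x / 2))) by (f_equal; field).
  rewrite cos_2a_sin.
  assert (S := sin_abs_le (x / 2) ltac:(lra)). apply Rabs_le_between in S.
  apply Rabs_le. split; nra.
Qed.

Lemma is_lim_sin_kerint3 : is_lim_seq (fun n => sin (en n) * kerint 3 (en n)) 0.
Proof.
  apply is_lim_squeeze_0 with (fun n => Rabs (en n * kerint 3 (en n))).
  - intros n. assert (H := en_bounds n). rewrite !Rabs_mult.
    apply Rmult_le_compat_r; [apply Rabs_pos|]. rewrite (Rabs_right (en n)) by lra.
    apply sin_abs_le; lra.
  - rewrite <- Rabs_R0. apply (is_lim_seq_abs _ (Finite 0)), is_lim_en_kerint3.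
Qed.

Lemma is_lim_cos_kerint3 : is_lim_seq (fun n => (cos (en n) - 1) * kerint 3 (en n)) 0.
Proof.
  apply is_lim_squeeze_0 with (fun n => Rabs (en n * kerint 3 (en n))).
  - intros n. assert (H := en_bounds n). rewrite !Rabs_mult.
    apply Rmult_le_compat_r; [apply Rabs_pos|]. rewrite (Rabs_right (en n)) by lra.
    apply cos_1_abs_le; lra.
  - rewrite <- Rabs_R0. apply (is_lim_seq_abs _ (Finite 0)), is_lim_en_kerint3.
Qed.

Lemma is_lim_hankelR : is_lim_seq (fun n => hankelR (en n)) 1.
Proof.
  assert (HP := PI_RGT_0). unfold hankelR.
  apply (is_lim_eq _ (2 / PI * (cos 0 * (PI / 2) + 0))); [|(rewrite cos_0; field; lra)].
  apply (is_lim_seq_scal_l _ (2 / PI) (Finite (cos 0 * (PI / 2) + 0))).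
  apply is_lim_seq_plus'; [|apply is_lim_sin_kerint3].
  apply is_lim_seq_mult'; [|apply is_lim_kerint2].
  apply is_lim_cont; [apply continuous_cos|apply is_lim_en].
Qed.

Lemma is_lim_quarter : is_lim_seq (fun n => (en n / 2) ^ 2) 0.
Proof.
  apply (is_lim_eq _ ((0 / 2) ^ 2)); [|field].
  apply (is_lim_cont (fun z => (z / 2) ^ 2)); [|apply is_lim_en].
  apply (is_derive_continuous _ _ _ (is_derive_quarter_sq 0)).
Qed.

Lemma is_lim_bessel_J0 : is_lim_seq (fun n => bessel_J0 (en n)) 1.
Proof.
  rewrite <- j0_0. apply (is_lim_cont j0 (fun n => (en n / 2) ^ 2)); [|apply is_lim_quarter].
  apply (is_derive_continuous _ _ _ (is_derive_j0 0)).
Qed.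

(** [J_0(z) - 1] contains a factor [z^2], which outweighs the logarithmic growth of [elln]. *)
Lemma is_lim_elln_J0 : is_lim_seq (fun n => elln n * (bessel_J0 (en n) - 1)) 0.
Proof.
  set (q := PSeries (PS_decr_1 aJ)).
  assert (Hq : forall w, j0 w - 1 = w * q w).
  { intros w. unfold j0, q. rewrite (PSeries_decr_1 aJ) by (apply entire_ex, CV_radius_aJ).
    replace (aJ 0) with 1 by (unfold aJ; simpl; field). ring. }
  apply is_lim_seq_ext with (fun n => en n * elln n * (en n * / 4 * q ((en n / 2) ^ 2))).
  - intros n. rewrite bessel_J0_eq, Hq. field.
  - apply (is_lim_eq _ (0 * (0 * / 4 * q 0))); [|ring].
    apply is_lim_seq_mult'; [apply is_lim_en_elln|].
    apply is_lim_seq_mult'.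
    + apply is_lim_seq_mult'; [apply is_lim_en|apply is_lim_seq_const].
    + apply (is_lim_cont q (fun n => (en n / 2) ^ 2)); [|apply is_lim_quarter].
      eapply is_derive_continuous. apply entire_is_derive.
      rewrite CV_radius_decr_1. exact CV_radius_aJ.
Qed.

Lemma is_lim_y0 : is_lim_seq (fun n => y0 ((en n / 2) ^ 2)) 0.
Proof.
  rewrite <- y0_0. apply (is_lim_cont y0 (fun n => (en n / 2) ^ 2)); [|apply is_lim_quarter].
  apply (is_derive_continuous _ _ _ (is_derive_y0 0)).
Qed.

(** To leading order both functions equal [-(2/pi)] times [elln], Euler's constant included. The
    regrouping writes the difference as five terms each of which tends to 0. *)
Lemma is_lim_hankelI_Y0 : is_lim_seq (fun n => hankelI (en n) - bessel_Y0 (en n)) 0.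
Proof.
  apply is_lim_seq_ext with (fun n => 2 / PI * (sin (en n) * kerint 2 (en n)
     - (cos (en n) - 1) * kerint 3 (en n) - (kerint 3 (en n) - elln n)
     + elln n * (bessel_J0 (en n) - 1) + y0 ((en n / 2) ^ 2))).
  - intros n. rewrite bessel_Y0_eq. unfold hankelI, elln. ring.
  - apply (is_lim_eq _ (2 / PI * (sin 0 * (PI / 2) - 0 - 0 + 0 + 0))); [|(rewrite sin_0; ring)].
    apply (is_lim_seq_scal_l _ (2 / PI) (Finite (sin 0 * (PI / 2) - 0 - 0 + 0 + 0))).
    apply is_lim_seq_plus'; [|apply is_lim_y0].
    apply is_lim_seq_plus'; [|apply is_lim_elln_J0].
    apply is_lim_seq_minus'; [|apply is_lim_kerint3].
    apply is_lim_seq_minus'; [|apply is_lim_cos_kerint3].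
    apply is_lim_seq_mult'; [|apply is_lim_kerint2].
    apply is_lim_cont; [apply continuous_sin|apply is_lim_en].
Qed.

(** The logarithm excludes a [Y_0] component: once the convergent terms are removed,
    [b (2/pi) elln n] converges, yet its increments are constantly [b (2/pi)]. *)
Lemma bessel_comb_limit (a b l : R) :
  is_lim_seq (fun n => a * bessel_J0 (en n) + b * bessel_Y0 (en n)) l -> b = 0 /\ a = l.
Proof.
  intros H. assert (HP := PI_RGT_0).
  assert (Hb : is_lim_seq (fun n => b * (2 / PI) * elln n) (a - l)).
  { apply is_lim_seq_ext with (fun n => a * bessel_J0 (en n)
      - b * (2 / PI) * (elln n * (bessel_J0 (en n) - 1)) - b * (2 / PI) * y0 ((en n / 2) ^ 2)
      - (a * bessel_J0 (en n) + b * bessel_Y0 (en n))).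
    - intros n. rewrite bessel_Y0_eq. unfold elln. ring.
    - apply (is_lim_eq _ (a * 1 - 0 - 0 - l)); [|ring].
      apply is_lim_seq_minus'; [|exact H].
      apply is_lim_seq_minus'; [|apply is_lim_scal_0, is_lim_y0].
      apply is_lim_seq_minus'; [|apply is_lim_scal_0, is_lim_elln_J0].
      apply (is_lim_seq_scal_l _ a (Finite 1)), is_lim_bessel_J0. }
  assert (Hd : b * (2 / PI) = 0).
  { assert (D : is_lim_seq (fun n => b * (2 / PI) * elln (S n) - b * (2 / PI) * elln n) ((a - l) - (a - l))).
    { apply is_lim_seq_minus'; [|exact Hb].
      apply (is_lim_seq_incr_1 (fun n => b * (2 / PI) * elln n)). exact Hb. }
    apply is_lim_seq_unique in D. rewrite (Lim_seq_ext _ (fun _ => b * (2 / PI))) in D.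
    - rewrite Lim_seq_const in D. injection D as D. lra.
    - intros n. rewrite !elln_eq, S_INR. ring. }
  assert (Hb0 : b = 0).
  { apply Rmult_eq_reg_r with (2 / PI); [lra|]. apply Rgt_not_eq, Rdiv_lt_0_compat; lra. }
  split; [exact Hb0|]. rewrite Hb0 in H. assert (D : Finite (a * 1) = Finite l).
  { apply is_lim_seq_unique in H. rewrite <- H. symmetry. apply is_lim_seq_unique.
    apply is_lim_seq_ext with (fun n => a * bessel_J0 (en n)); [intros; ring|].
    apply (is_lim_seq_scal_l _ a (Finite 1)), is_lim_bessel_J0. }
  injection D as D. lra.
Qed.

Lemma bessel_J0_hankel (z : R) : 0 < z ->
  bessel_J0 z = hankelR z /\ bessel_J0' z = hankelR' z.
Proof.
  intros Hz. destruct (bessel_pair_decomp _ _ hankelR_pair) as [a [b H]].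
  destruct (bessel_comb_limit a b 1) as [-> ->].
  - apply is_lim_seq_ext with (2 := is_lim_hankelR).
    intros n. apply H, en_bounds.
  - destruct (H z Hz) as [-> ->]. split; ring.
Qed.

Lemma bessel_Y0_hankel (z : R) : 0 < z ->
  bessel_Y0 z = hankelI z /\ bessel_Y0' z = hankelI' z.
Proof.
  intros Hz. destruct (bessel_pair_decomp _ _ hankelI_pair) as [a [b H]].
  (* Applied to [hankelI - bessel_Y0], whose second coefficient is [b - 1]. *)
  destruct (bessel_comb_limit a (b - 1) 0) as [Hb ->].
  - apply is_lim_seq_ext with (2 := is_lim_hankelI_Y0).
    intros n. destruct (H (en n)) as [-> _]; [apply en_bounds|ring].
  - replace b with 1 in H by lra. destruct (H z Hz) as [-> ->]. split; ring.
Qed.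

(** * Behaviour at infinity *)

(* Limits as the first argument tends to infinity, uniform in the second; the
   limit function is required to be bounded so that products are stable. *)
Definition ulim (f : R -> R -> C) (g : R -> C) : Prop :=
  (forall eps, 0 < eps -> exists M, forall r t, M < r -> Cmod (f r t - g t)%C < eps) /\
  (exists B, forall t, Cmod (g t) <= B).

Lemma ulim_const (g : R -> C) (B : R) :
  (forall t, Cmod (g t) <= B) -> ulim (fun _ t => g t) g.
Proof.
  intros HB. split; [|exists B; exact HB].
  intros eps Heps. exists 0. intros r t _.
  replace (g t - g t)%C with (RtoC 0) by ring. rewrite Cmod_0. exact Heps.
Qed.

Lemma ulim_cst (c : C) : ulim (fun _ _ => c) (fun _ => c).
Proof. apply (ulim_const (fun _ => c) (Cmod c)). intros; lra. Qed.

Lemma ulim_ext_loc (f f' : R -> R -> C) (g : R -> C) (M0 : R) :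
  (forall r t, M0 < r -> f r t = f' r t) -> ulim f g -> ulim f' g.
Proof.
  intros E [H HB]. split; [|exact HB]. intros eps Heps.
  destruct (H eps Heps) as [M HM]. exists (Rmax M M0). intros r t Hr.
  rewrite <- E by (eapply Rle_lt_trans; [apply Rmax_r|exact Hr]).
  apply HM. eapply Rle_lt_trans; [apply Rmax_l|exact Hr].
Qed.

Lemma ulim_ext (f f' : R -> R -> C) (g g' : R -> C) :
  (forall r t, f r t = f' r t) -> (forall t, g t = g' t) -> ulim f g -> ulim f' g'.
Proof.
  intros E E' [H [B HB]]. split.
  - intros eps Heps. destruct (H eps Heps) as [M HM]. exists M. intros r t Hr.
    rewrite <- E, <- E'. apply HM, Hr.
  - exists B. intros t. rewrite <- E'. apply HB.
Qed.

Lemma ulim_plus (f1 f2 : R -> R -> C) (g1 g2 : R -> C) :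
  ulim f1 g1 -> ulim f2 g2 ->
  ulim (fun r t => f1 r t + f2 r t)%C (fun t => g1 t + g2 t)%C.
Proof.
  intros [H1 [B1 HB1]] [H2 [B2 HB2]]. split.
  - intros eps Heps. destruct (H1 (eps / 2)) as [M1 HM1]; [lra|].
    destruct (H2 (eps / 2)) as [M2 HM2]; [lra|]. exists (Rmax M1 M2). intros r t Hr.
    assert (K1 := HM1 r t (Rle_lt_trans _ _ _ (Rmax_l _ _) Hr)).
    assert (K2 := HM2 r t (Rle_lt_trans _ _ _ (Rmax_r _ _) Hr)).
    replace (f1 r t + f2 r t - (g1 t + g2 t))%C with ((f1 r t - g1 t) + (f2 r t - g2 t))%C by ring.
    eapply Rle_lt_trans; [apply Cmod_triangle|lra].
  - exists (B1 + B2). intros t. eapply Rle_trans; [apply Cmod_triangle|].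
    apply Rplus_le_compat; auto.
Qed.

Lemma ulim_mult (f1 f2 : R -> R -> C) (g1 g2 : R -> C) :
  ulim f1 g1 -> ulim f2 g2 ->
  ulim (fun r t => f1 r t * f2 r t)%C (fun t => g1 t * g2 t)%C.
Proof.
  intros [H1 [B1 HB1]] [H2 [B2 HB2]].
  assert (P1 : 0 <= B1) by (eapply Rle_trans; [apply Cmod_ge_0|apply (HB1 0)]).
  assert (P2 : 0 <= B2) by (eapply Rle_trans; [apply Cmod_ge_0|apply (HB2 0)]).
  split.
  - intros eps Heps. set (d := Rmin 1 (eps / (B1 + B2 + 1))).
    assert (Hd : 0 < d) by (apply Rmin_glb_lt; [lra|apply Rdiv_lt_0_compat; lra]).
    assert (Hd1 : d <= 1) by apply Rmin_l.
    assert (Hd2 : d * (B1 + B2 + 1) <= eps).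
    { apply Rle_trans with (eps / (B1 + B2 + 1) * (B1 + B2 + 1)).
      - apply Rmult_le_compat_r; [lra|apply Rmin_r].
      - right. field. lra. }
    destruct (H1 d Hd) as [M1 HM1]. destruct (H2 d Hd) as [M2 HM2].
    exists (Rmax M1 M2). intros r t Hr.
    assert (K1 := HM1 r t (Rle_lt_trans _ _ _ (Rmax_l _ _) Hr)).
    assert (K2 := HM2 r t (Rle_lt_trans _ _ _ (Rmax_r _ _) Hr)).
    replace (f1 r t * f2 r t - g1 t * g2 t)%C with
      ((f1 r t - g1 t) * (f2 r t - g2 t) + ((f1 r t - g1 t) * g2 t + g1 t * (f2 r t - g2 t)))%C by ring.
    eapply Rle_lt_trans; [apply Cmod_triangle|].
    eapply Rle_lt_trans; [apply Rplus_le_compat_l, Cmod_triangle|].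
    rewrite !Cmod_mult. specialize (HB1 t). specialize (HB2 t).
    assert (Q1 := Cmod_ge_0 (f1 r t - g1 t)). assert (Q2 := Cmod_ge_0 (f2 r t - g2 t)).
    assert (Q3 := Cmod_ge_0 (g1 t)). assert (Q4 := Cmod_ge_0 (g2 t)).
    set (x := Cmod (f1 r t - g1 t)) in *. set (y := Cmod (f2 r t - g2 t)) in *.
    set (u := Cmod (g1 t)) in *. set (v := Cmod (g2 t)) in *.
    apply Rlt_le_trans with (2 := Hd2).
    assert (x * y <= d * y) by (apply Rmult_le_compat_r; lra).
    assert (d * y <= 1 * y) by (apply Rmult_le_compat_r; lra).
    assert (x * v <= d * B2) by (apply Rmult_le_compat; lra).
    assert (u * y <= B1 * d) by (apply Rmult_le_compat; lra).
    lra.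
  - exists (B1 * B2). intros t. rewrite Cmod_mult. apply Rmult_le_compat; auto using Cmod_ge_0.
Qed.

Lemma Cmod_Cconj (z : C) : Cmod (Cconj z) = Cmod z.
Proof. unfold Cmod, Cconj. simpl. f_equal. ring. Qed.

Lemma ulim_conj (f : R -> R -> C) (g : R -> C) :
  ulim f g -> ulim (fun r t => Cconj (f r t)) (fun t => Cconj (g t)).
Proof.
  intros [H [B HB]]. split.
  - intros eps Heps. destruct (H eps Heps) as [M HM]. exists M. intros r t Hr.
    replace (Cconj (f r t) - Cconj (g t))%C with (Cconj (f r t - g t)).
    + rewrite Cmod_Cconj. apply HM, Hr.
    + unfold Cconj, Cminus, Cplus, Copp; simpl. f_equal; ring.
  - exists B. intros t. rewrite Cmod_Cconj. apply HB.
Qed.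

Lemma ulim_scal (c : C) (f : R -> R -> C) (g : R -> C) :
  ulim f g -> ulim (fun r t => c * f r t)%C (fun t => c * g t)%C.
Proof. apply (ulim_mult (fun _ _ => c) f (fun _ => c)), ulim_cst. Qed.

Lemma ulim_opp (f : R -> R -> C) (g : R -> C) :
  ulim f g -> ulim (fun r t => - f r t)%C (fun t => - g t)%C.
Proof.
  intros H. apply (ulim_ext (fun r t => RtoC (-1) * f r t)%C _ (fun t => RtoC (-1) * g t)%C).
  - intros. Ceq.
  - intros. Ceq.
  - apply ulim_scal, H.
Qed.

Lemma ulim_minus (f1 f2 : R -> R -> C) (g1 g2 : R -> C) :
  ulim f1 g1 -> ulim f2 g2 ->
  ulim (fun r t => f1 r t - f2 r t)%C (fun t => g1 t - g2 t)%C.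
Proof. intros H1 H2. apply ulim_plus; [exact H1|apply ulim_opp, H2]. Qed.

Lemma ulim_0 (f : R -> R -> C) (K M0 : R) :
  (forall r t, M0 < r -> Cmod (f r t) <= K / r) -> ulim f (fun _ => RtoC 0).
Proof.
  intros H. split.
  - intros eps Heps. exists (Rmax M0 (Rmax 1 (Rabs K / eps))). intros r t Hr.
    assert (Hr1 : M0 < r) by (eapply Rle_lt_trans; [apply Rmax_l|exact Hr]).
    assert (Hr2 : Rmax 1 (Rabs K / eps) < r) by (eapply Rle_lt_trans; [apply Rmax_r|exact Hr]).
    assert (Hr3 : 1 < r) by (eapply Rle_lt_trans; [apply Rmax_l|exact Hr2]).
    assert (Hr4 : Rabs K / eps < r) by (eapply Rle_lt_trans; [apply Rmax_r|exact Hr2]).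
    replace (f r t - RtoC 0)%C with (f r t) by ring.
    apply Rle_lt_trans with (1 := H r t Hr1).
    apply Rmult_lt_reg_r with r; [lra|]. unfold Rdiv. rewrite Rmult_assoc, Rinv_l by lra.
    assert (L := Rle_abs K). apply (Rmult_lt_compat_l eps) in Hr4; [|exact Heps].
    replace (eps * (Rabs K / eps)) with (Rabs K) in Hr4 by (field; lra). lra.
  - exists 0. intros _. rewrite Cmod_0. lra.
Qed.

Lemma ulim_comp (f : R -> C) (l : C) (rho : R -> R -> R) :
  ulim (fun r _ => f r) (fun _ => l) ->
  (forall M, exists M', forall r t, M' < r -> M < rho r t) ->
  ulim (fun r t => f (rho r t)) (fun _ => l).
Proof.
  intros [H [B HB]] Hr. split; [|exists B; exact HB].
  intros eps Heps. destruct (H eps Heps) as [M HM]. destruct (Hr M) as [M' HM'].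
  exists M'. intros r t Hrt. apply (HM (rho r t) 0), HM', Hrt.
Qed.

Lemma ulim_unique (f : R -> C) (l l' : C) :
  ulim (fun r _ => f r) (fun _ => l) -> ulim (fun r _ => f r) (fun _ => l') -> l = l'.
Proof.
  intros H H'. assert (D := ulim_minus _ _ _ _ H H'). destruct D as [D _].
  assert (Z : (l - l')%C = RtoC 0).
  { apply Cmod_eq_0. destruct (Rle_lt_or_eq_dec 0 (Cmod (l - l')) (Cmod_ge_0 _)) as [P|P]; [|symmetry; exact P].
    destruct (D _ P) as [M HM]. specialize (HM (M + 1) 0 ltac:(lra)).
    replace (f (M + 1)%R - f (M + 1)%R - (l - l'))%C with (- (l - l'))%C in HM by ring.
    rewrite Cmod_opp in HM. lra. }
  replace l with (l - l' + l')%C by ring. rewrite Z. ring.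
Qed.

(** The limit along the integers exists by monotone convergence, and monotonicity carries it over to
    real arguments. *)
Lemma monotone_ulim (f : R -> R) :
  (forall x y, 1 <= x <= y -> f y <= f x) -> (exists m, forall x, 1 <= x -> m <= f x) ->
  exists l : R, ulim (fun r _ => RtoC (f r)) (fun _ => RtoC l).
Proof.
  intros Hf [m Hm].
  assert (H : ex_finite_lim_seq (fun n => f (INR (S n)))).
  { apply (ex_finite_lim_seq_decr _ m).
    - intros n. apply Hf. rewrite (S_INR (S n)). assert (1 <= INR (S n)) by (apply (le_INR 1); lia). lra.
    - intros n. apply Hm. apply (le_INR 1); lia. }
  destruct H as [l Hl]. exists l. split; [|exists (Cmod l); intros; lra].
  intros eps Heps.
  assert (Hl' := Hl). apply is_lim_seq_spec in Hl'.
  destruct (Hl' (mkposreal _ Heps)) as [N HN].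
  change (forall n, (N <= n)%nat -> Rabs (f (INR (S n)) - l) < eps) in HN.
  assert (Hlow : forall x, 1 <= x -> l <= f x).
  { intros x Hx. destruct (nfloor_ex x) as [n0 Hn0]; [lra|].
    refine (is_lim_seq_le_loc _ (fun _ => f x) (Finite l) (Finite (f x)) _ Hl (is_lim_seq_const _)).
    exists n0. intros n Hn. apply Hf. apply le_INR in Hn. rewrite S_INR. lra. }
  exists (INR (S N)). intros r _ Hr. rewrite <- RtoC_minus, Cmod_R.
  assert (1 <= INR (S N)) by (apply (le_INR 1); lia).
  specialize (HN N (le_n N)). apply Rabs_def2 in HN.
  assert (f r <= f (INR (S N))) by (apply Hf; lra).
  assert (l <= f r) by (apply Hlow; lra). rewrite Rabs_right; lra.
Qed.

(** * Size of the integrals for large argument and the radiation limit *)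

Lemma ker_cos_le (m : nat) (z t : R) : 0 <= t <= PI / 2 -> ker m z (cos t) <= ker (S m) z (cos t).
Proof.
  intros Ht. rewrite <- (ker_mult m). assert (G := ker_ge_0 (S m) z (cos t)).
  assert (B := COS_bound t). 
  assert (0 <= cos t) by (apply cos_ge_0; lra).
  rewrite <- (Rmult_1_l (ker (S m) z (cos t))) at 2. apply Rmult_le_compat_r; lra.
Qed.

Lemma kerint_incr (m : nat) (z : R) : 0 < z -> kerint m z <= kerint (S m) z.
Proof.
  intros Hz. assert (HP := PI_RGT_0).
  apply RInt_le; [lra|apply ex_RInt_ker; exact Hz|apply ex_RInt_ker; exact Hz|].
  intros t Ht. apply ker_cos_le; lra.
Qed.

Lemma kerint_ge_0 (m : nat) (z : R) : 0 < z -> 0 <= kerint m z.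
Proof.
  intros Hz. assert (HP := PI_RGT_0).
  apply RInt_ge_0; [lra|apply ex_RInt_ker; exact Hz|intros; apply ker_ge_0].
Qed.

Lemma x_le_exp_half (x : R) : 0 <= x -> x <= exp (x / 2).
Proof.
  intros Hx. replace (x / 2) with (x / 4 + x / 4) by field. rewrite exp_plus.
  assert (E := exp_ineq1_le (x / 4)).
  apply Rle_trans with ((1 + x / 4) * (1 + x / 4)); [|apply Rmult_le_compat; lra].
  assert (Q := Rle_0_sqr (1 - x / 4)). unfold Rsqr in Q. lra.
Qed.

(** The difference is [(1/c) v e^(-zv)] with [v = 1/c - c]. The inequality [x e^(-x) <= e^(-x/2)] at
    [x = z v] trades the factor [v] for [1/z], at the price of halving [z] in the exponent. *)
Lemma ker42_le (z c : R) : 0 < z -> 0 < c <= 1 ->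
  ker 4 z c - ker 2 z c <= / z * ker 3 (z / 2) c.
Proof.
  intros Hz Hc. rewrite !ker_pos by lra.
  set (v := / c - c).
  assert (Hi : 0 < / c) by (apply Rinv_0_lt_compat; lra).
  assert (Hv : 0 <= v).
  { unfold v. assert (1 <= / c) by (rewrite <- Rinv_1; apply Rinv_le_contravar; lra). lra. }
  replace (exp (- (z * v)) * c ^ 2 * (/ c) ^ 4 - exp (- (z * v)) * c ^ 2 * (/ c) ^ 2)
    with (/ z * / c * (z * v * exp (- (z * v)))).
  2: { generalize (exp (- (z * v))). intros e. unfold v. field. lra. }
  replace (/ z * (exp (- (z / 2 * v)) * c ^ 2 * (/ c) ^ 3)) with (/ z * / c * exp (- (z / 2 * v))).
  2: { generalize (exp (- (z / 2 * v))). intros e. field. lra. }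
  apply Rmult_le_compat_l.
  { apply Rmult_le_pos; [inv_pos|lra]. }
  assert (Hzv : 0 <= z * v) by (apply Rmult_le_pos; lra).
  assert (X := x_le_exp_half (z * v) Hzv).
  apply Rle_trans with (exp (z * v / 2) * exp (- (z * v))).
  - apply Rmult_le_compat_r; [left; apply exp_pos|exact X].
  - rewrite <- exp_plus. right. f_equal. field.
Qed.

Lemma kerint42_le (z : R) : 0 < z ->
  0 <= kerint 3 z - kerint 1 z <= kerint 4 z - kerint 2 z /\
  kerint 4 z - kerint 2 z <= / z * kerint 3 (z / 2).
Proof.
  intros Hz. assert (HP := PI_RGT_0).
  assert (Ex : forall m z, 0 < z -> is_RInt (fun t => ker m z (cos t)) 0 (PI / 2) (kerint m z))
    by (intros; apply is_RInt_RInt, ex_RInt_ker; assumption).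
  assert (A := kerint_incr 1 z Hz). assert (B := kerint_incr 2 z Hz).
  split; [split; [lra|]|].
  - apply (is_RInt_le (fun t => ker 3 z (cos t) - ker 1 z (cos t))
      (fun t => ker 4 z (cos t) - ker 2 z (cos t)) 0 (PI / 2)); [lra| | |].
    + apply (is_RInt_minus (V := R_NormedModule)); apply Ex; exact Hz.
    + apply (is_RInt_minus (V := R_NormedModule)); apply Ex; exact Hz.
    + intros t Ht. rewrite <- (ker_mult 3), <- (ker_mult 1).
      assert (K2 := ker_cos_le 2 z t ltac:(lra)). assert (K3 := ker_cos_le 3 z t ltac:(lra)).
      assert (C := COS_bound t).
      assert (cos t * (ker 4 z (cos t) - ker 2 z (cos t)) <= 1 * (ker 4 z (cos t) - ker 2 z (cos t)))
        by (apply Rmult_le_compat_r; lra). lra.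
  - apply (is_RInt_le (fun t => ker 4 z (cos t) - ker 2 z (cos t))
      (fun t => / z * ker 3 (z / 2) (cos t)) 0 (PI / 2)); [lra| | |].
    + apply (is_RInt_minus (V := R_NormedModule)); apply Ex; exact Hz.
    + apply (is_RInt_scal (V := R_NormedModule)). apply Ex; lra.
    + intros t Ht. apply ker42_le; [exact Hz|]. split; [apply cos_gt_0; lra|apply COS_bound].
Qed.

(** The Wronskian of [J_0] and [Y_0] in the integral representation; the unimodular factor [e^(iz)]
    drops out through [sin^2 + cos^2 = 1]. *)
Lemma kerint_wronskian (z : R) : 0 < z ->
  z * (kerint 2 z * kerint 4 z + kerint 1 z * kerint 3 z) = PI / 2.
Proof.
  intros Hz. assert (HP := PI_RGT_0). assert (W := wronskian_JY z Hz).
  destruct (bessel_J0_hankel z Hz) as [E1 E2]. destruct (bessel_Y0_hankel z Hz) as [E3 E4].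
  rewrite E1, E2, E3, E4 in W. unfold hankelR, hankelR', hankelI, hankelI' in W.
  assert (S2 := sin_cos_sq z).
  apply Rmult_eq_reg_l with (4 / (PI * PI)).
  2: { apply Rgt_not_eq, Rdiv_lt_0_compat; [lra|apply Rmult_lt_0_compat; lra]. }
  transitivity (2 / PI); [|field; lra]. rewrite <- W.
  transitivity (4 / (PI * PI) * (z * (kerint 2 z * kerint 4 z + kerint 1 z * kerint 3 z)) *
     (sin z * sin z + cos z * cos z)); [rewrite S2; ring|].
  field. lra.
Qed.

(* The Wronskian identity bounds [kerint 2] and hence [kerint 1]; the difference
   [kerint 3 - kerint 1] is smaller by a factor [1 / z]. *)
Lemma sqrt_kerint3_bound (z : R) : / 2 <= z -> sqrt z * kerint 3 z <= 2 + 2 * kerint 3 (/ 4).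
Proof.
  intros Hz. assert (HP4 := PI_4).
  destruct (kerint42_le z ltac:(lra)) as [B1 B2]. assert (W := kerint_wronskian z ltac:(lra)).
  assert (K1 := kerint_ge_0 1 z ltac:(lra)). assert (K12 := kerint_incr 1 z ltac:(lra)).
  assert (Q := sqrt_sqrt z ltac:(lra)). assert (Sz : 0 < sqrt z) by (apply sqrt_lt_R0; lra).
  (* [kerint 3] decreases because its derivative [kerint 2 - kerint 4] is nonpositive, and [z/2] is
     at least [1/4]. *)
  assert (Hm : kerint 3 (z / 2) <= kerint 3 (/ 4)).
  { apply Ropp_le_cancel. apply (derive_nonneg_le (fun z => - kerint 3 z)
      (fun z => - (kerint 2 z - kerint 4 z))); [lra| |]; intros t Ht.
    - apply (is_derive_opp (kerint 3)), is_derive_kerint. lra.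
    - destruct (kerint42_le t ltac:(lra)). lra. }
  assert (M2 : sqrt z * kerint 2 z <= 2).
  { apply Rsqr_incr_0_var; [|lra]. unfold Rsqr.
    replace (sqrt z * kerint 2 z * (sqrt z * kerint 2 z)) with (z * (kerint 2 z * kerint 2 z)) by (rewrite <- Q at 1; ring).
    apply Rle_trans with (z * (kerint 2 z * kerint 4 z + kerint 1 z * kerint 3 z)); [|lra].
    apply Rmult_le_compat_l; [lra|].
    assert (kerint 2 z * kerint 2 z <= kerint 2 z * kerint 4 z) by (apply Rmult_le_compat_l; lra).
    assert (0 <= kerint 1 z * kerint 3 z) by (apply Rmult_le_pos; lra). lra. }
  assert (Hs : sqrt z * / z <= 2).
  { replace (/ z) with (/ (sqrt z * sqrt z)) by (rewrite Q; reflexivity).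
    replace (sqrt z * / (sqrt z * sqrt z)) with (/ sqrt z) by (field; lra).
    rewrite <- (Rinv_inv 2). apply Rinv_le_contravar; [lra|].
    rewrite <- (sqrt_Rsqr (/ 2)) by lra. apply sqrt_le_1_alt. unfold Rsqr. lra. }
  assert (K0 := kerint_ge_0 3 (z / 2) ltac:(lra)).
  apply Rle_trans with (sqrt z * kerint 2 z + sqrt z * / z * kerint 3 (z / 2)).
  - rewrite Rmult_assoc, <- Rmult_plus_distr_l. apply Rmult_le_compat_l; lra.
  - apply Rplus_le_compat; [exact M2|]. apply Rmult_le_compat; try lra.
    apply Rmult_le_pos; [lra|inv_pos].
Qed.

Lemma is_derive_sqrt' (z : R) : 0 < z -> is_derive sqrt z (/ (2 * sqrt z)).
Proof. intros Hz. auto_derive; [exact Hz|]. field. apply Rgt_not_eq, sqrt_lt_R0; exact Hz. Qed.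

(* For [G = sqrt z (kerint 2 - i kerint 3)], Bessel's equation makes the derivative
   of [2iG + G'] equal to [-G / (4z^2)]; its components are [ampA] and [ampB]. *)
Definition ampA (z : R) : R := sqrt z * (kerint 1 z + kerint 3 z) + kerint 2 z / (2 * sqrt z).
Definition ampB (z : R) : R := sqrt z * (kerint 2 z + kerint 4 z) - kerint 3 z / (2 * sqrt z).

Lemma is_derive_half_inv_sqrt (z : R) : 0 < z ->
  is_derive (fun z => / (2 * sqrt z)) z (- / (4 * z * sqrt z)).
Proof.
  intros Hz. assert (Hs : 0 < sqrt z) by (apply sqrt_lt_R0; exact Hz).
  assert (Q := sqrt_sqrt z ltac:(lra)).
  auto_derive; [split; [exact Hz|split; [lra|exact I]]|].
  replace z with (sqrt z * sqrt z) at 4 by exact Q. field. lra.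
Qed.

(** [kerint_rel1] eliminates [kerint 0], after which the terms with [sqrt z] and [1 / sqrt z]
    cancel. What remains has a constant sign, so the amplitude is monotone and a bound yields
    convergence. *)
Lemma is_derive_ampA (z : R) : 0 < z -> is_derive ampA z (- kerint 2 z / (4 * z * sqrt z)).
Proof.
  intros Hz. assert (Hs : 0 < sqrt z) by (apply sqrt_lt_R0; exact Hz).
  assert (D := fun m => is_derive_kerint m z Hz).
  eapply is_derive_eq.
  - apply derR_plus; apply derR_mult.
    + apply is_derive_sqrt'; exact Hz.
    + apply derR_plus; [exact (D 0%nat)|exact (D 2%nat)].
    + exact (D 1%nat).
    + apply is_derive_half_inv_sqrt; exact Hz.
  - cbv beta. assert (R1 := kerint_rel1 z Hz).
    assert (Q := sqrt_sqrt z ltac:(lra)). set (w := sqrt z) in *. clearbody w. subst z.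
    replace (kerint 0 (w * w)) with (kerint 4 (w * w) - kerint 1 (w * w) / (w * w)).
    + field. lra.
    + rewrite R1 at 1. field. lra.
Qed.

Lemma is_derive_ampB (z : R) : 0 < z -> is_derive ampB z (kerint 3 z / (4 * z * sqrt z)).
Proof.
  intros Hz. assert (Hs : 0 < sqrt z) by (apply sqrt_lt_R0; exact Hz).
  assert (D := fun m => is_derive_kerint m z Hz).
  eapply is_derive_eq.
  - apply derR_minus; apply derR_mult.
    + apply is_derive_sqrt'; exact Hz.
    + apply derR_plus; [exact (D 1%nat)|exact (D 3%nat)].
    + exact (D 2%nat).
    + apply is_derive_half_inv_sqrt; exact Hz.
  - cbv beta. assert (R1 := kerint_rel2 z Hz).
    assert (Q := sqrt_sqrt z ltac:(lra)). set (w := sqrt z) in *. clearbody w. subst z.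
    replace (kerint 5 (w * w)) with (kerint 1 (w * w) + kerint 4 (w * w) / (w * w)).
    + field. lra.
    + rewrite R1 at 1. field. lra.
Qed.

Lemma sqrt_kerint_bounds : exists C, 0 <= C /\ forall z, 1 <= z ->
  1 <= sqrt z /\
  (forall m, (m <= 3)%nat -> 0 <= sqrt z * kerint m z <= C /\ 0 <= kerint m z / (2 * sqrt z) <= C / z) /\
  0 <= sqrt z * (kerint 3 z - kerint 1 z) <= C / z /\
  0 <= sqrt z * (kerint 4 z - kerint 2 z) <= C / z.
Proof.
  assert (C0 := kerint_ge_0 3 (/ 4) ltac:(lra)).
  exists (2 * (2 + 2 * kerint 3 (/ 4))). set (C := 2 + 2 * kerint 3 (/ 4)) in *.
  assert (HC : 0 <= C) by (unfold C; lra). split; [lra|]. intros z Hz.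
  assert (Hs : 1 <= sqrt z) by (rewrite <- sqrt_1; apply sqrt_le_1_alt; lra).
  assert (Q := sqrt_sqrt z ltac:(lra)). assert (Hi : 0 < / z) by (apply Rinv_0_lt_compat; lra).
  destruct (kerint42_le z ltac:(lra)) as [B1 B2].
  assert (D : sqrt z * (kerint 4 z - kerint 2 z) <= 2 * C / z).
  { apply Rle_trans with (/ z * (sqrt z * kerint 3 (z / 2))).
    - rewrite <- Rmult_assoc, (Rmult_comm (/ z)), Rmult_assoc. apply Rmult_le_compat_l; lra.
    - unfold Rdiv. rewrite (Rmult_comm (2 * C)). apply Rmult_le_compat_l; [lra|].
      assert (Hh := sqrt_kerint3_bound (z / 2) ltac:(lra)). fold C in Hh.
      assert (K0 := kerint_ge_0 3 (z / 2) ltac:(lra)).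
      apply Rle_trans with (2 * (sqrt (z / 2) * kerint 3 (z / 2))); [|lra].
      rewrite <- Rmult_assoc. apply Rmult_le_compat_r; [exact K0|].
      replace 2 with (sqrt (2 * 2)) at 1 by (apply sqrt_square; lra).
      rewrite <- sqrt_mult by lra. apply sqrt_le_1_alt. lra. }
  split; [exact Hs|]. split; [|split].
  - intros m Hm. assert (K0 := kerint_ge_0 m z ltac:(lra)).
    assert (A := kerint_incr 0 z ltac:(lra)).
    assert (E := kerint_incr 2 z ltac:(lra)).
    assert (K3 : kerint m z <= kerint 3 z) by (destruct m as [|[|[|[|m]]]]; try lra; lia).
    assert (L : sqrt z * kerint m z <= C).
    { apply Rle_trans with (2 := sqrt_kerint3_bound z ltac:(lra)). apply Rmult_le_compat_l; lra. }
    assert (P : 0 <= sqrt z * kerint m z) by (apply Rmult_le_pos; lra).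
    split; [lra|].
    replace (kerint m z / (2 * sqrt z)) with (sqrt z * kerint m z / 2 / z)
      by (replace (_ / 2 / z) with (sqrt z * kerint m z / 2 / (sqrt z * sqrt z)) by (rewrite Q; reflexivity); field; lra).
    split; [apply Rmult_le_pos; lra|apply Rmult_le_compat_r; lra].
  - split; [apply Rmult_le_pos; lra|]. apply Rle_trans with (2 := D). apply Rmult_le_compat_l; lra.
  - split; [apply Rmult_le_pos; lra|exact D].
Qed.

Lemma ulim_ampA : exists a : R, ulim (fun z _ => RtoC (ampA z)) (fun _ => RtoC a).
Proof.
  destruct sqrt_kerint_bounds as [C [HC Bd]]. apply monotone_ulim.
  - intros x y Hxy. apply Ropp_le_cancel.
    apply (derive_nonneg_le (fun z => - ampA z) (fun z => - (- kerint 2 z / (4 * z * sqrt z)))); [lra| |].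
    + intros t Ht. apply (is_derive_opp ampA). apply is_derive_ampA; lra.
    + intros t Ht. assert (0 <= kerint 2 t) by (apply kerint_ge_0; lra).
      assert (0 < sqrt t) by (apply sqrt_lt_R0; lra).
      replace (- (- kerint 2 t / (4 * t * sqrt t))) with (kerint 2 t * / (4 * t * sqrt t)) by (field; lra).
      apply Rmult_le_pos; [lra|]. left. apply Rinv_0_lt_compat. repeat apply Rmult_lt_0_compat; lra.
  - exists 0. intros z Hz. destruct (Bd z Hz) as [Hs [B _]]. unfold ampA.
    destruct (B 1%nat ltac:(lia)) as [B1 _]. destruct (B 3%nat ltac:(lia)) as [B3 _].
    destruct (B 2%nat ltac:(lia)) as [_ B2]. lra.
Qed.

Lemma ulim_ampB : exists b : R, ulim (fun z _ => RtoC (ampB z)) (fun _ => RtoC b).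
Proof.
  destruct sqrt_kerint_bounds as [C [HC Bd]].
  destruct (monotone_ulim (fun z => - ampB z)) as [l Hl].
  - intros x y Hxy. apply Ropp_le_contravar.
    apply (derive_nonneg_le ampB (fun z => kerint 3 z / (4 * z * sqrt z))); [lra| |].
    + intros t Ht. apply is_derive_ampB; lra.
    + intros t Ht. assert (0 <= kerint 3 t) by (apply kerint_ge_0; lra).
      assert (0 < sqrt t) by (apply sqrt_lt_R0; lra).
      apply Rmult_le_pos; [lra|]. left. apply Rinv_0_lt_compat. repeat apply Rmult_lt_0_compat; lra.
  - exists (- (3 * C)). intros z Hz. destruct (Bd z Hz) as [Hs [B [_ D]]]. unfold ampB.
    destruct (B 2%nat ltac:(lia)) as [B2 _]. destruct (B 3%nat ltac:(lia)) as [_ B3].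
    assert (C / z <= C).
    { apply Rmult_le_reg_r with z; [lra|]. unfold Rdiv. rewrite Rmult_assoc, Rinv_l, Rmult_1_r by lra.
      rewrite <- (Rmult_1_r C) at 1. apply Rmult_le_compat_l; lra. }
    lra.
  - exists (- l). apply (ulim_ext (fun z _ => - RtoC (- ampB z))%C _ (fun _ => - RtoC l)%C).
    + intros. Ceq.
    + intros. Ceq.
    + apply ulim_opp, Hl.
Qed.

Lemma ulim_real_0 (f : R -> R) (K : R) : (forall z, 1 <= z -> 0 <= f z <= K / z) ->
  ulim (fun z _ => RtoC (f z)) (fun _ => RtoC 0).
Proof.
  intros H. apply (ulim_0 _ K 1). intros z t Hz. rewrite Cmod_R.
  specialize (H z ltac:(lra)). rewrite Rabs_right; lra.
Qed.

(** Up to errors [O(1/z)], [ampA] is both [2 sqrt z] times [kerint 1] and [2 sqrt z] times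
    [kerint 3], and [ampB] likewise for the indices 2 and 4. The limits are therefore shared in
    pairs. *)
Lemma kerint_asymp : exists a b : R,
  ulim (fun z _ => RtoC (sqrt z * kerint 1 z)) (fun _ => RtoC a) /\
  ulim (fun z _ => RtoC (sqrt z * kerint 3 z)) (fun _ => RtoC a) /\
  ulim (fun z _ => RtoC (sqrt z * kerint 2 z)) (fun _ => RtoC b) /\
  ulim (fun z _ => RtoC (sqrt z * kerint 4 z)) (fun _ => RtoC b).
Proof.
  destruct ulim_ampA as [a Ha]. destruct ulim_ampB as [b Hb]. exists (a / 2), (b / 2).
  destruct sqrt_kerint_bounds as [C [HC Bd]].
  assert (P : ulim (fun z _ => RtoC (sqrt z * (kerint 3 z - kerint 1 z))) (fun _ => RtoC 0))
    by (apply (ulim_real_0 _ C); intros; apply Bd; assumption).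
  assert (Q : ulim (fun z _ => RtoC (sqrt z * (kerint 4 z - kerint 2 z))) (fun _ => RtoC 0))
    by (apply (ulim_real_0 _ C); intros; apply Bd; assumption).
  assert (E2 : ulim (fun z _ => RtoC (kerint 2 z / (2 * sqrt z))) (fun _ => RtoC 0))
    by (apply (ulim_real_0 _ C); intros z Hz; apply (Bd z Hz); lia).
  assert (E3 : ulim (fun z _ => RtoC (kerint 3 z / (2 * sqrt z))) (fun _ => RtoC 0))
    by (apply (ulim_real_0 _ C); intros z Hz; apply (Bd z Hz); lia).
  assert (A1 := ulim_scal (RtoC (/ 2)) _ _ (ulim_minus _ _ _ _ (ulim_minus _ _ _ _ Ha E2) P)).
  assert (A3 := ulim_plus _ _ _ _ A1 P).
  assert (B2 := ulim_scal (RtoC (/ 2)) _ _ (ulim_minus _ _ _ _ (ulim_plus _ _ _ _ Hb E3) Q)).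
  assert (B4 := ulim_plus _ _ _ _ B2 Q).
  unfold ampA, ampB in *.
  split; [|split; [|split]]; [refine (ulim_ext _ _ _ _ _ _ A1)|refine (ulim_ext _ _ _ _ _ _ A3)|
    refine (ulim_ext _ _ _ _ _ _ B2)|refine (ulim_ext _ _ _ _ _ _ B4)];
    intros; apply injective_projections; simpl; unfold Rdiv;
    repeat match goal with |- context [/ (2 * sqrt ?r)] => generalize (/ (2 * sqrt r)) end;
    intros; field.
Qed.

Lemma Cexp_mul (a b : R) : (expi a * expi b)%C = expi (a + b).
Proof. unfold expi. rewrite cos_plus, sin_plus. Ceq. Qed.

Definition hankel1_0' (z : R) : C := (RtoC (bessel_J0' z) + Ci * RtoC (bessel_Y0' z))%C.

(** With [a], [b] from [kerint_asymp], the limit is [c = (2/pi)(b - i a)], and [a^2 + b^2 = pi/2] is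
    the limit form of [kerint_wronskian]. The derivative tends to [(2/pi)(a + i b) = i c]. *)
Lemma hankel_radiation : exists c : C,
  (c * Cconj c)%C = RtoC (2 / PI) /\
  ulim (fun z _ => RtoC (sqrt z) * expi (- z) * hankel1_0 z)%C (fun _ => c) /\
  ulim (fun z _ => RtoC (sqrt z) * expi (- z) * hankel1_0' z)%C (fun _ => Ci * c)%C.
Proof.
  assert (HP := PI_RGT_0).
  destruct kerint_asymp as [a [b [A1 [A3 [B2 B4]]]]].
  assert (Hab : b * b + a * a = PI / 2).
  { assert (X := ulim_plus _ _ _ _ (ulim_mult _ _ _ _ B2 B4) (ulim_mult _ _ _ _ A1 A3)).
    assert (Y : ulim (fun _ _ => RtoC (PI / 2)) (fun _ => RtoC b * RtoC b + RtoC a * RtoC a)%C).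
    { refine (ulim_ext_loc _ _ _ 0 _ X). intros z t Hz.
      rewrite <- (kerint_wronskian z Hz). assert (Q := sqrt_sqrt z ltac:(lra)).
      rewrite <- Q at 9. Ceq. }
    assert (Z := ulim_unique (fun _ => RtoC (PI / 2)) _ _ Y (ulim_cst _)).
    injection Z as Z. lra. }
  exists (RtoC (2 / PI) * (RtoC b - Ci * RtoC a))%C. split; [|split].
  - transitivity (RtoC (2 / PI * (2 / PI) * (b * b + a * a))).
    + Ceq.
    + rewrite Hab. f_equal. field. lra.
  - refine (ulim_ext_loc _ _ _ 0 _ (ulim_scal (RtoC (2 / PI)) _ _
       (ulim_minus _ _ _ _ B2 (ulim_scal Ci _ _ A3)))).
    intros z t Hz. unfold hankel1_0. destruct (bessel_J0_hankel z Hz) as [-> _].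
    destruct (bessel_Y0_hankel z Hz) as [-> _].
    transitivity (RtoC (sqrt z) * (expi (- z) * expi z) * (RtoC (2 / PI) * (RtoC (kerint 2 z) - Ci * RtoC (kerint 3 z))))%C.
    + rewrite Cexp_mul. replace (- z + z) with 0 by ring. unfold expi. rewrite cos_0, sin_0.
      Ceq.
    + unfold expi, hankelR, hankelI. Ceq.
  - refine (ulim_ext _ _ _ _ (fun _ _ => eq_refl) _ (ulim_ext_loc _ _ _ 0 _ (ulim_scal (RtoC (2 / PI)) _ _
       (ulim_plus _ _ _ _ A1 (ulim_scal Ci _ _ B4))))).
    { intros _. Ceq. }
    intros z t Hz. unfold hankel1_0'. destruct (bessel_J0_hankel z Hz) as [_ ->].
    destruct (bessel_Y0_hankel z Hz) as [_ ->].
    transitivity (RtoC (sqrt z) * (expi (- z) * expi z) * (RtoC (2 / PI) * (RtoC (kerint 1 z) + Ci * RtoC (kerint 4 z))))%C.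
    + rewrite Cexp_mul. replace (- z + z) with 0 by ring. unfold expi. rewrite cos_0, sin_0.
      Ceq.
    + unfold expi, hankelR', hankelI'. Ceq.
Qed.

(** * Complex-valued calculus on a half plane *)

Definition isD (f : R -> C) (t : R) (l : C) : Prop :=
  is_derive (fun s => Re (f s)) t (Re l) /\ is_derive (fun s => Im (f s)) t (Im l).

Lemma isD_eq (f : R -> C) (t : R) (l l' : C) : isD f t l -> l = l' -> isD f t l'.
Proof. intros H <-. exact H. Qed.

Lemma isD_unique (f : R -> C) (t : R) (l : C) : isD f t l -> derive_RC f t = l.
Proof.
  intros [H1 H2]. unfold derive_RC. destruct l as [a b].
  f_equal; apply is_derive_unique; assumption.
Qed.

Lemma isD_const (c : C) (t : R) : isD (fun _ => c) t (RtoC 0).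
Proof. split; [apply (derR_const (Re c))|apply (derR_const (Im c))]. Qed.

Lemma isD_RtoC (f : R -> R) (t l : R) : is_derive f t l -> isD (fun s => RtoC (f s)) t (RtoC l).
Proof. intros H. split; [exact H|apply (derR_const 0)]. Qed.

Lemma isD_plus (f g : R -> C) (t : R) (a b : C) :
  isD f t a -> isD g t b -> isD (fun s => f s + g s)%C t (a + b)%C.
Proof. intros [F1 F2] [G1 G2]. split; apply derR_plus; assumption. Qed.

Lemma isD_mult (f g : R -> C) (t : R) (a b : C) :
  isD f t a -> isD g t b -> isD (fun s => f s * g s)%C t (a * g t + f t * b)%C.
Proof.
  intros [F1 F2] [G1 G2]. split.
  - eapply is_derive_eq.
    + apply (derR_minus (fun s => Re (f s) * Re (g s)) (fun s => Im (f s) * Im (g s)));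
        apply derR_mult; eassumption.
    + unfold Re, Im. simpl. ring.
  - eapply is_derive_eq.
    + apply (derR_plus (fun s => Re (f s) * Im (g s)) (fun s => Im (f s) * Re (g s)));
        apply derR_mult; eassumption.
    + unfold Re, Im. simpl. ring.
Qed.

Lemma isD_conj (f : R -> C) (t : R) (a : C) : isD f t a -> isD (fun s => Cconj (f s)) t (Cconj a).
Proof. intros [F1 F2]. split; [exact F1|]. apply (is_derive_opp (fun s => Im (f s))). exact F2. Qed.

Lemma isD_comp (f : R -> C) (g : R -> R) (t : R) (a : C) (b : R) :
  isD f (g t) a -> is_derive g t b -> isD (fun s => f (g s)) t (a * RtoC b)%C.
Proof.
  intros [F1 F2] G. split.
  - eapply is_derive_eq; [apply (derR_comp (fun s => Re (f s)) g); eassumption|].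
    unfold Re, Im. simpl. ring.
  - eapply is_derive_eq; [apply (derR_comp (fun s => Im (f s)) g); eassumption|].
    unfold Re, Im. simpl. ring.
Qed.

Lemma isD_ext_loc (f g : R -> C) (t : R) (l : C) :
  locally t (fun s => f s = g s) -> isD f t l -> isD g t l.
Proof.
  intros E [H1 H2]. split; (eapply is_derive_ext_loc; [|eassumption]);
    apply filter_imp with (2 := E); intros s ->; reflexivity.
Qed.

Definition contC (f : point -> C) (p : point) : Prop :=
  continuous (fun p : R * R => Re (f p)) p /\ continuous (fun p : R * R => Im (f p)) p.

Lemma contC_const (c : C) (p : point) : contC (fun _ => c) p.
Proof. split; apply continuous_const. Qed.
Lemma contC_RtoC (f : R * R -> R) (p : point) : continuous f p -> contC (fun p => RtoC (f p)) p.
Proof. intros H. split; [exact H|apply continuous_const]. Qed.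
Lemma contC_plus (f g : point -> C) (p : point) :
  contC f p -> contC g p -> contC (fun p => f p + g p)%C p.
Proof. intros [F1 F2] [G1 G2]. split; apply cont2_plus; assumption. Qed.
Lemma contC_mult (f g : point -> C) (p : point) :
  contC f p -> contC g p -> contC (fun p => f p * g p)%C p.
Proof.
  intros [F1 F2] [G1 G2]. split.
  - apply (cont2_minus (fun p => Re (f p) * Re (g p)) (fun p => Im (f p) * Im (g p)));
      apply cont2_mult; assumption.
  - apply (cont2_plus (fun p => Re (f p) * Im (g p)) (fun p => Im (f p) * Re (g p)));
      apply cont2_mult; assumption.
Qed.
Lemma contC_opp (f : point -> C) (p : point) : contC f p -> contC (fun p => - f p)%C p.
Proof.
  intros [F1 F2]. split; [apply (continuous_opp (fun p : R * R => Re (f p)))|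
    apply (continuous_opp (fun p : R * R => Im (f p)))]; assumption.
Qed.
Lemma contC_minus (f g : point -> C) (p : point) :
  contC f p -> contC g p -> contC (fun p => f p - g p)%C p.
Proof. intros F G. apply contC_plus; [exact F|apply contC_opp, G]. Qed.

(* Differentiability with gradient [(g0, g1)] on the half plane [b < p_2],
   tested along all differentiable curves so that both the partial derivatives
   and the chain rule in polar coordinates are instances. *)
Definition has_grad (b : R) (f g0 g1 : point -> C) : Prop :=
  forall (c1 c2 : R -> R) (t v1 v2 : R),
    is_derive c1 t v1 -> is_derive c2 t v2 -> b < c2 t ->
    isD (fun s => f (c1 s, c2 s)) t
      (RtoC v1 * g0 (c1 t, c2 t) + RtoC v2 * g1 (c1 t, c2 t))%C.

Lemma has_grad_const (b : R) (c : C) : has_grad b (fun _ => c) (fun _ => RtoC 0) (fun _ => RtoC 0).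
Proof. intros c1 c2 t v1 v2 _ _ _. eapply isD_eq; [apply isD_const|]. ring. Qed.

Lemma has_grad_plus (b : R) (f f0 f1 g g0 g1 : point -> C) :
  has_grad b f f0 f1 -> has_grad b g g0 g1 ->
  has_grad b (fun p => f p + g p)%C (fun p => f0 p + g0 p)%C (fun p => f1 p + g1 p)%C.
Proof.
  intros F G c1 c2 t v1 v2 H1 H2 Hb. eapply isD_eq.
  - apply isD_plus; [apply (F c1 c2 t v1 v2 H1 H2 Hb)|apply (G c1 c2 t v1 v2 H1 H2 Hb)].
  - cbv beta. ring.
Qed.

Lemma has_grad_mult (b : R) (f f0 f1 g g0 g1 : point -> C) :
  has_grad b f f0 f1 -> has_grad b g g0 g1 ->
  has_grad b (fun p => f p * g p)%C (fun p => f0 p * g p + f p * g0 p)%C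
    (fun p => f1 p * g p + f p * g1 p)%C.
Proof.
  intros F G c1 c2 t v1 v2 H1 H2 Hb. eapply isD_eq.
  - apply isD_mult; [apply (F c1 c2 t v1 v2 H1 H2 Hb)|apply (G c1 c2 t v1 v2 H1 H2 Hb)].
  - cbv beta. ring.
Qed.

Lemma has_grad_ext (b : R) (f f0 f1 g0 g1 : point -> C) : has_grad b f f0 f1 ->
  (forall p, b < snd p -> f0 p = g0 p) -> (forall p, b < snd p -> f1 p = g1 p) ->
  has_grad b f g0 g1.
Proof.
  intros F E0 E1 c1 c2 t v1 v2 H1 H2 Hb. eapply isD_eq; [apply (F c1 c2 t v1 v2 H1 H2 Hb)|].
  rewrite E0, E1 by exact Hb. reflexivity.
Qed.

Lemma has_grad_scal (b : R) (c : C) (f f0 f1 : point -> C) : has_grad b f f0 f1 ->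
  has_grad b (fun p => c * f p)%C (fun p => c * f0 p)%C (fun p => c * f1 p)%C.
Proof.
  intros F. eapply has_grad_ext; [apply has_grad_mult; [apply has_grad_const|exact F]| |];
    intros p _; cbv beta; ring.
Qed.

Lemma has_grad_opp (b : R) (f f0 f1 : point -> C) : has_grad b f f0 f1 ->
  has_grad b (fun p => - f p)%C (fun p => - f0 p)%C (fun p => - f1 p)%C.
Proof.
  intros F c1 c2 t v1 v2 H1 H2 Hb.
  assert (D := has_grad_scal b (RtoC (-1)) f f0 f1 F c1 c2 t v1 v2 H1 H2 Hb).
  apply isD_ext_loc with (fun s => RtoC (-1) * f (c1 s, c2 s))%C.
  - apply filter_forall. intros s. Ceq.
  - eapply isD_eq; [exact D|]. cbv beta. Ceq.
Qed.

Lemma has_grad_minus (b : R) (f f0 f1 g g0 g1 : point -> C) :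
  has_grad b f f0 f1 -> has_grad b g g0 g1 ->
  has_grad b (fun p => f p - g p)%C (fun p => f0 p - g0 p)%C (fun p => f1 p - g1 p)%C.
Proof. intros F G. apply has_grad_plus; [exact F|apply has_grad_opp, G]. Qed.

Lemma has_grad_pderiv (b : R) (f f0 f1 : point -> C) (p : point) :
  has_grad b f f0 f1 -> b < snd p ->
  pderiv 0 f p = f0 p /\ pderiv 1 f p = f1 p.
Proof.
  intros F Hb. destruct p as [p0 p1]. simpl in Hb. split; simpl; apply isD_unique.
  - eapply isD_eq.
    + apply (F (fun t => t) (fun _ => p1) p0 1 0); [apply derR_id|apply derR_const|exact Hb].
    + cbv beta. ring.
  - eapply isD_eq.
    + apply (F (fun _ => p0) (fun t => t) p1 0 1); [apply derR_const|apply derR_id|exact Hb].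
    + cbv beta. ring.
Qed.

Lemma derive_RC_ext_loc (f g : R -> C) (t : R) :
  locally t (fun s => f s = g s) -> derive_RC f t = derive_RC g t.
Proof.
  intros E. unfold derive_RC. f_equal; apply Derive_ext_loc;
    apply filter_imp with (2 := E); intros s ->; reflexivity.
Qed.

(** The entries of [Gamma] are total functions whose closed form is valid only above the source; the
    half plane is open, so agreement there transfers to derivatives. *)
Lemma pderiv_ext_region (b : R) (j : nat) (f g : point -> C) (p : point) :
  (forall q, b < snd q -> f q = g q) -> b < snd p -> pderiv j f p = pderiv j g p.
Proof.
  intros E Hb. destruct j as [|j]; simpl; apply derive_RC_ext_loc.
  - apply filter_forall. intros t. apply E. exact Hb.
  - apply filter_imp with (2 := locally_gt _ _ Hb). intros t Ht. apply E. exact Ht.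
Qed.

(** * Radial waves and the Navier equation *)

(* [W n] is the [n]-th derivative of a radial Helmholtz solution written as a
   function of the squared distance [s]; [q] is a quarter of the squared
   wave number. *)
Definition radial (q : R) (W : nat -> R -> C) : Prop :=
  (forall n s, 0 < s -> isD (W n) s (W (S n) s)) /\
  (forall n s, 0 < s ->
     (RtoC s * W (S (S n)) s + RtoC (INR n + 1) * W (S n) s = - RtoC q * W n s)%C).

(** As [q] is real, the conjugate wave satisfies the same equation. This is how the conjugate of Γ
    enters Betti's identity as a Navier solution. *)
Lemma radial_conj (q : R) (W : nat -> R -> C) :
  radial q W -> radial q (fun n s => Cconj (W n s)).
Proof.
  intros [H1 H2]. split.
  - intros n s Hs. apply isD_conj, H1, Hs.
  - intros n s Hs. transitivity (Cconj (RtoC s * W (S (S n)) s + RtoC (INR n + 1) * W (S n) s)%C).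
    + Ceq.
    + rewrite H2 by exact Hs. Ceq.
Qed.

Definition dx (y : point) (a : nat) (p : point) : C := RtoC (coord a p - coord a y).
Definition sqd (y p : point) : R := dot (sub p y) (sub p y).
Definition Wf (W : nat -> R -> C) (y : point) (n : nat) (p : point) : C := W n (sqd y p).
Definition del (j k : nat) : C := RtoC (delta j k).

Section Wave.
Variables (al be : R) (k : nat) (W : nat -> R -> C) (y : point).

(* [al δ_jk Φ + be ∂_j∂_k Φ] and its first and second partial derivatives,
   for the radial function [Φ] with derivatives [W]. *)
Definition wave (j : nat) (p : point) : C :=
  (RtoC al * (del j k * Wf W y 0 p)
   + RtoC be * (RtoC 4 * (dx y j p * (dx y k p * Wf W y 2 p)) + RtoC 2 * (del j k * Wf W y 1 p)))%C.
Definition wave1 (a j : nat) (p : point) : C :=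
  (RtoC al * (del j k * (RtoC 2 * (dx y a p * Wf W y 1 p)))
   + RtoC be * (RtoC 8 * (dx y a p * (dx y j p * (dx y k p * Wf W y 3 p)))
      + RtoC 4 * ((del a j * dx y k p + del a k * dx y j p + del j k * dx y a p) * Wf W y 2 p)))%C.
Definition wave2 (b a j : nat) (p : point) : C :=
  (RtoC al * (del j k * (RtoC 4 * (dx y a p * (dx y b p * Wf W y 2 p)) + RtoC 2 * (del a b * Wf W y 1 p)))
   + RtoC be * (RtoC 16 * (dx y b p * (dx y a p * (dx y j p * (dx y k p * Wf W y 4 p))))
      + RtoC 8 * ((del a b * dx y j p * dx y k p + del b j * dx y a p * dx y k p
           + del b k * dx y a p * dx y j p + del a j * dx y b p * dx y k p
           + del a k * dx y b p * dx y j p + del j k * dx y a p * dx y b p) * Wf W y 3 p)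
      + RtoC 4 * ((del a j * del b k + del a k * del b j + del j k * del a b) * Wf W y 2 p)))%C.
End Wave.

Lemma sqd_pos (y p : point) (b : R) : snd y <= b -> b < snd p -> 0 < sqd y p.
Proof.
  intros Hy Hp. unfold sqd, dot, sub. simpl.
  assert (0 < (snd p - snd y) * (snd p - snd y)) by (apply Rmult_lt_0_compat; lra).
  assert (0 <= (fst p - fst y) * (fst p - fst y)) by apply Rle_0_sqr. lra.
Qed.

Lemma has_grad_dx (b : R) (y : point) (a : nat) :
  (a < 2)%nat -> has_grad b (dx y a) (fun _ => del a 0) (fun _ => del a 1).
Proof.
  intros Ha c1 c2 t v1 v2 H1 H2 _. unfold dx, del.
  destruct a as [|[|a]]; [| |lia]; unfold coord, delta; simpl.
  - eapply isD_eq.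
    + apply isD_RtoC, (derR_minus c1 (fun _ => fst y)); [exact H1|apply derR_const].
    + Ceq.
  - eapply isD_eq.
    + apply isD_RtoC, (derR_minus c2 (fun _ => snd y)); [exact H2|apply derR_const].
    + Ceq.
Qed.

Lemma has_grad_Wf (b q : R) (W : nat -> R -> C) (y : point) (n : nat) :
  radial q W -> snd y <= b ->
  has_grad b (Wf W y n) (fun p => RtoC 2 * (dx y 0 p * Wf W y (S n) p))%C
    (fun p => RtoC 2 * (dx y 1 p * Wf W y (S n) p))%C.
Proof.
  intros [HW _] Hy c1 c2 t v1 v2 H1 H2 Hb.
  assert (Hs : 0 < sqd y (c1 t, c2 t)) by (apply (sqd_pos _ _ b); assumption).
  eapply isD_eq.
  - apply (isD_comp (W n) (fun s => sqd y (c1 s, c2 s))); [apply HW, Hs|].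
    unfold sqd, dot, sub. simpl. apply derR_plus; apply derR_mult; apply derR_minus;
      first [eassumption|apply derR_const].
  - unfold Wf, dx, coord. Ceq.
Qed.

Lemma contC_dx (y : point) (a : nat) (p : point) : contC (dx y a) p.
Proof.
  apply contC_RtoC. destruct a; simpl.
  - apply (cont2_minus (fun p => fst p) (fun _ => fst y)); [apply cont2_fst|apply cont2_const].
  - apply (cont2_minus (fun p => snd p) (fun _ => snd y)); [apply cont2_snd|apply cont2_const].
Qed.

Lemma continuous_sqd (y p : point) : continuous (fun p : R * R => sqd y p) p.
Proof.
  assert (F : continuous (fun p : R * R => fst p - fst y) p)
    by (apply (cont2_minus (fun p => fst p) (fun _ => fst y)); [apply cont2_fst|apply cont2_const]).
  assert (G : continuous (fun p : R * R => snd p - snd y) p)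
    by (apply (cont2_minus (fun p => snd p) (fun _ => snd y)); [apply cont2_snd|apply cont2_const]).
  apply (cont2_plus (fun p : R * R => (fst p - fst y) * (fst p - fst y))
    (fun p : R * R => (snd p - snd y) * (snd p - snd y))).
  - exact (cont2_mult _ _ _ F F).
  - exact (cont2_mult _ _ _ G G).
Qed.

Lemma contC_Wf (b q : R) (W : nat -> R -> C) (y : point) (n : nat) (p : point) :
  radial q W -> snd y <= b -> b < snd p -> contC (Wf W y n) p.
Proof.
  intros [HW _] Hy Hb. destruct (HW n _ (sqd_pos y p b Hy Hb)) as [H1 H2]. split.
  - apply (cont2_comp (fun s => Re (W n s)) (fun p => sqd y p)); [apply continuous_sqd|].
    eapply is_derive_continuous, H1.
  - apply (cont2_comp (fun s => Im (W n s)) (fun p => sqd y p)); [apply continuous_sqd|].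
    eapply is_derive_continuous, H2.
Qed.

Ltac two_cases H := match type of H with (?j < 2)%nat =>
  destruct j as [|[|?]]; [clear H|clear H|exfalso; clear - H; lia] end.

Section WaveCalculus.
Variables (al be : R) (W : nat -> R -> C) (y : point) (b q : R).
Hypothesis (HW : radial q W) (Hy : snd y <= b).

Ltac hgrad :=
  match goal with
  | |- has_grad _ (fun p => (@?f p + @?g p)%C) _ _ => refine (has_grad_plus b f _ _ g _ _ _ _); hgrad
  | |- has_grad _ (fun p => (@?f p * @?g p)%C) _ _ => refine (has_grad_mult b f _ _ g _ _ _ _); hgrad
  | |- has_grad _ (fun p => dx _ ?a p) _ _ => refine (has_grad_dx b y a _); first [assumption|lia]
  | |- has_grad _ (fun p => Wf _ _ ?n p) _ _ => exact (has_grad_Wf b q W y n HW Hy)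
  | |- has_grad _ (fun p => ?c) _ _ => exact (has_grad_const b c)
  end.

Lemma has_grad_wave (k : nat) (j : nat) : (k < 2)%nat -> (j < 2)%nat ->
  has_grad b (wave al be k W y j) (wave1 al be k W y 0 j) (wave1 al be k W y 1 j).
Proof.
  intros Hk Hj. eapply has_grad_ext; [unfold wave; hgrad| |]; intros p _;
    unfold wave1; two_cases Hj; two_cases Hk; unfold del, delta; simpl Nat.eqb; cbv iota;
    ring.
Qed.

Lemma has_grad_wave1 (k : nat) (a j : nat) : (a < 2)%nat -> (k < 2)%nat -> (j < 2)%nat ->
  has_grad b (wave1 al be k W y a j) (wave2 al be k W y 0 a j) (wave2 al be k W y 1 a j).
Proof.
  intros Ha Hk Hj. eapply has_grad_ext; [unfold wave1; hgrad| |]; intros p _;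
    unfold wave2; two_cases Ha; two_cases Hj; two_cases Hk; unfold del, delta; simpl Nat.eqb; cbv iota;
    ring.
Qed.

Ltac hcont :=
  match goal with
  | |- contC (fun p => (@?f p + @?g p)%C) _ => refine (contC_plus f g _ _ _); hcont
  | |- contC (fun p => (@?f p * @?g p)%C) _ => refine (contC_mult f g _ _ _); hcont
  | |- contC (fun p => dx _ _ p) _ => apply contC_dx
  | |- contC (fun p => Wf _ _ ?n p) _ => apply (contC_Wf b q W y n); assumption
  | |- contC (fun p => ?c) _ => exact (contC_const c _)
  end.

Lemma contC_wave (k : nat) (j : nat) (p : point) : b < snd p -> contC (wave al be k W y j) p.
Proof. intros Hp. unfold wave. hcont. Qed.
Lemma contC_wave1 (k : nat) (a j : nat) (p : point) : b < snd p -> contC (wave1 al be k W y a j) p.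
Proof. intros Hp. unfold wave1. hcont. Qed.
Lemma contC_wave2 (k : nat) (c a j : nat) (p : point) : b < snd p -> contC (wave2 al be k W y c a j) p.
Proof. intros Hp. unfold wave2. hcont. Qed.

Lemma wave2_sym (k : nat) (j : nat) (p : point) : (k < 2)%nat -> (j < 2)%nat ->
  wave2 al be k W y 0 1 j p = wave2 al be k W y 1 0 j p.
Proof.
  intros Hk Hj. unfold wave2. two_cases Hj; two_cases Hk; unfold del, delta; simpl Nat.eqb; cbv iota; ring.
Qed.

Lemma radial_at (n : nat) (p : point) : b < snd p ->
  ((dx y 0 p * dx y 0 p + dx y 1 p * dx y 1 p) * Wf W y (S (S n)) p
    + RtoC (INR n + 1) * Wf W y (S n) p = - RtoC q * Wf W y n p)%C.
Proof.
  intros Hp. destruct HW as [_ H2]. unfold Wf. rewrite <- H2 by (apply (sqd_pos _ _ b); assumption).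
  f_equal. f_equal. unfold dx, sqd, dot, sub, coord. Ceq.
Qed.

Lemma wave_laplace (k : nat) (j : nat) (p : point) : (k < 2)%nat -> (j < 2)%nat -> b < snd p ->
  (wave2 al be k W y 0 0 j p + wave2 al be k W y 1 1 j p = - RtoC (4 * q) * wave al be k W y j p)%C.
Proof.
  intros Hk Hj Hp. assert (E0 := radial_at 0 p Hp). assert (E1 := radial_at 1 p Hp).
  assert (E2 := radial_at 2 p Hp). simpl INR in E0, E1, E2.
  (* The Laplacian produces only the combinations of [radial_at] at orders 0, 1 and 2; the
     intermediate expression records their coefficients. *)
  transitivity (RtoC al * del j k * (RtoC 4 * (- RtoC q * Wf W y 0 p))
    + RtoC be * (RtoC 16 * dx y j p * dx y k p * (- RtoC q * Wf W y 2 p)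
        + RtoC 8 * del j k * (- RtoC q * Wf W y 1 p)))%C.
  - rewrite <- E0, <- E1, <- E2. unfold wave2. rewrite !RtoC_plus.
    two_cases Hj; two_cases Hk; unfold del, delta; simpl Nat.eqb; cbv iota; 
    generalize (dx y 0 p) (dx y 1 p) (Wf W y 1 p) (Wf W y 2 p) (Wf W y 3 p) (Wf W y 4 p); intros; Ceq.
  - unfold wave. rewrite RtoC_mult.
    generalize (dx y j p) (dx y k p) (del j k) (Wf W y 0 p) (Wf W y 1 p) (Wf W y 2 p); intros; Ceq.
Qed.

(** The divergence of column [k] is [(al + be Laplacian) d_k Phi = (al - 4 q be) d_k Phi], and
    [wave 0 1] is the Hessian of [Phi]. *)
Lemma wave_grad_div (k : nat) (j : nat) (p : point) : (k < 2)%nat -> (j < 2)%nat -> b < snd p ->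
  (wave2 al be k W y j 0 0 p + wave2 al be k W y j 1 1 p
   = RtoC (al - 4 * q * be) * wave 0 1 k W y j p)%C.
Proof.
  intros Hk Hj Hp. assert (E0 := radial_at 0 p Hp). assert (E1 := radial_at 1 p Hp).
  assert (E2 := radial_at 2 p Hp). simpl INR in E0, E1, E2.
  transitivity (RtoC al * wave 0 1 k W y j p
    + RtoC be * (RtoC 16 * dx y j p * dx y k p * (- RtoC q * Wf W y 2 p)
        + RtoC 8 * del j k * (- RtoC q * Wf W y 1 p)))%C.
  - rewrite <- E1, <- E2. unfold wave2, wave. rewrite !RtoC_plus.
    two_cases Hj; two_cases Hk; unfold del, delta; simpl Nat.eqb; cbv iota;
    generalize (dx y 0 p) (dx y 1 p) (Wf W y 0 p) (Wf W y 1 p) (Wf W y 2 p) (Wf W y 3 p) (Wf W y 4 p); intros; Ceq.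
  - unfold wave.
    generalize (dx y j p) (dx y k p) (del j k) (Wf W y 0 p) (Wf W y 1 p) (Wf W y 2 p); intros; Ceq.
Qed.
End WaveCalculus.

Definition vect : Type := nat -> point -> C.

(* [u1 a j] and [u2 b a j] stand for [∂_a u_j] and [∂_b ∂_a u_j]. *)
Definition navier_sol (mu lam om b : R) (u : vect) (u1 : nat -> vect) (u2 : nat -> nat -> vect) : Prop :=
  (forall j, (j < 2)%nat -> has_grad b (u j) (u1 0%nat j) (u1 1%nat j)) /\
  (forall a j, (a < 2)%nat -> (j < 2)%nat -> has_grad b (u1 a j) (u2 0%nat a j) (u2 1%nat a j)) /\
  (forall j p, (j < 2)%nat -> b < snd p -> u2 0%nat 1%nat j p = u2 1%nat 0%nat j p) /\
  (forall j p, (j < 2)%nat -> b < snd p ->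
     (RtoC mu * (u2 0%nat 0%nat j p + u2 1%nat 1%nat j p)
      + RtoC (lam + mu) * (u2 j 0%nat 0%nat p + u2 j 1%nat 1%nat p)
      + RtoC (om ^ 2) * u j p = RtoC 0)%C) /\
  (forall p, b < snd p -> (forall j, contC (u j) p) /\ (forall a j, contC (u1 a j) p) /\
     (forall c a j, contC (u2 c a j) p)).

Lemma navier_sol_plus (mu lam om b : R) u u1 u2 v v1 v2 :
  navier_sol mu lam om b u u1 u2 -> navier_sol mu lam om b v v1 v2 ->
  navier_sol mu lam om b (fun j p => u j p + v j p)%C (fun a j p => u1 a j p + v1 a j p)%C
    (fun c a j p => u2 c a j p + v2 c a j p)%C.
Proof.
  intros [A1 [A2 [A3 [A4 A5]]]] [B1 [B2 [B3 [B4 B5]]]].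
  split; [|split; [|split; [|split]]].
  - intros j Hj. apply has_grad_plus; auto.
  - intros a j Ha Hj. apply has_grad_plus; auto.
  - intros j p Hj Hp. rewrite A3, B3 by assumption. reflexivity.
  - intros j p Hj Hp. specialize (A4 j p Hj Hp). specialize (B4 j p Hj Hp).
    rewrite <- (Cplus_0_l (RtoC 0)). rewrite <- A4 at 1. rewrite <- B4. ring.
  - intros p Hp. destruct (A5 p Hp) as [X1 [X2 X3]]. destruct (B5 p Hp) as [Y1 [Y2 Y3]].
    split; [|split]; intros; apply contC_plus; auto.
Qed.

(** The two conditions are the coefficients of [delta_jk Phi] and [d_j d_k Phi] after applying the
    Navier operator. A shear wave meets them through [4 q mu = om^2] and [al = 4 q be], a pressure
    wave through [al = 0] and [4 q (lam + 2 mu) = om^2]. *)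
Lemma navier_sol_wave (mu lam om b al be q : R) (k : nat) (W : nat -> R -> C) (y : point) :
  (k < 2)%nat -> radial q W -> snd y <= b ->
  al * (om ^ 2 - 4 * q * mu) = 0 ->
  be * (om ^ 2 - 4 * q * mu) + (lam + mu) * (al - 4 * q * be) = 0 ->
  navier_sol mu lam om b (wave al be k W y) (wave1 al be k W y) (wave2 al be k W y).
Proof.
  intros Hk HW Hy C1 C2. split; [|split; [|split; [|split]]].
  - intros j Hj. apply (has_grad_wave al be W y b q); assumption.
  - intros a j Ha Hj. apply (has_grad_wave1 al be W y b q); assumption.
  - intros j p Hj Hp. apply (wave2_sym al be W y); assumption.
  - intros j p Hj Hp. rewrite (wave_laplace al be W y b q) by assumption.
    rewrite (wave_grad_div al be W y b q) by assumption.
    transitivity (RtoC (al * (om ^ 2 - 4 * q * mu)) * (del j k * Wf W y 0 p)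
      + RtoC (be * (om ^ 2 - 4 * q * mu) + (lam + mu) * (al - 4 * q * be)) * wave 0 1 k W y j p)%C.
    + unfold wave. generalize (dx y j p) (dx y k p) (del j k) (Wf W y 0 p) (Wf W y 1 p) (Wf W y 2 p); intros; Ceq.
    + rewrite C1, C2. ring.
  - intros p Hp. split; [|split]; intros.
    + apply (contC_wave al be W y b q); assumption.
    + apply (contC_wave1 al be W y b q); assumption.
    + apply (contC_wave2 al be W y b q); assumption.
Qed.

Lemma wave_conj (al be : R) (k : nat) (W : nat -> R -> C) (y : point) (j : nat) (p : point) :
  Cconj (wave al be k W y j p) = wave al be k (fun n s => Cconj (W n s)) y j p.
Proof. unfold wave, Wf, dx, del. Ceq. Qed.

Lemma wave1_conj (al be : R) (k : nat) (W : nat -> R -> C) (y : point) (a j : nat) (p : point) :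
  Cconj (wave1 al be k W y a j p) = wave1 al be k (fun n s => Cconj (W n s)) y a j p.
Proof. unfold wave1, Wf, dx, del. Ceq. Qed.

(** * Conservation of the flux *)

Definition polar (H r t : R) : point := (r * cos t, H + r * sin t).

Lemma contC_comp (g : point -> C) (c1 c2 : R * R -> R) (p : R * R) :
  continuous c1 p -> continuous c2 p -> contC g (c1 p, c2 p) ->
  contC (fun p => g (c1 p, c2 p)) p.
Proof.
  intros H1 H2 [G1 G2]. split.
  - apply (cont2_pair c1 c2 (fun p => Re (g p))); assumption.
  - apply (cont2_pair c1 c2 (fun p => Im (g p))); assumption.
Qed.

Lemma cont2_cos_snd (p : R * R) : continuous (fun p : R * R => cos (snd p)) p.
Proof. apply (cont2_comp cos (fun p => snd p)); [apply cont2_snd|apply continuous_cos]. Qed.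
Lemma cont2_sin_snd (p : R * R) : continuous (fun p : R * R => sin (snd p)) p.
Proof. apply (cont2_comp sin (fun p => snd p)); [apply cont2_snd|apply continuous_sin]. Qed.

Lemma cont2_polar1 (p : R * R) : continuous (fun p : R * R => fst p * cos (snd p)) p.
Proof. exact (cont2_mult _ _ p (cont2_fst p) (cont2_cos_snd p)). Qed.
Lemma cont2_polar2 (H : R) (p : R * R) : continuous (fun p : R * R => H + fst p * sin (snd p)) p.
Proof.
  exact (cont2_plus (fun _ => H) _ p (cont2_const H p) (cont2_mult _ _ p (cont2_fst p) (cont2_sin_snd p))).
Qed.

Lemma contC_polar (H : R) (g : point -> C) (r t : R) : contC g (polar H r t) ->
  contC (fun p => g (polar H (fst p) (snd p))) (r, t).
Proof.
  intros Hg. apply (contC_comp g (fun p => fst p * cos (snd p)) (fun p => H + fst p * sin (snd p)));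
    [apply cont2_polar1|apply cont2_polar2|exact Hg].
Qed.

Lemma continuous_slice (f : R * R -> R) (r t : R) :
  continuous f (r, t) -> continuous (fun t => f (r, t)) t.
Proof.
  intros Hf. apply (continuous_comp_2 (fun _ : R => r) (fun t : R => t) (fun r t => f (r, t))).
  - apply continuous_const.
  - apply continuous_id.
  - apply (continuous_ext f); [intros [u v]; reflexivity|exact Hf].
Qed.

Lemma continuous_slice1 (f : R * R -> R) (r t : R) :
  continuous f (r, t) -> continuous (fun r => f (r, t)) r.
Proof.
  intros Hf. apply (continuous_comp_2 (fun r : R => r) (fun _ : R => t) (fun r t => f (r, t))).
  - apply continuous_id.
  - apply continuous_const.
  - apply (continuous_ext f); [intros [u v]; reflexivity|exact Hf].
Qed.

Definition ex_RIntC (f : R -> C) (a b : R) : Prop :=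
  ex_RInt (fun t => Re (f t)) a b /\ ex_RInt (fun t => Im (f t)) a b.

Lemma is_RInt_C (f : R -> C) (a b : R) : ex_RIntC f a b ->
  is_RInt (V := C_R_NormedModule) f a b (RInt (fun t => Re (f t)) a b, RInt (fun t => Im (f t)) a b).
Proof.
  intros [H1 H2]. apply (is_RInt_fct_extend_pair (U := R_NormedModule) (V := R_NormedModule)).
  - apply is_RInt_RInt, H1.
  - apply is_RInt_RInt, H2.
Qed.

Lemma integral_RC_eq (f : R -> C) (a b : R) : ex_RIntC f a b ->
  integral_RC f a b = (RInt (fun t => Re (f t)) a b, RInt (fun t => Im (f t)) a b).
Proof. intros Hf. apply (is_RInt_unique (V := C_R_CompleteNormedModule)). exact (is_RInt_C f a b Hf). Qed.

Lemma integral_RC_ext (f g : R -> C) (a b : R) :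
  (forall t, f t = g t) -> integral_RC f a b = integral_RC g a b.
Proof. intros E. apply (RInt_ext (V := C_R_CompleteNormedModule)). intros t _. apply E. Qed.

Lemma ex_RIntC_ext (f g : R -> C) (a b : R) : (forall t, f t = g t) -> ex_RIntC f a b -> ex_RIntC g a b.
Proof.
  intros E [H1 H2].
  split; [refine (ex_RInt_ext _ _ _ _ _ H1)|refine (ex_RInt_ext _ _ _ _ _ H2)]; intros t _;
    rewrite E; reflexivity.
Qed.

Definition contRC (f : R -> C) (t : R) : Prop :=
  continuous (fun t => Re (f t)) t /\ continuous (fun t => Im (f t)) t.

Lemma ex_RIntC_cont (f : R -> C) (a b : R) :
  (forall t, Rmin a b <= t <= Rmax a b -> contRC f t) -> ex_RIntC f a b.
Proof.
  intros H. split; apply (ex_RInt_continuous (V := R_CompleteNormedModule)); intros t Ht; apply (H t Ht).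
Qed.

Section HalfDisc.
Variables (b H : R) (F0 F1 F00 F01 F10 F11 : point -> C).
Hypothesis (HbH : b < H).
Hypothesis (G0 : has_grad b F0 F00 F01) (G1 : has_grad b F1 F10 F11).
Hypothesis (Hdiv : forall p, b < snd p -> (F00 p + F11 p = RtoC 0)%C).
Hypothesis (Hc : forall p, b < snd p ->
  contC F0 p /\ contC F1 p /\ contC F00 p /\ contC F01 p /\ contC F10 p /\ contC F11 p).

Definition radial_flux (r t : R) : C :=
  (RtoC r * (RtoC (cos t) * F0 (polar H r t) + RtoC (sin t) * F1 (polar H r t)))%C.
Definition radial_flux' (r t : R) : C :=
  ((RtoC (cos t) * F0 (polar H r t) + RtoC (sin t) * F1 (polar H r t))
   + RtoC r * (RtoC (cos t) * (RtoC (cos t) * F00 (polar H r t) + RtoC (sin t) * F01 (polar H r t))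
       + RtoC (sin t) * (RtoC (cos t) * F10 (polar H r t) + RtoC (sin t) * F11 (polar H r t))))%C.
Definition angular_flux (r t : R) : C :=
  (- RtoC (sin t) * F0 (polar H r t) + RtoC (cos t) * F1 (polar H r t))%C.

Lemma isD_radial_flux (r t : R) : b < H + r * sin t ->
  isD (fun r => radial_flux r t) r (radial_flux' r t).
Proof.
  intros Hr.
  assert (C1 : is_derive (fun s => s * cos t) r (cos t)).
  { eapply is_derive_eq; [apply derR_mult; [apply derR_id|apply derR_const]|cbv beta; Req; ring]. }
  assert (C2 : is_derive (fun s => H + s * sin t) r (sin t)).
  { eapply is_derive_eq; [apply derR_plus; [apply derR_const|apply derR_mult; [apply derR_id|apply derR_const]]|cbv beta; Req; ring]. }
  assert (D0 := G0 _ _ r _ _ C1 C2 Hr). assert (D1 := G1 _ _ r _ _ C1 C2 Hr).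
  eapply isD_eq.
  - apply isD_mult; [apply isD_RtoC, derR_id|].
    apply isD_plus; apply isD_mult; [apply isD_const|exact D0|apply isD_const|exact D1].
  - unfold radial_flux', polar. cbv beta. ring.
Qed.

(** In polar coordinates [d_r (r F_r) + d_t F_t = r div F], and the divergence is zero here. *)
Lemma isD_angular_flux (r t : R) : b < H + r * sin t ->
  isD (fun t => angular_flux r t) t (- radial_flux' r t)%C.
Proof.
  intros Hr.
  assert (C1 : is_derive (fun s => r * cos s) t (- (r * sin t))).
  { eapply is_derive_eq; [apply derR_mult; [apply derR_const|apply is_derive_cos]|cbv beta; Req; ring]. }
  assert (C2 : is_derive (fun s => H + r * sin s) t (r * cos t)).
  { eapply is_derive_eq; [apply derR_plus; [apply derR_const|apply derR_mult; [apply derR_const|apply is_derive_sin]]|cbv beta; Req; ring]. }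
  assert (D0 := G0 _ _ t _ _ C1 C2 Hr). assert (D1 := G1 _ _ t _ _ C1 C2 Hr).
  assert (DS : isD (fun t => - RtoC (sin t))%C t (- RtoC (cos t))%C).
  { apply (isD_ext_loc (fun t => RtoC (- sin t))).
    - apply filter_forall. intros s. Ceq.
    - eapply isD_eq; [apply isD_RtoC, derR_opp, is_derive_sin|]. Ceq. }
  eapply isD_eq.
  - apply isD_plus; apply isD_mult;
      [exact DS|exact D0|apply isD_RtoC, is_derive_cos|exact D1].
  - unfold radial_flux'. cbv beta.
    change (r * cos t, H + r * sin t) with (polar H r t).
    assert (E : F11 (polar H r t) = (- F00 (polar H r t))%C).
    { assert (E := Hdiv (polar H r t) Hr).
      replace (F11 (polar H r t)) with (F00 (polar H r t) + F11 (polar H r t) - F00 (polar H r t))%C by ring.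
      rewrite E. ring. }
    rewrite E.
    rewrite !RtoC_opp, !RtoC_mult.
    ring.
Qed.

Lemma contC_radial_flux' (r t : R) : b < H + r * sin t ->
  contC (fun p => radial_flux' (fst p) (snd p)) (r, t).
Proof.
  intros Hr. destruct (Hc (polar H r t) Hr) as [K0 [K1 [K00 [K01 [K10 K11]]]]].
  apply contC_polar in K0, K1, K00, K01, K10, K11.
  assert (Cc := contC_RtoC _ _ (cont2_cos_snd (r, t))).
  assert (Cs := contC_RtoC _ _ (cont2_sin_snd (r, t))).
  assert (Cr := contC_RtoC _ _ (cont2_fst (r, t))).
  unfold radial_flux'.
  exact (contC_plus _ _ _ (contC_plus _ _ _ (contC_mult _ _ _ Cc K0) (contC_mult _ _ _ Cs K1))
    (contC_mult _ _ _ Cr (contC_plus _ _ _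
      (contC_mult _ _ _ Cc (contC_plus _ _ _ (contC_mult _ _ _ Cc K00) (contC_mult _ _ _ Cs K01)))
      (contC_mult _ _ _ Cs (contC_plus _ _ _ (contC_mult _ _ _ Cc K10) (contC_mult _ _ _ Cs K11)))))).
Qed.

Lemma contC_radial_flux (r t : R) : b < H + r * sin t ->
  contC (fun p => radial_flux (fst p) (snd p)) (r, t).
Proof.
  intros Hr. destruct (Hc (polar H r t) Hr) as [K0 [K1 _]].
  apply contC_polar in K0, K1.
  assert (Cc := contC_RtoC _ _ (cont2_cos_snd (r, t))).
  assert (Cs := contC_RtoC _ _ (cont2_sin_snd (r, t))).
  assert (Cr := contC_RtoC _ _ (cont2_fst (r, t))).
  unfold radial_flux.
  exact (contC_mult _ _ _ Cr (contC_plus _ _ _ (contC_mult _ _ _ Cc K0) (contC_mult _ _ _ Cs K1))).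
Qed.

Lemma upper_half_region (r t : R) : b - H < r -> 0 <= t <= PI -> b < H + r * sin t.
Proof.
  intros Hr Ht. assert (0 <= sin t) by (apply sin_ge_0; lra).
  assert (B := SIN_bound t). destruct (Rle_dec 0 r) as [H1|H1].
  - assert (0 <= r * sin t) by (apply Rmult_le_pos; lra). lra.
  - assert (- r * sin t <= - r * 1) by (apply Rmult_le_compat_l; lra). lra.
Qed.

Lemma ex_RInt_radial_flux (r : R) : b - H < r -> ex_RIntC (radial_flux r) 0 PI.
Proof.
  intros Hr. assert (HP := PI_RGT_0). apply ex_RIntC_cont.
  intros t. rewrite Rmin_left, Rmax_right by lra. intros Ht.
  destruct (contC_radial_flux r t (upper_half_region r t Hr Ht)) as [K1 K2]. split.
  - apply (continuous_slice (fun p => Re (radial_flux (fst p) (snd p))) r t K1).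
  - apply (continuous_slice (fun p => Im (radial_flux (fst p) (snd p))) r t K2).
Qed.

Lemma contRC_line (t : R) : contRC (fun t => F1 (t, H)) t.
Proof.
  destruct (Hc (t, H) HbH) as [_ [[K1 K2] _]].
  exact (conj (continuous_slice1 (fun p => Re (F1 p)) t H K1) (continuous_slice1 (fun p => Im (F1 p)) t H K2)).
Qed.

Lemma locally_region (r t : R) : b < H + r * sin t ->
  locally (r, t) (fun p : R * R => b < H + fst p * sin (snd p)).
Proof.
  intros Hr. apply (cont2_polar2 H (r, t)). apply (locally_gt b _ Hr).
Qed.

(** Under the integral the [r]-derivative becomes minus the angular derivative of [angular_flux],
    which integrates to its values at the two ends of the diameter, where the tangent of the circle
    is vertical. *)
Lemma radial_flux_derive (r : R) : b - H < r ->
  is_derive (fun r => RInt (fun t => Re (radial_flux r t)) 0 PI) r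
    (Re (F1 (r, H)) + Re (F1 (- r, H))).
Proof.
  intros Hr. assert (HP := PI_RGT_0).
  assert (DR : forall u v, b < H + u * sin v ->
    is_derive (fun z => Re (radial_flux z v)) u (Re (radial_flux' u v)))
    by (intros u v Huv; apply (isD_radial_flux u v Huv)).
  eapply is_derive_eq.
  - apply (is_derive_RInt_param (fun r t => Re (radial_flux r t)) 0 PI r);
      rewrite ?Rmin_left, ?Rmax_right by lra.
    + apply filter_imp with (2 := locally_gt _ _ Hr). intros u Hu t Ht.
      eexists. apply DR, upper_half_region; assumption.
    + intros t Ht. assert (Hrt := upper_half_region r t Hr Ht).
      apply continuity_2d_pt_filterlim.
      enough (Kc : continuous (fun p : R * R => Derive (fun z => Re (radial_flux z (snd p))) (fst p)) (r, t))
        by exact Kc.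
      apply (continuous_ext_loc _ (fun p : R * R => Re (radial_flux' (fst p) (snd p)))).
      * apply filter_imp with (2 := locally_region r t Hrt). intros [u v] Huv.
        change (Re (radial_flux' u v) = Derive (fun z => Re (radial_flux z v)) u).
        symmetry. apply is_derive_unique. exact (DR u v Huv).
      * destruct (contC_radial_flux' r t Hrt) as [K _]. exact K.
    + apply filter_imp with (2 := locally_gt _ _ Hr). intros u Hu.
      exact (proj1 (ex_RInt_radial_flux u Hu)).
  - rewrite (RInt_ext _ (fun t => Re (radial_flux' r t))).
    2: { intros t. rewrite Rmin_left, Rmax_right by lra. intros Ht.
         apply is_derive_unique, DR, upper_half_region; lra. }
    apply is_RInt_unique.
    assert (E : Re (F1 (r, H)) + Re (F1 (- r, H))
      = minus (- Re (angular_flux r PI)) (- Re (angular_flux r 0))).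
    { unfold angular_flux, polar, minus, plus, opp. simpl.
      rewrite cos_PI, sin_PI, cos_0, sin_0.
      replace (r * -1) with (- r) by ring. replace (r * 1) with r by ring.
      replace (H + r * 0) with H by ring. unfold Re. simpl. ring. }
    rewrite E. apply (is_RInt_derive (fun t => - Re (angular_flux r t))).
    + intros t. rewrite Rmin_left, Rmax_right by lra. intros Ht.
      destruct (isD_angular_flux r t (upper_half_region r t Hr Ht)) as [D _].
      eapply is_derive_eq; [apply (derR_opp (fun t => Re (angular_flux r t))), D|].
      unfold opp. simpl. unfold Re. simpl. ring.
    + intros t. rewrite Rmin_left, Rmax_right by lra. intros Ht.
      destruct (contC_radial_flux' r t (upper_half_region r t Hr Ht)) as [K _].
      apply (continuous_slice (fun p => Re (radial_flux' (fst p) (snd p))) r t K).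
Qed.

(** Both sides have the same derivative in [r] by [radial_flux_derive] and both are 0 at [r = 0]. *)
Lemma flux_half_disc_Re (r : R) : 0 < r ->
  RInt (fun t => Re (F1 (t, H))) (- r) r = RInt (fun t => Re (radial_flux r t)) 0 PI.
Proof.
  intros Hr.
  set (f := fun t => Re (F1 (t, H))).
  assert (Hf : forall t, continuous f t) by (intros t; exact (proj1 (contRC_line t))).
  set (Phi := fun x => RInt f 0 x).
  assert (DPhi : forall x, is_derive Phi x (f x)).
  { intros x. apply (is_derive_RInt (V := R_NormedModule) f Phi 0 x); [|apply Hf].
    apply filter_forall. intros u.
    apply is_RInt_RInt, ex_RInt_continuous_all, Hf. }
  set (A := fun r => RInt (fun t => Re (radial_flux r t)) 0 PI).
  assert (E : A 0 - (Phi 0 - Phi (- 0)) = A r - (Phi r - Phi (- r))).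
  { apply (eq_is_derive (fun r => A r - (Phi r - Phi (- r))) 0 r); [|exact Hr].
    intros t Ht. eapply is_derive_eq.
    - apply derR_minus; [apply radial_flux_derive; lra|].
      apply derR_minus; [apply DPhi|]. apply (derR_comp Phi (fun r => - r)); [apply DPhi|].
      apply derR_opp, derR_id.
    - unfold f, zero, opp. simpl. ring. }
  assert (A0 : A 0 = 0).
  { unfold A. rewrite (RInt_ext _ (fun _ => 0)).
    - rewrite RInt_const. unfold scal; simpl; unfold mult; simpl. ring.
    - intros t _. unfold radial_flux, Re. simpl. ring. }
  rewrite Ropp_0, A0 in E.
  rewrite <- (RInt_Chasles (V := R_CompleteNormedModule) f (- r) 0 r)
    by (apply ex_RInt_continuous_all, Hf).
  rewrite <- (opp_RInt_swap (V := R_CompleteNormedModule) f)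
    by (apply ex_RInt_continuous_all, Hf).
  change (- Phi (- r) + Phi r = A r).
  change (0 - (Phi 0 - Phi 0) = A r - (Phi r - Phi (- r)))%R in E. lra.
Qed.
End HalfDisc.

Lemma flux_half_disc (b H : R) (F0 F1 F00 F01 F10 F11 : point -> C) (r : R) :
  b < H -> has_grad b F0 F00 F01 -> has_grad b F1 F10 F11 ->
  (forall p, b < snd p -> (F00 p + F11 p = RtoC 0)%C) ->
  (forall p, b < snd p ->
    contC F0 p /\ contC F1 p /\ contC F00 p /\ contC F01 p /\ contC F10 p /\ contC F11 p) ->
  0 < r ->
  ex_RIntC (fun t => F1 (t, H)) (- r) r /\ ex_RIntC (radial_flux H F0 F1 r) 0 PI /\
  integral_RC (fun t => F1 (t, H)) (- r) r = integral_RC (radial_flux H F0 F1 r) 0 PI.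
Proof.
  intros HbH G0 G1 Hdiv Hc Hr.
  assert (X1 : ex_RIntC (fun t => F1 (t, H)) (- r) r)
    by (apply ex_RIntC_cont; intros t _; apply (contRC_line b H F0 F1 F00 F01 F10 F11 HbH Hc)).
  assert (X2 : ex_RIntC (radial_flux H F0 F1 r) 0 PI)
    by (apply (ex_RInt_radial_flux b H F0 F1 F00 F01 F10 F11 HbH Hc); lra).
  split; [exact X1|]. split; [exact X2|].
  rewrite !integral_RC_eq by assumption. f_equal.
  - apply (flux_half_disc_Re b H F0 F1 F00 F01 F10 F11); assumption.
  (* The imaginary part is the real part for the field multiplied by [-i], which satisfies the same
     hypotheses. *)
  - rewrite (RInt_ext (fun t => Im (F1 (t, H))) (fun t => Re (- Ci * F1 (t, H))%C)).
    2: { intros t _. unfold Re, Im. simpl. ring. }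
    rewrite (flux_half_disc_Re b H (fun p => - Ci * F0 p)%C (fun p => - Ci * F1 p)%C
      (fun p => - Ci * F00 p)%C (fun p => - Ci * F01 p)%C (fun p => - Ci * F10 p)%C (fun p => - Ci * F11 p)%C
      HbH (has_grad_scal _ _ _ _ _ G0) (has_grad_scal _ _ _ _ _ G1)).
    + apply RInt_ext. intros t _. unfold radial_flux, Re, Im. simpl. ring.
    + intros p Hp. transitivity (- Ci * (F00 p + F11 p))%C; [ring|]. rewrite Hdiv by exact Hp. ring.
    + intros p Hp. destruct (Hc p Hp) as [K0 [K1 [K00 [K01 [K10 K11]]]]].
      assert (K := fun g => contC_mult (fun _ => (- Ci)%C) g p (contC_const _ p)).
      exact (conj (K _ K0) (conj (K _ K1) (conj (K _ K00) (conj (K _ K01) (conj (K _ K10) (K _ K11)))))).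
    + exact Hr.
Qed.

(* The stress operator in terms of the values [g a j] of [∂_a u_j]. *)
Definition tr (mu tmu tlam : R) (n : point) (g : nat -> nat -> C) (j : nat) : C :=
  (RtoC (mu + tmu) * (RtoC (fst n) * g 0%nat j + RtoC (snd n) * g 1%nat j)
   + RtoC (tlam * coord j n) * (g 0%nat 0%nat + g 1%nat 1%nat)
   - RtoC (tmu * coord j (perp n)) * (- g 1%nat 0%nat + g 0%nat 1%nat))%C.

Definition betti (mu tmu tlam : R) (n : point) (u : nat -> C) (g : nat -> nat -> C)
  (v : nat -> C) (h : nat -> nat -> C) : C :=
  ((tr mu tmu tlam n g 0 * v 0%nat + tr mu tmu tlam n g 1 * v 1%nat)
   - (u 0%nat * tr mu tmu tlam n h 0 + u 1%nat * tr mu tmu tlam n h 1))%C.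

Definition flux (mu tmu tlam : R) (n : point) (u : vect) (u1 : nat -> vect)
  (v : vect) (v1 : nat -> vect) (p : point) : C :=
  betti mu tmu tlam n (fun j => u j p) (fun a j => u1 a j p) (fun j => v j p) (fun a j => v1 a j p).

Section Flux.
Variables (mu lam tmu tlam om b : R) (u v : vect) (u1 v1 : nat -> vect) (u2 v2 : nat -> nat -> vect).
Hypothesis (Hsum : tmu + tlam = mu + lam).
Hypothesis (Hu : navier_sol mu lam om b u u1 u2) (Hv : navier_sol mu lam om b v v1 v2).

Definition dflux (n : point) (a : nat) (p : point) : C :=
  ((tr mu tmu tlam n (fun c j => u2 a c j p) 0 * v 0%nat p
    + tr mu tmu tlam n (fun c j => u1 c j p) 0 * v1 a 0%nat p
    + (tr mu tmu tlam n (fun c j => u2 a c j p) 1 * v 1%nat p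
    + tr mu tmu tlam n (fun c j => u1 c j p) 1 * v1 a 1%nat p))
   - (u1 a 0%nat p * tr mu tmu tlam n (fun c j => v1 c j p) 0
      + u 0%nat p * tr mu tmu tlam n (fun c j => v2 a c j p) 0
     + (u1 a 1%nat p * tr mu tmu tlam n (fun c j => v1 c j p) 1
      + u 1%nat p * tr mu tmu tlam n (fun c j => v2 a c j p) 1)))%C.

Lemma has_grad_tr (w1 : nat -> vect) (w2 : nat -> nat -> vect) (n : point) (j : nat) :
  (forall a j, (a < 2)%nat -> (j < 2)%nat -> has_grad b (w1 a j) (w2 0%nat a j) (w2 1%nat a j)) ->
  (j < 2)%nat ->
  has_grad b (fun p => tr mu tmu tlam n (fun c j => w1 c j p) j)
    (fun p => tr mu tmu tlam n (fun c j => w2 0%nat c j p) j)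
    (fun p => tr mu tmu tlam n (fun c j => w2 1%nat c j p) j).
Proof.
  intros Hw Hj. unfold tr.
  apply (has_grad_minus b (fun p => RtoC (mu + tmu) * (RtoC (fst n) * w1 0%nat j p + RtoC (snd n) * w1 1%nat j p)
    + RtoC (tlam * coord j n) * (w1 0%nat 0%nat p + w1 1%nat 1%nat p))%C).
  - apply (has_grad_plus b (fun p => RtoC (mu + tmu) * (RtoC (fst n) * w1 0%nat j p + RtoC (snd n) * w1 1%nat j p))%C).
    + apply (has_grad_scal b _ (fun p => RtoC (fst n) * w1 0%nat j p + RtoC (snd n) * w1 1%nat j p)%C).
      apply (has_grad_plus b (fun p => RtoC (fst n) * w1 0%nat j p)%C).
      * apply (has_grad_scal b _ (w1 0%nat j)). apply Hw; lia.
      * apply (has_grad_scal b _ (w1 1%nat j)). apply Hw; lia.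
    + apply (has_grad_scal b _ (fun p => w1 0%nat 0%nat p + w1 1%nat 1%nat p)%C).
      apply (has_grad_plus b (w1 0%nat 0%nat)); apply Hw; lia.
  - apply (has_grad_scal b _ (fun p => - w1 1%nat 0%nat p + w1 0%nat 1%nat p)%C).
    apply (has_grad_plus b (fun p => - w1 1%nat 0%nat p)%C); [|apply Hw; lia].
    apply (has_grad_opp b (w1 1%nat 0%nat)). apply Hw; lia.
Qed.

Lemma has_grad_flux (n : point) :
  has_grad b (flux mu tmu tlam n u u1 v v1) (dflux n 0) (dflux n 1).
Proof.
  destruct Hu as [U1 [U2 _]]. destruct Hv as [V1 [V2 _]].
  assert (L0 : (0 < 2)%nat) by lia. assert (L1 : (1 < 2)%nat) by lia.
  exact (has_grad_minus b _ _ _ _ _ _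
    (has_grad_plus b _ _ _ _ _ _
      (has_grad_mult b _ _ _ _ _ _ (has_grad_tr u1 u2 n 0 U2 L0) (V1 0%nat L0))
      (has_grad_mult b _ _ _ _ _ _ (has_grad_tr u1 u2 n 1 U2 L1) (V1 1%nat L1)))
    (has_grad_plus b _ _ _ _ _ _
      (has_grad_mult b _ _ _ _ _ _ (U1 0%nat L0) (has_grad_tr v1 v2 n 0 V2 L0))
      (has_grad_mult b _ _ _ _ _ _ (U1 1%nat L1) (has_grad_tr v1 v2 n 1 V2 L1)))).
Qed.

Lemma contC_tr (w1 : nat -> vect) (n : point) (j : nat) (p : point) :
  (forall a j, contC (w1 a j) p) -> contC (fun p => tr mu tmu tlam n (fun c j => w1 c j p) j) p.
Proof.
  intros Hw. unfold tr.
  exact (contC_minus _ _ p (contC_plus _ _ p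
    (contC_mult _ _ p (contC_const _ p) (contC_plus _ _ p
       (contC_mult _ _ p (contC_const _ p) (Hw 0%nat j)) (contC_mult _ _ p (contC_const _ p) (Hw 1%nat j))))
    (contC_mult _ _ p (contC_const _ p) (contC_plus _ _ p (Hw 0%nat 0%nat) (Hw 1%nat 1%nat))))
    (contC_mult _ _ p (contC_const _ p) (contC_plus _ _ p (contC_opp _ p (Hw 1%nat 0%nat)) (Hw 0%nat 1%nat)))).
Qed.

Lemma contC_flux (n : point) (p : point) : b < snd p ->
  contC (flux mu tmu tlam n u u1 v v1) p.
Proof.
  intros Hp. destruct Hu as [_ [_ [_ [_ U]]]]. destruct Hv as [_ [_ [_ [_ V]]]].
  destruct (U p Hp) as [U0 [U1 U2]]. destruct (V p Hp) as [V0 [V1 V2]].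
  exact (contC_minus _ _ p
    (contC_plus _ _ p (contC_mult _ _ p (contC_tr u1 n 0 p U1) (V0 0%nat))
       (contC_mult _ _ p (contC_tr u1 n 1 p U1) (V0 1%nat)))
    (contC_plus _ _ p (contC_mult _ _ p (U0 0%nat) (contC_tr v1 n 0 p V1))
       (contC_mult _ _ p (U0 1%nat) (contC_tr v1 n 1 p V1)))).
Qed.

Lemma contC_dflux (n : point) (a : nat) (p : point) : b < snd p -> contC (dflux n a) p.
Proof.
  intros Hp. destruct Hu as [_ [_ [_ [_ U]]]]. destruct Hv as [_ [_ [_ [_ V]]]].
  destruct (U p Hp) as [U0 [U1 U2]]. destruct (V p Hp) as [V0 [V1 V2]].
  exact (contC_minus _ _ p
    (contC_plus _ _ p
       (contC_plus _ _ p (contC_mult _ _ p (contC_tr (u2 a) n 0 p (U2 a)) (V0 0%nat))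
         (contC_mult _ _ p (contC_tr u1 n 0 p U1) (V1 a 0%nat)))
       (contC_plus _ _ p (contC_mult _ _ p (contC_tr (u2 a) n 1 p (U2 a)) (V0 1%nat))
         (contC_mult _ _ p (contC_tr u1 n 1 p U1) (V1 a 1%nat))))
    (contC_plus _ _ p
       (contC_plus _ _ p (contC_mult _ _ p (U1 a 0%nat) (contC_tr v1 n 0 p V1))
         (contC_mult _ _ p (U0 0%nat) (contC_tr (v2 a) n 0 p (V2 a))))
       (contC_plus _ _ p (contC_mult _ _ p (U1 a 1%nat) (contC_tr v1 n 1 p V1))
         (contC_mult _ _ p (U0 1%nat) (contC_tr (v2 a) n 1 p (V2 a)))))).
Qed.

(** Stress tensors with the same [tmu + tlam] differ by a divergence-free term, by the symmetry of
    second derivatives; so each of them has the elastic part of the Navier operator as its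
    divergence. *)
Lemma div_tr (w : vect) (w1 : nat -> vect) (w2 : nat -> nat -> vect) (j : nat) (p : point) :
  navier_sol mu lam om b w w1 w2 -> (j < 2)%nat -> b < snd p ->
  (tr mu tmu tlam (1, 0) (fun c j => w2 0%nat c j p) j + tr mu tmu tlam (0, 1) (fun c j => w2 1%nat c j p) j
   = - RtoC (om ^ 2) * w j p)%C.
Proof.
  intros [_ [_ [S [N _]]]] Hj Hp. specialize (N j p Hj Hp).
  assert (S0 := S 0%nat p ltac:(lia) Hp). assert (S1 := S 1%nat p ltac:(lia) Hp).
  transitivity ((RtoC mu * (w2 0%nat 0%nat j p + w2 1%nat 1%nat j p)
    + RtoC (lam + mu) * (w2 j 0%nat 0%nat p + w2 j 1%nat 1%nat p)
    + RtoC (om ^ 2) * w j p) - RtoC (om ^ 2) * w j p)%C; [|rewrite N; ring].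
  replace (lam + mu) with (tmu + tlam) by lra.
  unfold tr, perp, coord, fst, snd.
  two_cases Hj; rewrite ?S0, ?S1; rewrite !RtoC_mult, !RtoC_plus, ?RtoC_opp; ring.
Qed.

(* Betti: the zeroth-order terms cancel by the equation, and the products of
   first derivatives cancel because the form [tr] is symmetric. *)
Lemma div_flux (p : point) : b < snd p -> (dflux (1, 0) 0 p + dflux (0, 1) 1 p = RtoC 0)%C.
Proof.
  intros Hp.
  assert (U := fun j H => div_tr u u1 u2 j p Hu H Hp). assert (V := fun j H => div_tr v v1 v2 j p Hv H Hp).
  assert (U0 := U 0%nat ltac:(lia)). assert (U1 := U 1%nat ltac:(lia)).
  assert (V0 := V 0%nat ltac:(lia)). assert (V1 := V 1%nat ltac:(lia)).
  clear U V. unfold dflux.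
  set (a0 := tr mu tmu tlam (1, 0) (fun c j => u2 0%nat c j p) 0) in *.
  set (a1 := tr mu tmu tlam (1, 0) (fun c j => u2 0%nat c j p) 1) in *.
  set (b0 := tr mu tmu tlam (0, 1) (fun c j => u2 1%nat c j p) 0) in *.
  set (b1 := tr mu tmu tlam (0, 1) (fun c j => u2 1%nat c j p) 1) in *.
  set (c0 := tr mu tmu tlam (1, 0) (fun c j => v2 0%nat c j p) 0) in *.
  set (c1 := tr mu tmu tlam (1, 0) (fun c j => v2 0%nat c j p) 1) in *.
  set (d0 := tr mu tmu tlam (0, 1) (fun c j => v2 1%nat c j p) 0) in *.
  set (d1 := tr mu tmu tlam (0, 1) (fun c j => v2 1%nat c j p) 1) in *.
  replace a0 with ((a0 + b0) - b0)%C by ring. replace a1 with ((a1 + b1) - b1)%C by ring.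
  replace c0 with ((c0 + d0) - d0)%C by ring. replace c1 with ((c1 + d1) - d1)%C by ring.
  rewrite U0, U1, V0, V1. clear. clearbody b0 b1 d0 d1.
  unfold tr, perp, coord, fst, snd. rewrite !RtoC_mult, !RtoC_plus, ?RtoC_opp. ring.
Qed.

(** The stress operator is linear in the normal, and [dir t] is the outer normal of the circle. *)
Lemma flux_normal (H r t : R) :
  radial_flux H (flux mu tmu tlam (1, 0) u u1 v v1) (flux mu tmu tlam (0, 1) u u1 v v1) r t
  = (RtoC r * flux mu tmu tlam (dir t) u u1 v v1 (polar H r t))%C.
Proof.
  unfold radial_flux, flux, betti, tr, dir, perp, coord, fst, snd.
  rewrite !RtoC_mult, !RtoC_plus, ?RtoC_opp. ring.
Qed.

Lemma flux_line_arc (H r : R) : b < H -> 0 < r ->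
  let F := fun t => flux mu tmu tlam (0, 1) u u1 v v1 (t, H) in
  let G := fun t => (RtoC r * flux mu tmu tlam (dir t) u u1 v v1 (polar H r t))%C in
  ex_RIntC F (- r) r /\ ex_RIntC G 0 PI /\ integral_RC F (- r) r = integral_RC G 0 PI.
Proof.
  intros HbH Hr F G.
  destruct (flux_half_disc b H (flux mu tmu tlam (1, 0) u u1 v v1) (flux mu tmu tlam (0, 1) u u1 v v1)
    (dflux (1, 0) 0) (dflux (1, 0) 1) (dflux (0, 1) 0) (dflux (0, 1) 1) r HbH) as [X1 [X2 X3]].
  - apply has_grad_flux.
  - apply has_grad_flux.
  - exact div_flux.
  - intros p Hp.
    exact (conj (contC_flux _ p Hp) (conj (contC_flux _ p Hp) (conj (contC_dflux _ _ p Hp)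
      (conj (contC_dflux _ _ p Hp) (conj (contC_dflux _ _ p Hp) (contC_dflux _ _ p Hp)))))).
  - exact Hr.
  - split; [exact X1|]. split; [exact (ex_RIntC_ext _ _ _ _ (flux_normal H r) X2)|].
    exact (eq_trans X3 (integral_RC_ext _ _ _ _ (flux_normal H r))).
Qed.
End Flux.

(** * Far fields *)

Lemma ulim_rate (f : R -> R -> C) (g : R -> C) (B K M0 : R) :
  (forall t, Cmod (g t) <= B) ->
  (forall r t, M0 < r -> Cmod (f r t - g t)%C <= K / r) -> ulim f g.
Proof.
  intros HB H.
  refine (ulim_ext _ _ _ _ _ _ (ulim_plus _ _ _ _ (ulim_0 (fun r t => f r t - g t)%C K M0 H) (ulim_const g B HB)));
    intros; cbv beta; ring.
Qed.

Lemma Cmod_expi (a : R) : Cmod (expi a) = 1.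
Proof.
  unfold Cmod, expi. simpl. assert (S2 := sin_cos_sq a).
  replace (cos a * (cos a * 1) + sin a * (sin a * 1)) with 1 by lra. apply sqrt_1.
Qed.

Lemma Rabs_sin_le (x : R) : Rabs (sin x) <= Rabs x.
Proof.
  destruct (Rle_dec 0 x) as [H|H].
  - rewrite (Rabs_right x) by lra. apply sin_abs_le; exact H.
  - replace (Rabs (sin x)) with (Rabs (sin (- x))) by (rewrite sin_neg; apply Rabs_Ropp).
    rewrite (Rabs_left1 x) by lra. apply sin_abs_le; lra.
Qed.

(** [|e^(ia) - e^(ib)| = 2 |sin((a - b)/2)|]. *)
Lemma expi_lipschitz (a b : R) : Cmod (expi a - expi b)%C <= Rabs (a - b).
Proof.
  rewrite <- (sqrt_Rsqr_abs (a - b)). unfold Cmod. apply sqrt_le_1_alt. simpl.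
  replace ((cos a + - cos b) * ((cos a + - cos b) * 1) + (sin a + - sin b) * ((sin a + - sin b) * 1))
    with ((sin a * sin a + cos a * cos a) + (sin b * sin b + cos b * cos b)
       - 2 * (cos a * cos b + sin a * sin b)) by ring.
  assert (Sa := sin_cos_sq a). assert (Sb := sin_cos_sq b). unfold Rsqr. rewrite Sa, Sb.
  rewrite <- cos_minus. replace (a - b) with (2 * ((a - b) / 2)) at 1 by field.
  rewrite cos_2a_sin. assert (X := Rabs_sin_le ((a - b) / 2)).
  apply Rsqr_le_abs_1 in X. unfold Rsqr in X.
  replace ((a - b) / 2 * ((a - b) / 2)) with ((a - b) * (a - b) / 4) in X by field. lra.
Qed.

Section Distance.
Variables (H : R) (x : point).

(** Seen from the centre of the arc, [proj] is the component of the source along the ray, so that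
    [r - proj] begins the expansion of the distance [rho]. The bound [off] controls the errors
    independently of the angle. *)
Definition proj (t : R) : R := dot (fst x, snd x - H) (dir t).
Definition rho (r t : R) : R := sqrt (sqd x (polar H r t)).
Definition off : R := Rabs (fst x) + Rabs (snd x - H).

Lemma off_ge_0 : 0 <= off.
Proof. unfold off. assert (A := Rabs_pos (fst x)). assert (B := Rabs_pos (snd x - H)). lra. Qed.

Lemma proj_le (t : R) : Rabs (proj t) <= off.
Proof.
  unfold proj, off, dot, dir. simpl. eapply Rle_trans; [apply Rabs_triang|].
  rewrite !Rabs_mult. assert (C := COS_bound t). assert (S := SIN_bound t).
  assert (Hc : Rabs (cos t) <= 1) by (apply Rabs_le; lra).
  assert (Hs : Rabs (sin t) <= 1) by (apply Rabs_le; lra).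
  assert (A := Rabs_pos (fst x)). assert (B := Rabs_pos (snd x - H)).
  apply Rplus_le_compat.
  - rewrite <- (Rmult_1_r (Rabs (fst x))) at 2. apply Rmult_le_compat_l; lra.
  - rewrite <- (Rmult_1_r (Rabs (snd x - H))) at 2. apply Rmult_le_compat_l; lra.
Qed.

Lemma sqd_polar (r t : R) :
  sqd x (polar H r t) = r * r - 2 * r * proj t + (fst x * fst x + (snd x - H) * (snd x - H)).
Proof.
  unfold sqd, polar, proj, dot, sub, dir. simpl. assert (S2 := sin_cos_sq t).
  replace (r * r) with (r * r * (sin t * sin t + cos t * cos t)) by (rewrite S2; ring). ring.
Qed.

Lemma proj_sq_le (t : R) : proj t * proj t <= fst x * fst x + (snd x - H) * (snd x - H).
Proof.
  unfold proj, dot, dir. simpl. assert (S2 := sin_cos_sq t).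
  set (a := fst x). set (c := snd x - H).
  assert (Q := Rle_0_sqr (a * sin t - c * cos t)). unfold Rsqr in Q.
  replace (a * a + c * c) with ((a * a + c * c) * (sin t * sin t + cos t * cos t)) by (rewrite S2; ring).
  lra.
Qed.

Lemma off_sq_ge : fst x * fst x + (snd x - H) * (snd x - H) <= off * off.
Proof.
  unfold off. assert (A := Rabs_pos (fst x)). assert (B := Rabs_pos (snd x - H)).
  assert (E1 := Rsqr_abs (fst x)). assert (E2 := Rsqr_abs (snd x - H)). unfold Rsqr in E1, E2.
  rewrite E1, E2. assert (0 <= Rabs (fst x) * Rabs (snd x - H)) by (apply Rmult_le_pos; lra). lra.
Qed.

Lemma rho_bounds (r t : R) : 2 * off + 1 < r ->
  r / 2 <= rho r t /\ Rabs (rho r t - r) <= off /\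
  Rabs (rho r t - r + proj t) <= 2 * (off * off) / r.
Proof.
  intros Hr. assert (P1 := proj_le t). apply Rabs_le_between in P1.
  assert (P2 := proj_sq_le t). assert (P3 := off_sq_ge). assert (E := sqd_polar r t).
  set (n := fst x * fst x + (snd x - H) * (snd x - H)) in *. set (e := proj t) in *. set (m := off) in *.
  assert (L : rho r t <= r + m).
  { unfold rho. rewrite <- (sqrt_Rsqr (r + m)) by lra. apply sqrt_le_1_alt. rewrite E. unfold Rsqr.
    assert (- (r * m) <= r * e) by (assert (r * - m <= r * e) by (apply Rmult_le_compat_l; lra); lra). lra. }
  assert (G : r - m <= rho r t).
  { unfold rho. rewrite <- (sqrt_Rsqr (r - m)) by lra. apply sqrt_le_1_alt. rewrite E.
    apply Rle_trans with ((r - e) * (r - e)).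
    - unfold Rsqr. apply Rmult_le_compat; lra.
    - lra. }
  assert (Q : rho r t * rho r t = r * r - 2 * r * e + n).
  { unfold rho. rewrite sqrt_sqrt; [exact E|]. rewrite E.
    assert (0 <= (r - e) * (r - e)) by apply Rle_0_sqr. lra. }
  set (p := rho r t) in *. clearbody p.
  assert (Hd : Rabs (p - r) <= m) by (apply Rabs_le; lra).
  split; [lra|]. split; [exact Hd|].
  (* Since [p^2 = r^2 - 2 r e + n], multiplying [p - r + e] by [p + r] gives [n + e (p - r)], which
     is bounded; hence a remainder [O(1/r)]. *)
  replace (p - r + e) with ((n + e * (p - r)) / (p + r)).
  2: { assert (En : n = p * p - r * r + 2 * r * e) by lra. rewrite En. field. lra. }
  unfold Rdiv at 1. rewrite Rabs_mult.
  assert (Hi : 0 < / (p + r)) by (apply Rinv_0_lt_compat; lra). rewrite (Rabs_right (/ (p + r))) by lra.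
  unfold Rdiv. apply Rmult_le_compat; [apply Rabs_pos|lra| |apply Rinv_le_contravar; lra].
  eapply Rle_trans; [apply Rabs_triang|]. rewrite Rabs_mult.
  assert (0 <= e * e) by apply Rle_0_sqr.
  rewrite (Rabs_right n) by lra.
  assert (Rabs e <= m) by (apply Rabs_le; lra).
  assert (Rabs e * Rabs (p - r) <= m * m) by (apply Rmult_le_compat; try apply Rabs_pos; assumption). lra.
Qed.

Lemma rho_infty (M : R) : exists M', forall r t, M' < r -> M < rho r t.
Proof.
  exists (Rmax (2 * off + 1) (2 * M)). intros r t Hr.
  assert (H1 : 2 * off + 1 < r) by (eapply Rle_lt_trans; [apply Rmax_l|exact Hr]).
  assert (H2 : 2 * M < r) by (eapply Rle_lt_trans; [apply Rmax_r|exact Hr]).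
  destruct (rho_bounds r t H1) as [B _]. lra.
Qed.

Lemma ulim_phase (k : R) :
  ulim (fun r t => expi (k * (rho r t - r))) (fun t => expi (- (k * proj t))).
Proof.
  apply (ulim_rate _ _ 1 (Rabs k * (2 * (off * off))) (2 * off + 1)).
  - intros t. rewrite Cmod_expi. lra.
  - intros r t Hr. eapply Rle_trans; [apply expi_lipschitz|].
    replace (k * (rho r t - r) - - (k * proj t)) with (k * (rho r t - r + proj t)) by ring.
    rewrite Rabs_mult. unfold Rdiv. rewrite Rmult_assoc.
    apply Rmult_le_compat_l; [apply Rabs_pos|]. apply (rho_bounds r t Hr).
Qed.

Lemma ulim_ratio : ulim (fun r t => RtoC (r / rho r t)) (fun _ => RtoC 1).
Proof.
  apply (ulim_rate _ _ 1 (2 * off) (2 * off + 1)).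
  - intros t. rewrite Cmod_1. lra.
  - intros r t Hr. destruct (rho_bounds r t Hr) as [B1 [B2 _]]. assert (O0 := off_ge_0).
    rewrite <- RtoC_minus, Cmod_R.
    replace (r / rho r t - 1) with (- (rho r t - r) / rho r t) by (field; lra).
    unfold Rdiv. rewrite Rabs_mult, Rabs_Ropp.
    assert (Hi : 0 < / rho r t) by (apply Rinv_0_lt_compat; lra). rewrite (Rabs_right (/ rho r t)) by lra.
    replace (2 * off * / r) with (off * / (r / 2)) by (field; lra).
    apply Rmult_le_compat; [apply Rabs_pos|lra|exact B2|apply Rinv_le_contravar; lra].
Qed.

Lemma ulim_sqrt_ratio : ulim (fun r t => RtoC (sqrt r / sqrt (rho r t))) (fun _ => RtoC 1).
Proof.
  apply (ulim_rate _ _ 1 (2 * off) (2 * off + 1)).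
  - intros t. rewrite Cmod_1. lra.
  - intros r t Hr. destruct (rho_bounds r t Hr) as [B1 [B2 _]]. assert (O0 := off_ge_0).
    rewrite <- RtoC_minus, Cmod_R.
    assert (Hp : 0 < rho r t) by lra. set (p := rho r t) in *. clearbody p.
    assert (Sr : 0 < sqrt r) by (apply sqrt_lt_R0; lra). assert (Sp : 0 < sqrt p) by (apply sqrt_lt_R0; lra).
    assert (Qr := sqrt_sqrt r ltac:(lra)). assert (Qp := sqrt_sqrt p ltac:(lra)).
    replace (sqrt r / sqrt p - 1) with (- (p - r) * / (p + sqrt r * sqrt p)).
    2: { replace (p - r) with (sqrt p * sqrt p - sqrt r * sqrt r) by lra.
         replace (p + sqrt r * sqrt p) with (sqrt p * (sqrt p + sqrt r)) by lra. field. lra. }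
    assert (0 < sqrt r * sqrt p) by (apply Rmult_lt_0_compat; lra).
    rewrite Rabs_mult, Rabs_Ropp.
    assert (Hi : 0 < / (p + sqrt r * sqrt p)) by (apply Rinv_0_lt_compat; lra).
    rewrite (Rabs_right (/ (p + sqrt r * sqrt p))) by lra.
    replace (2 * off / r) with (off * / (r / 2)) by (field; lra).
    apply Rmult_le_compat; [apply Rabs_pos|lra|exact B2|apply Rinv_le_contravar; lra].
Qed.

Lemma ulim_dx (a : nat) : ulim (fun r t => dx x a (polar H r t) * RtoC (/ r))%C (fun t => RtoC (coord a (dir t))).
Proof.
  apply (ulim_rate _ _ 1 off 0).
  - intros t. rewrite Cmod_R. apply Rabs_le. destruct a; simpl; [apply COS_bound|apply SIN_bound].
  - intros r t Hr. unfold dx. rewrite <- RtoC_mult, <- RtoC_minus, Cmod_R.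
    assert (A := Rabs_pos (fst x)). assert (B := Rabs_pos (snd x - H)).
    assert (Hi : 0 < / r) by (apply Rinv_0_lt_compat; lra).
    destruct a; simpl.
    + replace ((r * cos t - fst x) * / r - cos t) with (- fst x * / r) by (field; lra).
      rewrite Rabs_mult, Rabs_Ropp, (Rabs_right (/ r)) by lra.
      apply Rmult_le_compat_r; [lra|]. unfold off. lra.
    + replace ((H + r * sin t - snd x) * / r - sin t) with (- (snd x - H) * / r) by (field; lra).
      rewrite Rabs_mult, Rabs_Ropp, (Rabs_right (/ r)) by lra.
      apply Rmult_le_compat_r; [lra|]. unfold off. lra.
Qed.
End Distance.

Lemma ulim_inv : ulim (fun r _ => RtoC (/ r)) (fun _ => RtoC 0).
Proof.
  apply (ulim_0 _ 1 0). intros r t Hr. rewrite Cmod_R.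
  assert (Hi : 0 < / r) by (apply Rinv_0_lt_compat; lra). rewrite Rabs_right by lra. lra.
Qed.

Lemma ulim_pow (f : R -> R -> C) (n : nat) :
  ulim f (fun _ => RtoC 1) -> ulim (fun r t => Cpow (f r t) n) (fun _ => RtoC 1).
Proof.
  intros Hf. induction n as [|n IH].
  - apply (ulim_cst (RtoC 1)).
  - refine (ulim_ext _ _ _ _ _ _ (ulim_mult _ _ _ _ Hf IH)); intros; simpl; [reflexivity|ring].
Qed.

(* Radiation: [A] is the far-field amplitude of the outgoing wave [W 0]. *)
Definition outgoing (k : R) (A : C) (W : nat -> R -> C) : Prop :=
  ulim (fun p _ => RtoC (sqrt p) * expi (- (k * p)) * W 0%nat (p * p)%R)%C (fun _ => A) /\
  ulim (fun p _ => RtoC (sqrt p) * expi (- (k * p)) * (RtoC (2 * p) * W 1%nat (p * p)%R))%C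
    (fun _ => Ci * RtoC k * A)%C.

(** For [X_n = (2p)^n W_n(p^2)] the radial equation reads
    [X_(n+2) = - k^2 X_n - (2(n+1)/p) X_(n+1)], and the last term vanishes in the limit. Asymptotics
    of all derivatives thus follow from the first two. *)
Lemma outgoing_all (k : R) (A : C) (W : nat -> R -> C) :
  radial (k ^ 2 / 4) W -> outgoing k A W -> forall n,
  ulim (fun p _ => RtoC (sqrt p) * expi (- (k * p)) * (RtoC ((2 * p) ^ n) * W n (p * p)%R))%C
    (fun _ => Cpow (Ci * RtoC k) n * A)%C.
Proof.
  intros [_ HW] [H0 H1].
  assert (X : forall n,
    ulim (fun p _ => RtoC (sqrt p) * expi (- (k * p)) * (RtoC ((2 * p) ^ n) * W n (p * p)%R))%C
      (fun _ => Cpow (Ci * RtoC k) n * A)%C /\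
    ulim (fun p _ => RtoC (sqrt p) * expi (- (k * p)) * (RtoC ((2 * p) ^ S n) * W (S n) (p * p)%R))%C
      (fun _ => Cpow (Ci * RtoC k) (S n) * A)%C).
  { induction n as [|n [I0 I1]].
    - split.
      + refine (ulim_ext _ _ _ _ _ _ H0); intros; simpl; ring.
      + refine (ulim_ext _ _ _ _ _ _ H1); intros; simpl; [|ring].
        rewrite Rmult_1_r. reflexivity.
    - split; [exact I1|].
      assert (Y := ulim_plus _ _ _ _ (ulim_scal (RtoC (- k ^ 2)) _ _ I0)
        (ulim_scal (RtoC (- 2 * (INR n + 1))) _ _ (ulim_mult _ _ _ _ ulim_inv I1))).
      refine (ulim_ext _ _ _ _ (fun _ _ => eq_refl) _ (ulim_ext_loc _ _ _ 0 _ Y)).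
      + intros _. simpl. Ceq.
      + intros p t Hp. cbv beta.
        assert (E := HW n (p * p) ltac:(apply Rmult_lt_0_compat; lra)).
        transitivity (RtoC (sqrt p) * expi (- (k * p)) * (RtoC (4 * (2 * p) ^ n)
           * (RtoC (p * p) * W (S (S n)) (p * p)%R)))%C.
        * replace (RtoC (p * p) * W (S (S n)) (p * p)%R)%C with
            (- RtoC (k ^ 2 / 4) * W n (p * p)%R - RtoC (INR n + 1) * W (S n) (p * p)%R)%C
            by (rewrite <- E; ring).
          change ((2 * p) ^ S n) with (2 * p * (2 * p) ^ n).
          generalize (W n (p * p)) (W (S n) (p * p)) (sqrt p) (expi (- (k * p))) ((2 * p) ^ n).
          intros w0 w1 s e q. Cfield.
        * change ((2 * p) ^ S (S n)) with (2 * p * (2 * p * (2 * p) ^ n)).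
          generalize (W (S (S n)) (p * p)) (sqrt p) (expi (- (k * p))) ((2 * p) ^ n).
          intros w1 s e q. Ceq. }
  intros n. apply X.
Qed.

Definition scaling (k r : R) : C := (RtoC (sqrt r) * expi (- (k * r)))%C.

Lemma Cpow_RtoC (a : R) (n : nat) : Cpow (RtoC a) n = RtoC (a ^ n).
Proof. induction n as [|n IH]; [reflexivity|]. simpl. rewrite IH, RtoC_mult. reflexivity. Qed.

(** The fields are normalised by the radius [r] of the arc, common to both sources, while their
    decay is in [rho]. The ratios of powers tend to 1 and the phase difference leaves
    [e^(-ik proj)]. *)
Lemma ulim_Wf (k H : R) (x : point) (A : C) (W : nat -> R -> C) (n : nat) :
  radial (k ^ 2 / 4) W -> outgoing k A W ->
  ulim (fun r t => scaling k r * (RtoC ((2 * r) ^ n) * Wf W x n (polar H r t)))%C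
    (fun t => Cpow (Ci * RtoC k) n * (A * expi (- (k * proj H x t))))%C.
Proof.
  intros HW HA.
  assert (T := ulim_comp _ _ (rho H x) (outgoing_all k A W HW HA n) (rho_infty H x)).
  assert (Y := ulim_mult _ _ _ _ (ulim_mult _ _ _ _ (ulim_sqrt_ratio H x) (ulim_pow _ n (ulim_ratio H x)))
     (ulim_mult _ _ _ _ (ulim_phase H x k) T)).
  refine (ulim_ext _ _ _ _ (fun _ _ => eq_refl) _ (ulim_ext_loc _ _ _ (2 * off H x + 1) _ Y)).
  - intros t. cbv beta. ring.
  - intros r t Hr. cbv beta. destruct (rho_bounds H x r t Hr) as [B1 _].
    assert (O0 := off_ge_0 H x). assert (Hp : 0 < rho H x r t) by lra.
    assert (Es : rho H x r t * rho H x r t = sqd x (polar H r t)).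
    { unfold rho. apply sqrt_sqrt. unfold sqd, dot.
      assert (Q := fun z => Rle_0_sqr z). unfold Rsqr in Q.
      assert (Q1 := Q (fst (sub (polar H r t) x))). assert (Q2 := Q (snd (sub (polar H r t) x))). lra. }
    rewrite Es. unfold Wf, scaling. set (p := rho H x r t) in *. clearbody p.
    rewrite Cpow_RtoC.
    replace (expi (- (k * r))) with (expi (k * (p - r)) * expi (- (k * p)))%C
      by (rewrite Cexp_mul; f_equal; ring).
    assert (Sp : 0 < sqrt p) by (apply sqrt_lt_R0; lra).
    replace (RtoC (sqrt r)) with (RtoC (sqrt r / sqrt p) * RtoC (sqrt p))%C
      by (rewrite <- RtoC_mult; f_equal; field; lra).
    replace (RtoC ((2 * r) ^ n)) with (RtoC ((r / p) ^ n) * RtoC ((2 * p) ^ n))%C.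
    + ring.
    + rewrite <- RtoC_mult, <- Rpow_mult_distr. do 2 f_equal. field. lra.
Qed.

(** * Far-field amplitudes and the flux of two plane waves *)

Definition amp (al be : R) (c : nat) (k t : R) (j : nat) : R :=
  al * delta j c - be * k ^ 2 * (coord j (dir t) * coord c (dir t)).

Definition phase (k H : R) (A : C) (x : point) (t : R) : C := (A * expi (- (k * proj H x t)))%C.

Section WaveFar.
Variables (al be k H : R) (c : nat) (W : nat -> R -> C) (A : C) (x : point).
Hypothesis (HW : radial (k ^ 2 / 4) W) (HA : outgoing k A W).

(** In the far field each derivative multiplies by [i k] times a component of the direction, so the
    Hessian becomes [-k^2] times [d d^T]. Terms with fewer factors [dx] carry a spare [1/r] and
    vanish. *)
Lemma ulim_wave (j : nat) :
  ulim (fun r t => scaling k r * wave al be c W x j (polar H r t))%C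
    (fun t => RtoC (amp al be c k t j) * phase k H A x t)%C.
Proof.
  assert (T := fun n => ulim_Wf k H x A W n HW HA).
  assert (Y := ulim_plus _ _ _ _ (ulim_scal (RtoC al * del j c)%C _ _ (T 0%nat))
    (ulim_scal (RtoC be) _ _ (ulim_plus _ _ _ _
      (ulim_mult _ _ _ _ (ulim_mult _ _ _ _ (ulim_dx H x j) (ulim_dx H x c)) (T 2%nat))
      (ulim_scal (del j c) _ _ (ulim_mult _ _ _ _ ulim_inv (T 1%nat)))))).
  refine (ulim_ext _ _ _ _ (fun _ _ => eq_refl) _ (ulim_ext_loc _ _ _ 0 _ Y)).
  - intros t. cbv beta. fold (phase k H A x t). unfold amp, del.
    generalize (phase k H A x t) (delta j c) (coord j (dir t)) (coord c (dir t)). intros. Ceq.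
  - intros r t Hr. cbv beta. unfold wave, del.
    generalize (Wf W x 0 (polar H r t)) (Wf W x 1 (polar H r t)) (Wf W x 2 (polar H r t))
      (scaling k r) (dx x j (polar H r t)) (dx x c (polar H r t)) (delta j c). intros.
    Cfield.
Qed.

Lemma ulim_wave1 (a j : nat) :
  ulim (fun r t => scaling k r * wave1 al be c W x a j (polar H r t))%C
    (fun t => Ci * RtoC k * (RtoC (coord a (dir t)) * (RtoC (amp al be c k t j) * phase k H A x t)))%C.
Proof.
  assert (T := fun n => ulim_Wf k H x A W n HW HA).
  assert (D := fun a => ulim_dx H x a).
  assert (Y := ulim_plus _ _ _ _
    (ulim_scal (RtoC al * del j c)%C _ _ (ulim_mult _ _ _ _ (D a) (T 1%nat)))
    (ulim_scal (RtoC be) _ _ (ulim_plus _ _ _ _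
      (ulim_mult _ _ _ _ (ulim_mult _ _ _ _ (D a) (ulim_mult _ _ _ _ (D j) (D c))) (T 3%nat))
      (ulim_mult _ _ _ _ ulim_inv (ulim_mult _ _ _ _
        (ulim_plus _ _ _ _ (ulim_plus _ _ _ _ (ulim_scal (del a j) _ _ (D c)) (ulim_scal (del a c) _ _ (D j)))
          (ulim_scal (del j c) _ _ (D a)))
        (T 2%nat)))))).
  refine (ulim_ext _ _ _ _ (fun _ _ => eq_refl) _ (ulim_ext_loc _ _ _ 0 _ Y)).
  - intros t. cbv beta. fold (phase k H A x t). unfold amp, del.
    generalize (phase k H A x t) (delta j c) (delta a j) (delta a c)
      (coord j (dir t)) (coord c (dir t)) (coord a (dir t)). intros. Ceq.
  - intros r t Hr. cbv beta. unfold wave1, del.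
    generalize (Wf W x 3 (polar H r t)) (Wf W x 1 (polar H r t)) (Wf W x 2 (polar H r t))
      (scaling k r) (dx x j (polar H r t)) (dx x c (polar H r t)) (dx x a (polar H r t))
      (delta j c) (delta a j) (delta a c). intros.
    Cfield.
Qed.
End WaveFar.

(** Pairing of [g] with the stress, on the normal [dir t], of a plane wave of polarisation [f]
    travelling along [dir t], the factor [i k] left out. Its symmetry in [f] and [g] lets the two
    halves of [betti] combine. *)
Definition stress_form (mu tmu tlam t : R) (f g : nat -> R) : R :=
  (mu + tmu) * (f 0%nat * g 0%nat + f 1%nat * g 1%nat)
  + tlam * ((cos t * f 0%nat + sin t * f 1%nat) * (cos t * g 0%nat + sin t * g 1%nat))
  - tmu * ((- sin t * f 0%nat + cos t * f 1%nat) * (- sin t * g 0%nat + cos t * g 1%nat)).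

Lemma ulim_real (f : R -> R) (B : R) : (forall t, Rabs (f t) <= B) ->
  ulim (fun _ t => RtoC (f t)) (fun t => RtoC (f t)).
Proof. intros HB. apply (ulim_const (fun t => RtoC (f t)) B). intros t. rewrite Cmod_R. apply HB. Qed.

Lemma ulim_cos : ulim (fun _ t => RtoC (cos t)) (fun t => RtoC (cos t)).
Proof. apply (ulim_real cos 1). intros t. apply Rabs_le, COS_bound. Qed.
Lemma ulim_sin : ulim (fun _ t => RtoC (sin t)) (fun t => RtoC (sin t)).
Proof. apply (ulim_real sin 1). intros t. apply Rabs_le, SIN_bound. Qed.

Lemma ulim_tr (mu tmu tlam : R) (g : nat -> nat -> R -> R -> C) (G : nat -> nat -> R -> C) (j : nat) :
  (forall a j, ulim (g a j) (G a j)) ->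
  ulim (fun r t => tr mu tmu tlam (dir t) (fun a j => g a j r t) j)
    (fun t => tr mu tmu tlam (dir t) (fun a j => G a j t) j).
Proof.
  intros Hg.
  assert (N : forall i, ulim (fun _ t => RtoC (coord i (dir t))) (fun t => RtoC (coord i (dir t)))).
  { intros [|i]; [exact ulim_cos|exact ulim_sin]. }
  assert (NP : ulim (fun _ t => RtoC (coord j (perp (dir t)))) (fun t => RtoC (coord j (perp (dir t))))).
  { destruct j as [|j]; [|exact ulim_cos].
    refine (ulim_ext _ _ _ _ _ _ (ulim_opp _ _ ulim_sin)); intros; simpl; Ceq. }
  assert (Y := ulim_minus _ _ _ _ (ulim_plus _ _ _ _
    (ulim_scal (RtoC (mu + tmu)) _ _ (ulim_plus _ _ _ _ (ulim_mult _ _ _ _ ulim_cos (Hg 0%nat j))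
       (ulim_mult _ _ _ _ ulim_sin (Hg 1%nat j))))
    (ulim_mult _ _ _ _ (ulim_scal (RtoC tlam) _ _ (N j)) (ulim_plus _ _ _ _ (Hg 0%nat 0%nat) (Hg 1%nat 1%nat))))
    (ulim_mult _ _ _ _ (ulim_scal (RtoC tmu) _ _ NP)
       (ulim_plus _ _ _ _ (ulim_opp _ _ (Hg 1%nat 0%nat)) (Hg 0%nat 1%nat)))).
  refine (ulim_ext _ _ _ _ _ _ Y); intros; cbv beta; unfold tr; rewrite !RtoC_mult; reflexivity.
Qed.

Lemma ulim_betti (mu tmu tlam : R) (f h : nat -> R -> R -> C) (F E : nat -> R -> C)
  (g l : nat -> nat -> R -> R -> C) (G L : nat -> nat -> R -> C) :
  (forall j, ulim (f j) (F j)) -> (forall j, ulim (h j) (E j)) ->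
  (forall a j, ulim (g a j) (G a j)) -> (forall a j, ulim (l a j) (L a j)) ->
  ulim (fun r t => betti mu tmu tlam (dir t) (fun j => f j r t) (fun a j => g a j r t)
          (fun j => h j r t) (fun a j => l a j r t))
    (fun t => betti mu tmu tlam (dir t) (fun j => F j t) (fun a j => G a j t)
          (fun j => E j t) (fun a j => L a j t)).
Proof.
  intros Hf Hh Hg Hl.
  assert (Tg := fun j => ulim_tr mu tmu tlam g G j Hg). assert (Tl := fun j => ulim_tr mu tmu tlam l L j Hl).
  exact (ulim_minus _ _ _ _
    (ulim_plus _ _ _ _ (ulim_mult _ _ _ _ (Tg 0%nat) (Hh 0%nat)) (ulim_mult _ _ _ _ (Tg 1%nat) (Hh 1%nat)))
    (ulim_plus _ _ _ _ (ulim_mult _ _ _ _ (Hf 0%nat) (Tl 0%nat)) (ulim_mult _ _ _ _ (Hf 1%nat) (Tl 1%nat)))).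
Qed.

Lemma betti_scal (mu tmu tlam : R) (n : point) (s s' : C) (u v : nat -> C) (g h : nat -> nat -> C) :
  betti mu tmu tlam n (fun j => s * u j)%C (fun a j => s * g a j)%C (fun j => s' * v j)%C
    (fun a j => s' * h a j)%C = (s * s' * betti mu tmu tlam n u g v h)%C.
Proof. unfold betti, tr. ring. Qed.

Lemma tr_plane (mu tmu tlam t : R) (q V : C) (f : nat -> R) (j : nat) : (j < 2)%nat ->
  tr mu tmu tlam (dir t) (fun a j => q * (RtoC (coord a (dir t)) * (RtoC (f j) * V)))%C j
  = (q * V * RtoC ((mu + tmu) * f j + tlam * coord j (dir t) * (cos t * f 0%nat + sin t * f 1%nat)
       - tmu * coord j (perp (dir t)) * (- sin t * f 0%nat + cos t * f 1%nat)))%C.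
Proof.
  intros Hj. assert (S2 := sin_cos_sq t).
  replace ((mu + tmu) * f j) with ((mu + tmu) * (sin t * sin t + cos t * cos t) * f j) by (rewrite S2; ring).
  unfold tr, dir, perp, coord, fst, snd. two_cases Hj; Ceq.
Qed.

Lemma tr_ext (mu tmu tlam : R) (n : point) (g h : nat -> nat -> C) (j : nat) :
  (forall a i, g a i = h a i) -> tr mu tmu tlam n g j = tr mu tmu tlam n h j.
Proof. intros E. unfold tr. rewrite !E. reflexivity. Qed.

Lemma betti_ext (mu tmu tlam : R) (n : point) (u u' v v' : nat -> C) (g g' h h' : nat -> nat -> C) :
  (forall i, u i = u' i) -> (forall i, v i = v' i) ->
  (forall a i, g a i = g' a i) -> (forall a i, h a i = h' a i) ->
  betti mu tmu tlam n u g v h = betti mu tmu tlam n u' g' v' h'.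
Proof.
  intros Eu Ev Eg Eh. unfold betti. rewrite !Eu, !Ev.
  rewrite !(tr_ext _ _ _ _ g g' _ Eg), !(tr_ext _ _ _ _ h h' _ Eh). reflexivity.
Qed.

(** Conjugation turns [i k'] into [-i k'], so the subtraction in [betti] produces the sum of the
    wave numbers and not their difference. *)
Lemma betti_plane (mu tmu tlam t k k' : R) (V V' : C) (f g : nat -> R) :
  betti mu tmu tlam (dir t) (fun j => RtoC (f j) * V)%C
    (fun a j => Ci * RtoC k * (RtoC (coord a (dir t)) * (RtoC (f j) * V)))%C
    (fun j => Cconj (RtoC (g j) * V'))%C
    (fun a j => Cconj (Ci * RtoC k' * (RtoC (coord a (dir t)) * (RtoC (g j) * V'))))%C
  = (Ci * RtoC ((k + k') * stress_form mu tmu tlam t f g) * (V * Cconj V'))%C.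
Proof.
  assert (E : forall n j, tr mu tmu tlam n (fun a j => Cconj (Ci * RtoC k' * (RtoC (coord a (dir t)) * (RtoC (g j) * V'))))%C j
    = tr mu tmu tlam n (fun a j => - Ci * RtoC k' * (RtoC (coord a (dir t)) * (RtoC (g j) * Cconj V')))%C j).
  { intros n j. apply tr_ext. intros. Ceq. }
  unfold betti. rewrite !E, !tr_plane by lia.
  unfold stress_form, dir, perp, coord, fst, snd.
  generalize (cos t) (sin t) (f 0%nat) (f 1%nat) (g 0%nat) (g 1%nat). intros. Ceq.
Qed.

Lemma expi_conj (a : R) : Cconj (expi a) = expi (- a).
Proof. unfold expi. rewrite cos_neg, sin_neg. reflexivity. Qed.

(** The two factors [sqrt r] make up the length element of the arc; the phase disappears when the
    wave numbers agree. *)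
Lemma scaling_conj (k k' r : R) : 0 < r ->
  (scaling k r * Cconj (scaling k' r))%C = (expi (- ((k - k') * r)) * RtoC r)%C.
Proof.
  intros Hr. unfold scaling. rewrite Cmult_conj, expi_conj.
  replace (Cconj (RtoC (sqrt r))) with (RtoC (sqrt r)) by Ceq.
  transitivity (RtoC (sqrt r * sqrt r) * (expi (- (k * r)) * expi (- - (k' * r))))%C.
  - rewrite RtoC_mult. ring.
  - rewrite sqrt_sqrt by lra. rewrite Cexp_mul, Cmult_comm. f_equal. f_equal. ring.
Qed.

Lemma ulim_pair (mu tmu tlam H : R)
  (al be k : R) (c : nat) (W : nat -> R -> C) (A : C) (x : point)
  (al' be' k' : R) (c' : nat) (W' : nat -> R -> C) (A' : C) (y : point) :
  radial (k ^ 2 / 4) W -> outgoing k A W -> radial (k' ^ 2 / 4) W' -> outgoing k' A' W' ->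
  ulim (fun r t => expi (- ((k - k') * r)) * (RtoC r * flux mu tmu tlam (dir t)
      (wave al be c W x) (wave1 al be c W x)
      (wave al' be' c' (fun n s => Cconj (W' n s)) y) (wave1 al' be' c' (fun n s => Cconj (W' n s)) y)
      (polar H r t)))%C
    (fun t => Ci * RtoC ((k + k') * stress_form mu tmu tlam t (amp al be c k t) (amp al' be' c' k' t))
       * (phase k H A x t * Cconj (phase k' H A' y t)))%C.
Proof.
  intros HW HA HW' HA'.
  assert (Y := ulim_betti mu tmu tlam _ _ _ _ _ _ _ _
    (ulim_wave al be k H c W A x HW HA)
    (fun j => ulim_conj _ _ (ulim_wave al' be' k' H c' W' A' y HW' HA' j))
    (ulim_wave1 al be k H c W A x HW HA)
    (fun a j => ulim_conj _ _ (ulim_wave1 al' be' k' H c' W' A' y HW' HA' a j))).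
  refine (ulim_ext _ _ _ _ (fun _ _ => eq_refl) _ (ulim_ext_loc _ _ _ 0 _ Y)).
  - intros t. apply betti_plane.
  - intros r t Hr. cbv beta.
    transitivity (betti mu tmu tlam (dir t)
      (fun j => scaling k r * wave al be c W x j (polar H r t))%C
      (fun a j => scaling k r * wave1 al be c W x a j (polar H r t))%C
      (fun j => Cconj (scaling k' r) * wave al' be' c' (fun n s => Cconj (W' n s)) y j (polar H r t))%C
      (fun a j => Cconj (scaling k' r) * wave1 al' be' c' (fun n s => Cconj (W' n s)) y a j (polar H r t))%C).
    + apply betti_ext; intros; rewrite <- ?wave_conj, <- ?wave1_conj; try reflexivity;
        apply Cmult_conj.
    + rewrite betti_scal, scaling_conj by exact Hr. unfold flux. ring.
Qed.

Lemma perp_dir (t : R) (j c : nat) : (j < 2)%nat -> (c < 2)%nat ->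
  delta j c - coord j (dir t) * coord c (dir t) = coord j (perp (dir t)) * coord c (perp (dir t)).
Proof.
  intros Hj Hc. assert (S2 := sin_cos_sq t).
  two_cases Hj; two_cases Hc; unfold delta, dir, perp; simpl; lra.
Qed.

(** Meant for the mixed terms: their oscillating factor has no limit of its own, but it is
    unimodular and multiplies something that tends to 0. *)
Lemma ulim_mult_unit (f g : R -> R -> C) (h : R -> C) :
  (forall r t, Cmod (f r t) = 1) -> ulim g (fun _ => RtoC 0) -> ulim (fun r t => f r t * g r t)%C (fun _ => RtoC 0).
Proof.
  intros Hf [Hg _]. split; [|exists 0; intros; rewrite Cmod_0; lra].
  intros eps Heps. destruct (Hg eps Heps) as [M HM]. exists M. intros r t Hr.
  specialize (HM r t Hr). replace (f r t * g r t - 0)%C with (f r t * (g r t - 0))%C by ring.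
  rewrite Cmod_mult, Hf, Rmult_1_l. exact HM.
Qed.

(** * The fundamental solution *)

(** Higher derivatives are generated by solving the radial equation for its leading term, so [f0]
    and its derivative [f1] determine everything; carrying pairs makes the two-step recursion
    structural. *)
Fixpoint radial_pair (q : R) (f0 f1 : R -> C) (n : nat) (s : R) : C * C :=
  match n with
  | O => (f0 s, f1 s)
  | S m => let p := radial_pair q f0 f1 m s in
           (snd p, ((- RtoC q * fst p - RtoC (INR m + 1) * snd p) * RtoC (/ s))%C)
  end.

Definition radial_seq (q : R) (f0 f1 : R -> C) (n : nat) (s : R) : C := fst (radial_pair q f0 f1 n s).

Lemma radial_seq_radial (q : R) (f0 f1 : R -> C) :
  (forall s, 0 < s -> isD f0 s (f1 s)) ->
  (forall s, 0 < s -> isD f1 s ((- RtoC q * f0 s - f1 s) * RtoC (/ s))%C) ->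
  radial q (radial_seq q f0 f1).
Proof.
  intros H0 H1. set (W := radial_seq q f0 f1).
  assert (R2 : forall n s, W (S (S n)) s = ((- RtoC q * W n s - RtoC (INR n + 1) * W (S n) s) * RtoC (/ s))%C)
    by reflexivity.
  assert (X : forall n s, 0 < s -> isD (W n) s (W (S n) s) /\ isD (W (S n)) s (W (S (S n)) s)).
  { induction n as [|n IH]; intros s Hs.
    - split; [apply H0, Hs|]. eapply isD_eq; [apply H1, Hs|]. rewrite R2.
      unfold W, radial_seq. simpl. Ceq.
    - destruct (IH s Hs) as [I0 I1]. split; [exact I1|].
      assert (Hi : isD (fun s => RtoC (/ s)) s (RtoC (- / s ^ 2))).
      { apply (isD_RtoC Rinv), is_derive_Rinv, Hs. }
      apply (isD_ext_loc (fun s => (RtoC (- q) * W n s + RtoC (- (INR n + 1)) * W (S n) s) * RtoC (/ s))%C).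
      + apply filter_forall. intros u. rewrite R2. Ceq.
      + eapply isD_eq.
        * apply isD_mult; [|exact Hi].
          apply isD_plus; apply isD_mult; [apply isD_const|exact I0|apply isD_const|exact I1].
        * cbv beta. rewrite (R2 (S n)), (R2 n), S_INR.
          generalize (W n s) (W (S n) s) (INR n). intros a b m.
          Cfield. }
  split.
  - intros n s Hs. apply X, Hs.
  - intros n s Hs. rewrite R2. generalize (W n s) (W (S n) s) (INR n). intros a b m.
    Cfield.
Qed.

Lemma isD_hankel (z : R) : 0 < z ->
  isD hankel1_0 z (hankel1_0' z) /\
  isD hankel1_0' z (- hankel1_0' z * RtoC (/ z) - hankel1_0 z)%C.
Proof.
  intros Hz. destruct (bessel_J0_pair z Hz) as [J1 J2]. destruct (bessel_Y0_pair z Hz) as [Y1 Y2].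
  assert (K : forall a b a' b', is_derive a z a' -> is_derive b z b' ->
    isD (fun z => RtoC (a z) + Ci * RtoC (b z))%C z (RtoC a' + Ci * RtoC b')%C).
  { intros a b a' b' Ha Hb. eapply isD_eq.
    - apply isD_plus; [apply isD_RtoC, Ha|]. apply isD_mult; [apply isD_const|apply isD_RtoC, Hb].
    - cbv beta. ring. }
  split.
  - exact (K _ _ _ _ J1 Y1).
  - eapply isD_eq; [exact (K _ _ _ _ J2 Y2)|]. unfold hankel1_0, hankel1_0'. 
    Cfield.
Qed.

Definition phi0 (k s : R) : C := (Ci / RtoC 4 * hankel1_0 (k * sqrt s))%C.
Definition phi1 (k s : R) : C :=
  (Ci / RtoC 4 * (RtoC (k / (2 * sqrt s)) * hankel1_0' (k * sqrt s)))%C.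
Definition phis (k : R) : nat -> R -> C := radial_seq (k ^ 2 / 4) (phi0 k) (phi1 k).

Lemma is_derive_k_sqrt (k s : R) : 0 < s -> is_derive (fun s => k * sqrt s) s (k / (2 * sqrt s)).
Proof.
  intros Hs. eapply is_derive_eq; [apply derR_scal, is_derive_sqrt', Hs|].
  reflexivity.
Qed.

Lemma phis_radial (k : R) : 0 < k -> radial (k ^ 2 / 4) (phis k).
Proof.
  intros Hk. apply radial_seq_radial; intros s Hs;
    assert (Ss : 0 < sqrt s) by (apply sqrt_lt_R0; exact Hs);
    assert (Hz : 0 < k * sqrt s) by (apply Rmult_lt_0_compat; assumption);
    destruct (isD_hankel _ Hz) as [D0 D1]; assert (Dz := is_derive_k_sqrt k s Hs).
  - eapply isD_eq.
    + apply isD_mult; [apply isD_const|].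
      apply (isD_comp hankel1_0 (fun s => k * sqrt s)); [exact D0|exact Dz].
    + unfold phi1. ring.
  - assert (Di : isD (fun s => RtoC (k / (2 * sqrt s))) s (RtoC (- (k / (4 * s * sqrt s))))).
    { apply isD_RtoC. eapply is_derive_eq.
      - apply (derR_scal (fun s => / (2 * sqrt s)) s k), is_derive_half_inv_sqrt, Hs.
      - unfold Rdiv. ring. }
    eapply isD_eq.
    + apply isD_mult; [apply isD_const|]. apply isD_mult; [exact Di|].
      apply (isD_comp hankel1_0' (fun s => k * sqrt s)); [exact D1|exact Dz].
    + cbv beta. unfold phi1, phi0.
      generalize (hankel1_0 (k * sqrt s)) (hankel1_0' (k * sqrt s)) (Ci / RtoC 4)%C. intros h h' q.
      assert (Q := sqrt_sqrt s ltac:(lra)).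
      replace (k / (4 * s * sqrt s)) with (k / (4 * (sqrt s * sqrt s) * sqrt s)) by (rewrite Q; reflexivity).
      replace (/ s) with (/ (sqrt s * sqrt s)) by (rewrite Q; reflexivity).
      clear Q. generalize dependent (sqrt s). intros w Hw _ _ _ _ _.
      Cfield.
Qed.

(** The amplitude is [(i/4) c / sqrt k], and [(1/16)(2/pi)/k = 1/(8 pi k)], the origin of the factor
    [1/(8 pi)] in [ImplusGamma]. *)
Lemma phis_outgoing (k : R) : 0 < k -> exists A : C,
  outgoing k A (phis k) /\ (A * Cconj A)%C = RtoC (/ (8 * PI * k)).
Proof.
  intros Hk. assert (HP := PI_RGT_0). destruct hankel_radiation as [c [Hc [H0 H1]]].
  assert (Sk : 0 < sqrt k) by (apply sqrt_lt_R0; exact Hk).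
  assert (Qk := sqrt_sqrt k ltac:(lra)).
  exists (Ci / RtoC 4 * (RtoC (/ sqrt k) * c))%C.
  assert (Inf : forall M, exists M', forall r t : R, M' < r -> M < k * r).
  { intros M. exists (M / k). intros r _ Hr. apply (Rmult_lt_compat_l k) in Hr; [|exact Hk].
    replace (k * (M / k)) with M in Hr by (field; lra). exact Hr. }
  assert (T0 := ulim_comp (fun z => RtoC (sqrt z) * expi (- z) * hankel1_0 z)%C c (fun r _ => k * r) H0 Inf).
  assert (T1 := ulim_comp (fun z => RtoC (sqrt z) * expi (- z) * hankel1_0' z)%C _ (fun r _ => k * r) H1 Inf).
  split; [split|].
  - refine (ulim_ext_loc _ _ _ 0 _ (ulim_scal (Ci / RtoC 4)%C _ _ (ulim_scal (RtoC (/ sqrt k)) _ _ T0))).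
    intros p t Hp. cbv beta. unfold phis, radial_seq, phi0. simpl fst.
    rewrite sqrt_square by lra. rewrite sqrt_mult, RtoC_mult by lra.
    transitivity (RtoC (/ sqrt k * sqrt k) * (RtoC (sqrt p) * expi (- (k * p)) * (Ci / RtoC 4 * hankel1_0 (k * p))))%C.
    + rewrite RtoC_mult. ring.
    + rewrite Rinv_l by lra. ring.
  - refine (ulim_ext _ _ _ _ (fun _ _ => eq_refl) _ (ulim_ext_loc _ _ _ 0 _
      (ulim_scal (Ci / RtoC 4 * RtoC k)%C _ _ (ulim_scal (RtoC (/ sqrt k)) _ _ T1)))).
    + intros _. cbv beta. ring.
    + intros p t Hp. cbv beta. unfold phis, radial_seq, phi1. simpl fst.
      rewrite sqrt_square by lra. rewrite sqrt_mult, RtoC_mult by lra.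
      transitivity (RtoC (/ sqrt k * sqrt k) * (RtoC (sqrt p) * expi (- (k * p)) *
        (RtoC (2 * p * (k / (2 * p))) * (Ci / RtoC 4 * hankel1_0' (k * p)))))%C.
      * replace (2 * p * (k / (2 * p))) with k by (field; lra). rewrite RtoC_mult. ring.
      * rewrite Rinv_l by lra. rewrite RtoC_mult. ring.
  - transitivity (RtoC (/ 16 * / (sqrt k * sqrt k)) * (c * Cconj c))%C.
    + Cfield.
    + rewrite Hc, Qk, <- RtoC_mult. f_equal. field. lra.
Qed.

Lemma Phi_phis (k : R) (x y : point) : Phi k x y = Wf (phis k) y 0 x.
Proof. reflexivity. Qed.

Lemma entry_build (f : nat -> nat -> C) (j k : nat) : (j < 2)%nat -> (k < 2)%nat -> entry (build f) j k = f j k.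
Proof. intros Hj Hk. unfold entry, build. apply coeff_mat_bij; assumption. Qed.

Lemma entry_mulmat (A B : mat) (j k : nat) : (j < 2)%nat -> (k < 2)%nat ->
  entry (mulmat A B) j k = (entry A j 0 * entry B 0 k + entry A j 1 * entry B 1 k)%C.
Proof.
  intros Hj Hk. unfold entry, mulmat, Mmult. rewrite coeff_mat_bij by assumption.
  simpl Nat.pred. rewrite sum_Sn, sum_O. reflexivity.
Qed.

Section Green.
Variables (om mu lam : R).
Hypothesis (Hom : 0 < om) (Hmu : 0 < mu) (Hlm : 0 <= lam + mu).

Lemma ks_pos : 0 < ks om mu.
Proof. apply Rdiv_lt_0_compat; [exact Hom|apply sqrt_lt_R0; exact Hmu]. Qed.
Lemma kp_pos : 0 < kp om mu lam.
Proof. apply Rdiv_lt_0_compat; [exact Hom|apply sqrt_lt_R0; lra]. Qed.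
Lemma ks_sq : ks om mu ^ 2 = om ^ 2 / mu.
Proof.
  unfold ks, Rdiv. rewrite Rpow_mult_distr, pow_inv. f_equal. f_equal.
  simpl. rewrite Rmult_1_r. apply sqrt_sqrt; lra.
Qed.
Lemma kp_sq : kp om mu lam ^ 2 = om ^ 2 / (2 * mu + lam).
Proof.
  unfold kp, Rdiv. rewrite Rpow_mult_distr, pow_inv. f_equal. f_equal.
  simpl. rewrite Rmult_1_r. apply sqrt_sqrt; lra.
Qed.

Let Ws := phis (ks om mu).
Let Wp := phis (kp om mu lam).

(** A column of Γ is the sum of its terms in [Phi_(k_s)] and its term in [Phi_(k_p)], the shear and
    the pressure part. The radial function [W] is a parameter so that conjugate columns are covered
    as well. *)
Definition swave (W : nat -> R -> C) (x : point) (c : nat) : vect := wave (/ mu) (/ om ^ 2) c W x.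
Definition swave1 (W : nat -> R -> C) (x : point) (c : nat) : nat -> vect := wave1 (/ mu) (/ om ^ 2) c W x.
Definition swave2 (W : nat -> R -> C) (x : point) (c : nat) : nat -> nat -> vect := wave2 (/ mu) (/ om ^ 2) c W x.
Definition pwave (W : nat -> R -> C) (x : point) (c : nat) : vect := wave 0 (- / om ^ 2) c W x.
Definition pwave1 (W : nat -> R -> C) (x : point) (c : nat) : nat -> vect := wave1 0 (- / om ^ 2) c W x.
Definition pwave2 (W : nat -> R -> C) (x : point) (c : nat) : nat -> nat -> vect := wave2 0 (- / om ^ 2) c W x.

Lemma navier_total (Vs Vp : nat -> R -> C) (b : R) (x : point) (c : nat) :
  radial (ks om mu ^ 2 / 4) Vs -> radial (kp om mu lam ^ 2 / 4) Vp -> (c < 2)%nat -> snd x <= b ->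
  navier_sol mu lam om b (fun j p => swave Vs x c j p + pwave Vp x c j p)%C
    (fun a j p => swave1 Vs x c a j p + pwave1 Vp x c a j p)%C
    (fun d a j p => swave2 Vs x c d a j p + pwave2 Vp x c d a j p)%C.
Proof.
  intros HVs HVp Hc Hb. apply navier_sol_plus.
  - apply (navier_sol_wave mu lam om b _ _ (ks om mu ^ 2 / 4)); try assumption;
      rewrite ks_sq; field; lra.
  - apply (navier_sol_wave mu lam om b _ _ (kp om mu lam ^ 2 / 4)); try assumption;
      rewrite kp_sq; field; lra.
Qed.

(** The Hessian is an iterated [Derive]: the inner derivative is first replaced by its closed form
    on the whole half plane above the source, and only then is the outer one taken. *)
Lemma Gamma_entry (z x : point) (j c : nat) : (j < 2)%nat -> (c < 2)%nat -> snd x < snd z ->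
  entry (Gamma om mu lam z x) j c = (swave Ws x c j z + pwave Wp x c j z)%C.
Proof.
  intros Hj Hc Hz.
  assert (Rs := phis_radial _ ks_pos). assert (Rp := phis_radial _ kp_pos).
  unfold Gamma. rewrite entry_build by assumption. unfold hessian. rewrite entry_build by assumption.
  set (f := fun z => (Phi (ks om mu) z x - Phi (kp om mu lam) z x)%C).
  set (f1 := fun z => (RtoC 2 * (dx x c z * Wf Ws x 1 z) - RtoC 2 * (dx x c z * Wf Wp x 1 z))%C).
  assert (Gf := has_grad_minus (snd x) _ _ _ _ _ _ (has_grad_Wf (snd x) _ _ x 0 Rs (Rle_refl _))
    (has_grad_Wf (snd x) _ _ x 0 Rp (Rle_refl _))).
  assert (E1 : pderiv j (pderiv c f) z = pderiv j f1 z).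
  { apply (pderiv_ext_region (snd x)); [|exact Hz]. intros q Hq.
    destruct (has_grad_pderiv _ _ _ _ q Gf Hq) as [D0 D1]. unfold f1.
    two_cases Hc; [exact D0|exact D1]. }
  rewrite E1.
  assert (Gc : forall W q, radial q W -> has_grad (snd x) (fun z => RtoC 2 * (dx x c z * Wf W x 1 z))%C
    (fun z => RtoC 2 * (del c 0 * Wf W x 1 z + dx x c z * (RtoC 2 * (dx x 0 z * Wf W x 2 z))))%C
    (fun z => RtoC 2 * (del c 1 * Wf W x 1 z + dx x c z * (RtoC 2 * (dx x 1 z * Wf W x 2 z))))%C).
  { intros W q HW. apply (has_grad_scal (snd x) (RtoC 2) (fun z => dx x c z * Wf W x 1 z)%C).
    exact (has_grad_mult _ _ _ _ _ _ _ (has_grad_dx (snd x) x c Hc) (has_grad_Wf _ q W x 1 HW (Rle_refl _))). }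
  assert (G1 := has_grad_minus _ _ _ _ _ _ _ (Gc _ _ Rs) (Gc _ _ Rp)).
  destruct (has_grad_pderiv _ _ _ _ z G1 Hz) as [D0 D1]. fold Ws Wp in D0, D1. fold f1 in D0, D1.
  unfold swave, pwave, wave. rewrite (Phi_phis (ks om mu)). fold Ws.
  two_cases Hj; [rewrite D0|rewrite D1]; unfold del; two_cases Hc; unfold delta; simpl Nat.eqb; cbv iota;
    generalize (Wf Ws x 0 z) (Wf Ws x 1 z) (Wf Ws x 2 z) (Wf Wp x 0 z) (Wf Wp x 1 z) (Wf Wp x 2 z)
      (dx x 0 z) (dx x 1 z) (/ om ^ 2) (/ mu); intros; Ceq.
Qed.

Lemma Pi1_entry (tmu tlam : R) (n z x : point) (j c : nat) : (j < 2)%nat -> (c < 2)%nat -> snd x < snd z ->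
  entry (Pi1 om mu lam tmu tlam n z x) j c
  = tr mu tmu tlam n (fun a i => swave1 Ws x c a i z + pwave1 Wp x c a i z)%C j.
Proof.
  intros Hj Hc Hz.
  assert (Rs := phis_radial _ ks_pos). assert (Rp := phis_radial _ kp_pos).
  destruct (navier_total _ _ (snd x) x c Rs Rp Hc (Rle_refl _)) as [G _].
  assert (E : forall a i, (a < 2)%nat -> (i < 2)%nat ->
    pderiv a (fun z => entry (Gamma om mu lam z x) i c) z
    = (swave1 Ws x c a i z + pwave1 Wp x c a i z)%C).
  { intros a i Ha Hi.
    rewrite (pderiv_ext_region (snd x) a _ (fun z => swave Ws x c i z + pwave Wp x c i z)%C);
      [|intros q Hq; apply Gamma_entry; assumption|exact Hz].
    destruct (has_grad_pderiv _ _ _ _ z (G i Hi) Hz) as [D0 D1].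
    two_cases Ha; [exact D0|exact D1]. }
  unfold Pi1. rewrite entry_build by assumption.
  unfold stress, ndiff, div, div_perp, tr. rewrite !E by (try assumption; lia). reflexivity.
Qed.
End Green.

(** * Splitting of the flux and passage to the limit *)

Lemma Cconj_tr (mu tmu tlam : R) (n : point) (g : nat -> nat -> C) (j : nat) :
  Cconj (tr mu tmu tlam n g j) = tr mu tmu tlam n (fun a i => Cconj (g a i)) j.
Proof. unfold tr. Ceq. Qed.

Lemma flux_plus (mu tmu tlam : R) (n : point) (u u' v v' : vect) (u1 u1' v1 v1' : nat -> vect) (p : point) :
  flux mu tmu tlam n (fun j p => u j p + u' j p)%C (fun a j p => u1 a j p + u1' a j p)%C
    (fun j p => v j p + v' j p)%C (fun a j p => v1 a j p + v1' a j p)%C p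
  = (flux mu tmu tlam n u u1 v v1 p + flux mu tmu tlam n u' u1' v' v1' p
     + (flux mu tmu tlam n u u1 v' v1' p + flux mu tmu tlam n u' u1' v v1 p))%C.
Proof. unfold flux, betti, tr. ring. Qed.

(** Points of the line are approached from above. By contraposition, a source outside the closure
    lies strictly below the line. *)
Lemma closure_U (H : R) (x : point) : H <= snd x -> closure (U H) x.
Proof.
  intros Hx V [eps HV]. exists (fst x, snd x + eps / 2). assert (He := cond_pos eps). split.
  - apply HV. split; simpl.
    + apply ball_center.
    + unfold ball; simpl. unfold AbsRing_ball, abs, minus, plus, opp; simpl.
      replace (snd x + eps / 2 + - snd x) with (eps / 2) by ring. rewrite Rabs_right; lra.
  - unfold U. simpl. lra.
Qed.

Lemma Rabs_Re_le (z : C) : Rabs (Re z) <= Cmod z.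
Proof. eapply Rle_trans; [|apply Rmax_Cmod]. apply Rmax_l. Qed.
Lemma Rabs_Im_le (z : C) : Rabs (Im z) <= Cmod z.
Proof. eapply Rle_trans; [|apply Rmax_Cmod]. apply Rmax_r. Qed.

Lemma RInt_diff_le (f g : R -> R) (a b M : R) : a <= b -> ex_RInt f a b -> ex_RInt g a b ->
  (forall t, Rabs (f t - g t) <= M) -> Rabs (RInt f a b - RInt g a b) <= (b - a) * M.
Proof.
  intros Hab Hf Hg HM.
  assert (E : RInt (fun t => f t - g t) a b = RInt f a b - RInt g a b)
    by exact (RInt_minus (V := R_CompleteNormedModule) f g a b Hf Hg).
  rewrite <- E. apply abs_RInt_le_const; [exact Hab|exact (ex_RInt_minus (V := R_NormedModule) f g a b Hf Hg)|].
  intros t _. apply HM.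
Qed.

(** Uniformity in the angle moves the limit under the integral; the tolerance [eps / (2 pi)] becomes
    [eps / 2] over an interval of length [pi]. *)
Lemma integral_ulim (f : R -> R -> C) (g : R -> C) : ulim f g ->
  (forall r, 0 < r -> ex_RIntC (f r) 0 PI) -> ex_RIntC g 0 PI ->
  filterlim (fun r => integral_RC (f r) 0 PI) (Rbar_locally p_infty) (locally (integral_RC g 0 PI)).
Proof.
  intros [Hl _] Hf Hg P [eps HP]. assert (HPI := PI_RGT_0). assert (He := cond_pos eps).
  destruct (Hl (eps / (2 * PI))) as [M HM]; [apply Rdiv_lt_0_compat; lra|].
  exists (Rmax M 0). intros r Hr.
  assert (Hr1 : M < r) by (eapply Rle_lt_trans; [apply Rmax_l|exact Hr]).
  assert (Hr2 : 0 < r) by (eapply Rle_lt_trans; [apply Rmax_r|exact Hr]).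
  specialize (Hf r Hr2). rewrite (integral_RC_eq g 0 PI Hg) in HP. rewrite (integral_RC_eq _ 0 PI Hf).
  destruct Hf as [F1 F2]. destruct Hg as [G1 G2]. apply HP.
  assert (E : (PI - 0) * (eps / (2 * PI)) < eps).
  { replace ((PI - 0) * (eps / (2 * PI))) with (eps / 2) by (field; lra). lra. }
  split; (eapply Rle_lt_trans; [|exact E]).
  - apply (RInt_diff_le (fun t => Re (f r t)) (fun t => Re (g t)) 0 PI); [lra|assumption|assumption|].
    intros t. left. eapply Rle_lt_trans; [|apply (HM r t Hr1)]. apply (Rabs_Re_le (f r t - g t)%C).
  - apply (RInt_diff_le (fun t => Im (f r t)) (fun t => Im (g t)) 0 PI); [lra|assumption|assumption|].
    intros t. left. eapply Rle_lt_trans; [|apply (HM r t Hr1)]. apply (Rabs_Im_le (f r t - g t)%C).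
Qed.

Lemma stress_form_ext (mu tmu tlam t : R) (f f' g g' : nat -> R) :
  (forall j, (j < 2)%nat -> f j = f' j) -> (forall j, (j < 2)%nat -> g j = g' j) ->
  stress_form mu tmu tlam t f g = stress_form mu tmu tlam t f' g'.
Proof.
  intros Hf Hg. unfold stress_form.
  rewrite (Hf 0%nat), (Hf 1%nat), (Hg 0%nat), (Hg 1%nat) by lia. reflexivity.
Qed.

Lemma phase_product (k H : R) (A : C) (x y : point) (t : R) :
  (A * Cconj A)%C = RtoC (/ (8 * PI * k)) ->
  (phase k H A x t * Cconj (phase k H A y t))%C
  = (RtoC (/ (8 * PI * k)) * expi (k * dot (sub y x) (dir t)))%C.
Proof.
  intros <-. unfold phase. rewrite Cmult_conj, expi_conj.
  transitivity (A * Cconj A * (expi (- (k * proj H x t)) * expi (- - (k * proj H y t))))%C; [ring|].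
  rewrite Cexp_mul. f_equal. f_equal. unfold proj, dot, sub, dir. simpl. ring.
Qed.

Lemma ulim_limit (f : R -> R -> C) (g g' : R -> C) :
  ulim f g -> (forall t, g t = g' t) -> ulim f g'.
Proof. intros H E. exact (ulim_ext f f g g' (fun _ _ => eq_refl) E H). Qed.

Lemma cross_zero (a q : R) (V : C) : q = 0 -> (Ci * RtoC (a * q) * V)%C = RtoC 0.
Proof. intros ->. rewrite Rmult_0_r. ring. Qed.

Section Main.
Variables (om mu lam tmu tlam : R).
Hypothesis (Hom : 0 < om) (Hmu : 0 < mu) (Hlm : 0 <= lam + mu) (Hsum : tmu + tlam = mu + lam).

(** [ks^2 = om^2 / mu] merges the two terms of the amplitude into the projection across [dir t]:
    shear waves are transversal. *)
Lemma amp_s (c j : nat) (t : R) : (c < 2)%nat -> (j < 2)%nat ->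
  amp (/ mu) (/ om ^ 2) c (ks om mu) t j = / mu * coord c (perp (dir t)) * coord j (perp (dir t)).
Proof.
  intros Hc Hj. unfold amp. rewrite ks_sq by assumption.
  transitivity (/ mu * (delta j c - coord j (dir t) * coord c (dir t))); [field; lra|].
  rewrite perp_dir by assumption. ring.
Qed.

Lemma amp_p (c j : nat) (t : R) :
  amp 0 (- / om ^ 2) c (kp om mu lam) t j = / (lam + 2 * mu) * coord c (dir t) * coord j (dir t).
Proof. unfold amp. rewrite kp_sq by assumption. field. split; lra. Qed.

(** Across the normal the form takes the value [(mu + tmu) - tmu = mu], and of the two amplitude
    factors [1/mu] one is left. *)
Lemma form_ss (c c' : nat) (t : R) : (c < 2)%nat -> (c' < 2)%nat ->
  stress_form mu tmu tlam t (amp (/ mu) (/ om ^ 2) c (ks om mu) t) (amp (/ mu) (/ om ^ 2) c' (ks om mu) t)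
  = / mu * (delta c c' - coord c (dir t) * coord c' (dir t)).
Proof.
  intros Hc Hc'. rewrite (stress_form_ext _ _ _ _ _ _ _ _ (fun j => amp_s c j t Hc) (fun j => amp_s c' j t Hc')).
  rewrite perp_dir by assumption. assert (S2 := sin_cos_sq t).
  set (a := coord c (perp (dir t))). set (b := coord c' (perp (dir t))).
  unfold stress_form, dir, perp, coord, fst, snd.
  transitivity (/ mu * / mu * (a * b) * ((mu + tmu) * (sin t * sin t + cos t * cos t)
    - tmu * ((sin t * sin t + cos t * cos t) * (sin t * sin t + cos t * cos t)))); [ring|].
  rewrite S2. field. lra.
Qed.

(** Along the normal the form takes the value [mu + tmu + tlam], which the prescribed sum turns into
    [lam + 2 mu]. *)
Lemma form_pp (c c' : nat) (t : R) :
  stress_form mu tmu tlam t (amp 0 (- / om ^ 2) c (kp om mu lam) t) (amp 0 (- / om ^ 2) c' (kp om mu lam) t)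
  = / (lam + 2 * mu) * (coord c (dir t) * coord c' (dir t)).
Proof.
  rewrite (stress_form_ext _ _ _ _ _ _ _ _ (fun j _ => amp_p c j t) (fun j _ => amp_p c' j t)).
  assert (S2 := sin_cos_sq t).
  set (a := coord c (dir t)). set (b := coord c' (dir t)).
  unfold stress_form, dir, coord, fst, snd.
  transitivity (/ (lam + 2 * mu) * / (lam + 2 * mu) * (a * b) * ((mu + tmu) * (sin t * sin t + cos t * cos t)
    + tlam * ((sin t * sin t + cos t * cos t) * (sin t * sin t + cos t * cos t)))); [ring|].
  rewrite S2. replace tlam with (mu + lam - tmu) by lra. field. lra.
Qed.

(** The polarisations are orthogonal, and each of the two projections in the form annihilates one of
    them. *)
Lemma form_sp (c c' : nat) (t : R) : (c < 2)%nat ->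
  stress_form mu tmu tlam t (amp (/ mu) (/ om ^ 2) c (ks om mu) t) (amp 0 (- / om ^ 2) c' (kp om mu lam) t) = 0.
Proof.
  intros Hc. rewrite (stress_form_ext _ _ _ _ _ _ _ _ (fun j => amp_s c j t Hc) (fun j _ => amp_p c' j t)).
  set (a := coord c (perp (dir t))). set (b := coord c' (dir t)).
  unfold stress_form, dir, perp, coord, fst, snd. ring.
Qed.

Lemma form_ps (c c' : nat) (t : R) : (c' < 2)%nat ->
  stress_form mu tmu tlam t (amp 0 (- / om ^ 2) c (kp om mu lam) t) (amp (/ mu) (/ om ^ 2) c' (ks om mu) t) = 0.
Proof.
  intros Hc. rewrite (stress_form_ext _ _ _ _ _ _ _ _ (fun j _ => amp_p c j t) (fun j => amp_s c' j t Hc)).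
  set (a := coord c (dir t)). set (b := coord c' (perp (dir t))).
  unfold stress_form, dir, perp, coord, fst, snd. ring.
Qed.

Let Ws := phis (ks om mu).
Let Wp := phis (kp om mu lam).
Let Vs := fun n s => Cconj (Ws n s).
Let Vp := fun n s => Cconj (Wp n s).

Definition shear_density (x y : point) (j k : nat) (t : R) : C :=
  (RtoC (delta j k - coord j (dir t) * coord k (dir t)) * expi (ks om mu * dot (sub y x) (dir t)))%C.
Definition pressure_density (x y : point) (j k : nat) (t : R) : C :=
  (RtoC (coord j (dir t) * coord k (dir t)) * expi (kp om mu lam * dot (sub y x) (dir t)))%C.

Definition green_flux (n : point) (x y : point) (j k : nat) : point -> C :=
  flux mu tmu tlam n
    (fun i p => swave om mu Ws x j i p + pwave om Wp x j i p)%C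
    (fun a i p => swave1 om mu Ws x j a i p + pwave1 om Wp x j a i p)%C
    (fun i p => swave om mu Vs y k i p + pwave om Vp y k i p)%C
    (fun a i p => swave1 om mu Vs y k a i p + pwave1 om Vp y k a i p)%C.

(** Because the left factors are transposed, entry [(j, k)] pairs column [j] of Γ(·,x) with column
    [k] of the conjugate of Γ(·,y). *)
Lemma integrand_flux (z x y : point) (j k : nat) :
  (j < 2)%nat -> (k < 2)%nat -> snd x < snd z -> snd y < snd z ->
  entry (submat
     (mulmat (trmat (Pi1 om mu lam tmu tlam (0, 1) z x)) (conjmat (Gamma om mu lam z y)))
     (mulmat (trmat (Gamma om mu lam z x)) (conjmat (Pi1 om mu lam tmu tlam (0, 1) z y)))) j k
  = green_flux (0, 1) x y j k z.
Proof.
  intros Hj Hk Hx Hy. unfold submat. rewrite entry_build by assumption.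
  rewrite !entry_mulmat by assumption. unfold trmat, conjmat.
  rewrite !entry_build by (try assumption; lia).
  rewrite !Pi1_entry by (try assumption; lia). rewrite !Gamma_entry by (try assumption; lia).
  rewrite !Cconj_tr. unfold green_flux, flux, betti.
  assert (Ev : forall i, Cconj (swave om mu Ws y k i z + pwave om Wp y k i z)%C
     = (swave om mu Vs y k i z + pwave om Vp y k i z)%C).
  { intros i. rewrite Cplus_conj. unfold swave, pwave. rewrite !wave_conj. reflexivity. }
  assert (Eh : forall i, tr mu tmu tlam (0, 1) (fun a i => Cconj (swave1 om mu Ws y k a i z + pwave1 om Wp y k a i z)%C) i
     = tr mu tmu tlam (0, 1) (fun a i => swave1 om mu Vs y k a i z + pwave1 om Vp y k a i z)%C i).
  { intros i. apply tr_ext. intros a i'. rewrite Cplus_conj. unfold swave1, pwave1.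
    rewrite !wave1_conj. reflexivity. }
  fold Ws Wp. rewrite !Ev, !Eh. reflexivity.
Qed.

(** Each pure term contributes [i (2k) / (8 pi k)], in which the wave number cancels and
    [2i / (8 pi)] is left. *)
Lemma ulim_green_flux (H : R) (x y : point) (j k : nat) : (j < 2)%nat -> (k < 2)%nat ->
  ulim (fun r t => RtoC r * green_flux (dir t) x y j k (polar H r t))%C
    (fun t => RtoC 2 * Ci * (RtoC (/ (8 * PI)) *
       (RtoC (/ (lam + 2 * mu)) * pressure_density x y j k t + RtoC (/ mu) * shear_density x y j k t)))%C.
Proof.
  intros Hj Hk. assert (HP := PI_RGT_0).
  assert (Ks := ks_pos om mu Hom Hmu). assert (Kp := kp_pos om mu lam Hom Hmu Hlm).
  assert (Rs := phis_radial _ Ks). assert (Rp := phis_radial _ Kp).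
  destruct (phis_outgoing _ Ks) as [As [Os Ns]]. destruct (phis_outgoing _ Kp) as [Ap [Op Np]].
  assert (SS := ulim_pair mu tmu tlam H (/ mu) (/ om ^ 2) _ j _ _ x (/ mu) (/ om ^ 2) _ k _ _ y Rs Os Rs Os).
  assert (PP := ulim_pair mu tmu tlam H 0 (- / om ^ 2) _ j _ _ x 0 (- / om ^ 2) _ k _ _ y Rp Op Rp Op).
  assert (SP := ulim_pair mu tmu tlam H (/ mu) (/ om ^ 2) _ j _ _ x 0 (- / om ^ 2) _ k _ _ y Rs Os Rp Op).
  assert (PS := ulim_pair mu tmu tlam H 0 (- / om ^ 2) _ j _ _ x (/ mu) (/ om ^ 2) _ k _ _ y Rp Op Rs Os).
  (* [ulim_pair] gives the limit with the oscillation removed; as that limit is 0, the oscillation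
     can be restored. *)
  assert (SP0 := ulim_mult_unit (fun r _ => expi ((ks om mu - kp om mu lam) * r)) _ (fun _ => RtoC 0)
    (fun r t => Cmod_expi _) (ulim_limit _ _ _ SP (fun t => cross_zero _ _ _ (form_sp j k t Hj)))).
  assert (PS0 := ulim_mult_unit (fun r _ => expi ((kp om mu lam - ks om mu) * r)) _ (fun _ => RtoC 0)
    (fun r t => Cmod_expi _) (ulim_limit _ _ _ PS (fun t => cross_zero _ _ _ (form_ps j k t Hk)))).
  refine (ulim_ext _ _ _ _ _ _ (ulim_plus _ _ _ _ (ulim_plus _ _ _ _ SS PP) (ulim_plus _ _ _ _ SP0 PS0))).
  - intros r t. cbv beta. unfold green_flux. rewrite flux_plus.
    rewrite !(Cmult_assoc (expi _) (expi _)), !Cexp_mul.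
    assert (E0 : expi 0 = RtoC 1) by (unfold expi; rewrite cos_0, sin_0; reflexivity).
    replace (- ((ks om mu - ks om mu) * r)) with 0 by ring.
    replace (- ((kp om mu lam - kp om mu lam) * r)) with 0 by ring.
    replace ((ks om mu - kp om mu lam) * r + - ((ks om mu - kp om mu lam) * r)) with 0 by ring.
    replace ((kp om mu lam - ks om mu) * r + - ((kp om mu lam - ks om mu) * r)) with 0 by ring.
    rewrite E0. unfold swave, swave1, pwave, pwave1, Vs, Vp, Ws, Wp. ring.
  - intros t. cbv beta.
    rewrite form_ss, form_pp by assumption. rewrite !(phase_product _ _ _ _ _ _ Ns), !(phase_product _ _ _ _ _ _ Np).
    unfold pressure_density, shear_density.
    generalize (expi (ks om mu * dot (sub y x) (dir t))) (expi (kp om mu lam * dot (sub y x) (dir t)))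
      (coord j (dir t)) (coord k (dir t)) (delta j k). intros es ep ej ek d.
    generalize dependent (ks om mu). generalize dependent (kp om mu lam). intros.
    Cfield.
Qed.
End Main.

(** * Integrability and linearity for the limiting densities *)

Lemma continuous_coord_dir (j : nat) (t : R) : continuous (fun t => coord j (dir t)) t.
Proof. destruct j; [apply continuous_cos|apply continuous_sin]. Qed.

Lemma continuous_dot_dir (k : R) (p : point) (t : R) : continuous (fun t => k * dot p (dir t)) t.
Proof.
  eapply is_derive_continuous. unfold dot, dir. simpl. auto_derive; [exact I|reflexivity].
Qed.

Lemma contRC_plane (f h : R -> R) (t : R) : continuous f t -> continuous h t ->
  contRC (fun t => RtoC (f t) * expi (h t))%C t.
Proof.
  intros Hf Hh.
  assert (C : continuous (fun t => cos (h t)) t) by exact (continuous_comp h cos t Hh (continuous_cos _)).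
  assert (S : continuous (fun t => sin (h t)) t) by exact (continuous_comp h sin t Hh (continuous_sin _)).
  split.
  - apply (continuous_ext (fun t => f t * cos (h t))).
    + intros u. simpl. Req. ring.
    + exact (continuous_mult f (fun t => cos (h t)) t Hf C).
  - apply (continuous_ext (fun t => f t * sin (h t))).
    + intros u. simpl. Req. ring.
    + exact (continuous_mult f (fun t => sin (h t)) t Hf S).
Qed.

Lemma continuous_coord2 (j k : nat) (t : R) : continuous (fun t => coord j (dir t) * coord k (dir t)) t.
Proof. exact (continuous_mult _ _ t (continuous_coord_dir j t) (continuous_coord_dir k t)). Qed.

Lemma ex_RInt_pressure (om mu lam : R) (x y : point) (j k : nat) :
  ex_RIntC (pressure_density om mu lam x y j k) 0 PI.
Proof.
  apply ex_RIntC_cont. intros t _.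
  exact (contRC_plane _ _ t (continuous_coord2 j k t) (continuous_dot_dir (kp om mu lam) (sub y x) t)).
Qed.

Lemma ex_RInt_shear (om mu : R) (x y : point) (j k : nat) : ex_RIntC (shear_density om mu x y j k) 0 PI.
Proof.
  apply ex_RIntC_cont. intros t _.
  exact (contRC_plane _ _ t
    (continuous_minus (fun _ => delta j k) _ t (continuous_const _ t) (continuous_coord2 j k t))
    (continuous_dot_dir (ks om mu) (sub y x) t)).
Qed.

Lemma RInt_comb (f g h : R -> R) (c d a b : R) : ex_RInt f a b -> ex_RInt g a b ->
  (forall t, h t = c * f t + d * g t) -> is_RInt h a b (c * RInt f a b + d * RInt g a b).
Proof.
  intros Hf Hg E.
  apply (is_RInt_ext (fun t => c * f t + d * g t)); [intros t _; symmetry; apply E|].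
  apply (is_RInt_plus (V := R_NormedModule) (fun t => c * f t) (fun t => d * g t));
    apply (is_RInt_scal (V := R_NormedModule));
    apply is_RInt_RInt; assumption.
Qed.

Lemma integral_RC_plus (f g : R -> C) (a b : R) : ex_RIntC f a b -> ex_RIntC g a b ->
  ex_RIntC (fun t => f t + g t)%C a b /\
  integral_RC (fun t => f t + g t)%C a b = (integral_RC f a b + integral_RC g a b)%C.
Proof.
  intros F G. assert (F' := F). assert (G' := G). destruct F' as [F1 F2]. destruct G' as [G1 G2].
  assert (K1 := RInt_comb _ _ (fun t => Re (f t + g t)%C) 1 1 a b F1 G1 ltac:(intros; unfold Re, Im; simpl; ring)).
  assert (K2 := RInt_comb _ _ (fun t => Im (f t + g t)%C) 1 1 a b F2 G2 ltac:(intros; unfold Re, Im; simpl; ring)).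
  assert (X : ex_RIntC (fun t => f t + g t)%C a b) by (split; eexists; eassumption).
  split; [exact X|]. rewrite !integral_RC_eq by assumption.
  rewrite (is_RInt_unique _ _ _ _ K1), (is_RInt_unique _ _ _ _ K2).
  apply injective_projections; cbn [fst snd Cplus]; Req; ring.
Qed.

Lemma integral_RC_scal (c : C) (f : R -> C) (a b : R) : ex_RIntC f a b ->
  ex_RIntC (fun t => c * f t)%C a b /\ integral_RC (fun t => c * f t)%C a b = (c * integral_RC f a b)%C.
Proof.
  intros F. assert (F' := F). destruct F' as [F1 F2]. destruct c as [c d].
  assert (K1 := RInt_comb _ _ (fun t => Re ((c, d) * f t)%C) c (- d) a b F1 F2
    ltac:(intros; unfold Re, Im; simpl; ring)).
  assert (K2 := RInt_comb _ _ (fun t => Im ((c, d) * f t)%C) d c a b F1 F2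
    ltac:(intros; unfold Re, Im; simpl; ring)).
  assert (X : ex_RIntC (fun t => (c, d) * f t)%C a b) by (split; eexists; eassumption).
  split; [exact X|]. rewrite !integral_RC_eq by assumption.
  rewrite (is_RInt_unique _ _ _ _ K1), (is_RInt_unique _ _ _ _ K2).
  apply injective_projections; cbn [fst snd Cmult Re Im]; Req; ring.
Qed.

Theorem lemma3p3 :
  forall (om mu lam tmu tlam : R),
    0 < om -> 0 < mu -> 0 <= lam + mu -> tmu + tlam = mu + lam ->
  forall (H : R) (x y : point),
    ~ closure (U H) x -> ~ closure (U H) y ->
    is_improper_integral_T H
      (fun xi =>
         submat
           (mulmat (trmat (Pi1 om mu lam tmu tlam (0, 1) xi x))
                   (conjmat (Gamma om mu lam xi y)))
           (mulmat (trmat (Gamma om mu lam xi x))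
                   (conjmat (Pi1 om mu lam tmu tlam (0, 1) xi y))))
      (scalmat (RtoC 2 * Ci)%C (ImplusGamma om mu lam y x)).
Proof.
  intros om mu lam tmu tlam Hom Hmu Hlm Hsum H x y Hx Hy j k Hj Hk.
  assert (Hx' : snd x < H) by (destruct (Rlt_dec (snd x) H); [assumption|exfalso; apply Hx, closure_U; lra]).
  assert (Hy' : snd y < H) by (destruct (Rlt_dec (snd y) H); [assumption|exfalso; apply Hy, closure_U; lra]).
  (* A common height with no source above it and the line strictly higher; both fields solve the
     Navier equation where [b < p_2]. *)
  set (b := Rmax (snd x) (snd y)).
  assert (HbH : b < H) by (apply Rmax_lub_lt; assumption).
  assert (Rs := phis_radial _ (ks_pos om mu Hom Hmu)).
  assert (Rp := phis_radial _ (kp_pos om mu lam Hom Hmu Hlm)).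
  assert (Nu := navier_total om mu lam Hom Hmu Hlm _ _ b x j Rs Rp Hj (Rmax_l _ _)).
  assert (Nv := navier_total om mu lam Hom Hmu Hlm _ _ b y k (radial_conj _ _ Rs) (radial_conj _ _ Rp) Hk (Rmax_r _ _)).
  assert (Arc := fun r (Hr : 0 < r) => flux_line_arc mu lam tmu tlam om b _ _ _ _ _ _ Hsum Nu Nv H r HbH Hr).
  cbv zeta in Arc.
  set (F := fun t => green_flux om mu lam tmu tlam (0, 1) x y j k (t, H)).
  set (G := fun r t => (RtoC r * green_flux om mu lam tmu tlam (dir t) x y j k (polar H r t))%C).
  change (forall r, 0 < r -> ex_RIntC F (- r) r /\ ex_RIntC (G r) 0 PI /\
    integral_RC F (- r) r = integral_RC (G r) 0 PI) in Arc.
  assert (Lim : ulim G _) by (apply (ulim_green_flux om mu lam tmu tlam Hom Hmu Hlm Hsum H x y j k Hj Hk)).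
  destruct (integral_RC_scal (RtoC (/ (lam + 2 * mu))) _ 0 PI (ex_RInt_pressure om mu lam x y j k)) as [XP EP].
  destruct (integral_RC_scal (RtoC (/ mu)) _ 0 PI (ex_RInt_shear om mu x y j k)) as [XS ES].
  destruct (integral_RC_plus _ _ 0 PI XP XS) as [XPS EPS].
  destruct (integral_RC_scal (RtoC (/ (8 * PI))) _ 0 PI XPS) as [X1 E1].
  destruct (integral_RC_scal (RtoC 2 * Ci)%C _ 0 PI X1) as [X2 E2].
  rewrite E1, EPS, EP, ES in E2.
  assert (EF : forall t, F t = entry (submat
       (mulmat (trmat (Pi1 om mu lam tmu tlam (0, 1) (t, H) x)) (conjmat (Gamma om mu lam (t, H) y)))
       (mulmat (trmat (Gamma om mu lam (t, H) x)) (conjmat (Pi1 om mu lam tmu tlam (0, 1) (t, H) y)))) j k).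
  { intros t. symmetry. apply (integrand_flux om mu lam tmu tlam Hom Hmu Hlm); assumption. }
  split.
  - intros r Hr. apply (ex_RInt_ext (V := C_R_NormedModule) F); [intros t _; apply EF|].
    eexists. exact (is_RInt_C F (- r) r (proj1 (Arc r Hr))).
  - unfold scalmat, ImplusGamma. rewrite !entry_build by assumption. unfold integral_upper_circle.
    (* [E2] evaluates the integral of the limiting density as the claimed entry, so the limit of the
       arc integrals is what remains. *)
    refine (eq_ind _ (fun l => filterlim _ _ (locally l)) _ _ E2).
    refine (filterlim_ext_loc _ _ _ (integral_ulim G _ Lim (fun r Hr => proj1 (proj2 (Arc r Hr))) X2)).
    exists 0. intros r Hr. rewrite <- (proj2 (proj2 (Arc r Hr))). apply integral_RC_ext, EF.
Qed.
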